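(* (a) Let $f\colon P\to Q$ be a cellular map of finite posets, and $Z$ an open subposet of $Q$. If $Q$ is a cell complex with coboundary $Z$, then $P$ is a cell complex with coboundary $f^{-1}(Z)$; when $f$ is surjective, the converse holds. (b) Let $f\colon M\to N$ be a comanifold [resp. pseudo-comanifold] of dimension $m$, where $N^*$ is a cell complex with coboundary $Z^*$ (for a subposet $Z$ of $N$). Then $M$ is an $m$-manifold [resp. $m$-pseudo$^*$-manifold] with boundary $f^{-1}(Z)$.
   Context: All posets are finite; homeomorphisms of polyhedra are PL. For a poset $P$, $|P|$ denotes the polyhedron given by the geometric realization of the simplicial complex $P^\flat$ of nonempty chains of $P$, and $\dim P=\dim|P|$. $P^*$ is $P$ with the opposite order; $p^*$ is $p$ viewed as an element of $P^*$. A subposet $Q\subset P$ is closed (open) if $p\le q\in Q$ (resp. $p\ge q\in Q$) implies $p\in Q$. $\lceil p\rceil=\{q: q\le p\}$, $\partial\lceil p\rceil=\{q: q<p\}$, $\lfloor p\rfloor=\{q: q\ge p\}$, $\partial^*\lfloor p\rfloor=\{q: q>p\}$. $P$ is a sphere if $|P|$ is PL homeomorphic to the boundary of a simplex (possibly empty). $P$ is a ball with boundary $B$ if $B$ is a closed subposet of $P$ and $(|P|,|B|)$ is PL homeomorphic to a simplex and its boundary. $P$ is a manifold with boundary $B$ if $B$ is a (possibly empty) closed subposet of $P$ and $|P|$ is a PL manifold with boundary $|B|$. $P$ is a cell complex if every $\partial\lceil p\rceil$ is a sphere. $P$ is a cell complex with coboundary $Z$ if $Z$ is an open subposet of $P$,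 $(\partial\lceil p\rceil)^*$ is a sphere for each $p\in P\setminus Z$, and a ball with boundary $(\{z\in Z: z<p\})^*$ for each $p\in Z$. $P$ is purely $n$-dimensional if every simplex of $P^\flat$ lies in an $n$-simplex of $P^\flat$. The $1$-skeleton $P^{(1)}$ consists of the minimal elements (atoms) and the elements that cover atoms. A monotone map $f\colon P\to Q$ is cellular if $f^{-1}(\lfloor q\rfloor)$ is a cell complex with coboundary $f^{-1}(\partial^*\lfloor q\rfloor)$ for each $q\in Q$. $P$ is an $n$-pseudo-manifold with coboundary $Z$ if $P$ is purely $n$-dimensional, $P$ is a cell complex with coboundary $Z$, and $(P^* )^{(1)}$ is a cell complex; then $P^*$ is called an $n$-pseudo$^*$-manifold with boundary $Z^*$. A monotone map $g\colon P\to Q$ is a comanifold (resp. pseudo-comanifold) if $g^{-1}(\lceil\sigma\rceil)$ is a manifold (resp. pseudo$^*$-manifold) with boundary $g^{-1}(\partial\lceil\sigma\rceil)$ for each $\sigma\in Q$. If the cones $\lceil\sigma^*\rceil$ of $Q^*$ are pure, $g$ is of dimension $d$ if $g^{-1}(\lceil\sigma\rceil)$ is of dimension $d-i$ for each $\sigma\in Q$ such that the cone $\lceil\sigma^*\rceil$ of $Q^*$ has dimension $i$. (Empty preimages are allowed: the empty poset counts as a [pseudo$^*$-]manifold of every dimension.) *)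

(* Defs.v *)
From HB Require Import structures.
From mathcomp Require Import all_boot all_order all_algebra.
From mathcomp Require Import classical_sets filter reals topology normedtype.

Set Implicit Arguments.
Unset Strict Implicit.
Unset Printing Implicit Defensive.

Import Order.TTheory GRing.Theory Num.Theory.
Import numFieldNormedType.Exports.

Local Open Scope classical_set_scope.
Local Open Scope ring_scope.

Section PL.
Variable R : realType.

Definition convex_polyhedron (n : nat) (C : set 'rV[R]_n) : Prop :=
  exists (k : nat) (A : 'M[R]_(n, k)) (b : 'rV[R]_k),
    C = [set x | forall j, (x *m A) 0 j <= b 0 j].

Definition affine_on (n m : nat) (C : set 'rV[R]_n)
    (f : 'rV[R]_n -> 'rV[R]_m) : Prop :=
  exists (A : 'M[R]_(n, m)) (b : 'rV[R]_m), forall x, C x -> f x = x *m A + b.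

(* Only the values of f on X matter. The pieces are closed and finite in
   number, so that f is continuous on X. For bounded X the pieces are convex
   polytopes, and X is a compact polyhedron. *)
Definition pl_on (n m : nat) (X : set 'rV[R]_n)
    (f : 'rV[R]_n -> 'rV[R]_m) : Prop :=
  exists (k : nat) (C : 'I_k -> set 'rV[R]_n),
    [/\ forall i, convex_polyhedron (C i),
        X = \bigcup_(i in setT) C i
      & forall i, affine_on (C i) f].

Definition pl_homeo (n m : nat) (X : set 'rV[R]_n) (Y : set 'rV[R]_m)
    (h : 'rV[R]_n -> 'rV[R]_m) : Prop :=
  [/\ pl_on X h, (forall x, X x -> Y (h x)) &
    exists g : 'rV[R]_m -> 'rV[R]_n,
      [/\ pl_on Y g, (forall y, Y y -> X (g y)),
          (forall x, X x -> g (h x) = x) & (forall y, Y y -> h (g y) = y)]].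

Definition simplex (n : nat) : set 'rV[R]_n.+1 :=
  [set x | (forall i, 0 <= x 0 i) /\ \sum_i x 0 i = 1].

Definition bd_simplex (n : nat) : set 'rV[R]_n.+1 :=
  [set x | simplex x /\ exists i, x 0 i = 0].

(* Geometric realization, in barycentric coordinates, of an abstract simplicial
   complex K given by its nonempty simplices. *)
Definition realization (T : finType) (K : {set {set T}}) : set 'rV[R]_#|T| :=
  [set x | [/\ forall i, 0 <= x 0 i, \sum_i x 0 i = 1
             & finset (fun t : T => x 0 (enum_rank t) != 0) \in K]].

End PL.

Local Close Scope classical_set_scope.

(* Subposets are represented as subsets A of an ambient finite poset P; all
   the notions below are relative to A with the induced order. *)
Section Posets.
Variables (d : Order.disp_t) (P : finPOrderType d).
Implicit Types (A B Z : {set P}) (p q : P).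

Definition opset A : {set P^d} := [set p : P^d | (p : P) \in A].

Definition closed_in A B : Prop :=
  B \subset A /\ (forall p q, p \in A -> q \in B -> (p <= q)%O -> p \in B).

Definition open_in A B : Prop :=
  B \subset A /\ (forall p q, p \in A -> q \in B -> (q <= p)%O -> p \in B).

Definition cone A p : {set P} := [set q in A | (q <= p)%O].
Definition bd_cone A p : {set P} := [set q in A | (q < p)%O].
Definition dual_cone A p : {set P} := [set q in A | (p <= q)%O].
Definition bd_dual_cone A p : {set P} := [set q in A | (p < q)%O].

Definition chain (c : {set P}) : bool :=
  [forall p in c, forall q in c, (p >=< q)%O].

Definition order_complex A : {set {set P}} :=
  [set c : {set P} | [&& c != finset.set0, c \subset A & chain c]].

(* The empty poset has dimension -1. *)
Definition dim_poset A : int :=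
  (\max_(c in order_complex A) #|c|)%N%:Z - 1.

Definition purely_dim (n : int) A : Prop :=
  forall c, c \in order_complex A ->
    exists c', [/\ c' \in order_complex A, c \subset c' & #|c'|%:Z = n + 1].

Definition pure A : Prop := exists n : int, purely_dim n A.

Definition atom A p : bool := (p \in A) && (bd_cone A p == finset.set0).

Definition covers_in A p q : bool :=
  [&& p \in A, q \in A, (q < p)%O
    & [forall r in A, ~~ ((q < r)%O && (r < p)%O)]].

Definition skel1 A : {set P} :=
  [set p in A | atom A p || [exists q, atom A q && covers_in A p q]].

End Posets.

Section PLPosets.
Variables (R : realType) (d : Order.disp_t) (P : finPOrderType d).
Implicit Types A B : {set P}.

Definition polyhedron A : set 'rV[R]_#|P| := realization (order_complex A).

Definition is_sphere A : Prop :=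
  exists (n : nat) h, pl_homeo (polyhedron A) (@bd_simplex R n) h.

Definition is_ball A B : Prop :=
  closed_in A B /\
  exists (n : nat) h, pl_homeo (polyhedron A) (@simplex R n) h /\
    (forall x, polyhedron A x -> (polyhedron B x <-> bd_simplex (h x))).

(* Every point of |A| has a neighbourhood in |A| that is PL homeomorphic to an
   n-simplex, and it lies in |B| precisely when it goes to the boundary of the
   simplex. The empty poset qualifies for every n, including negative n. *)
Definition is_manifold (n : int) A B : Prop :=
  closed_in A B /\
  forall x, polyhedron A x ->
    exists (k : nat) (U : set 'rV[R]_#|P|) (h : 'rV[R]_#|P| -> 'rV[R]_k.+1),
      [/\ n = k%:Z,
          (U `<=` polyhedron A)%classic,
          within (polyhedron A) (nbhs x) U,
          pl_homeo U (@simplex R k) h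
        & polyhedron B x <-> bd_simplex (h x)].

Definition cell_complex A : Prop :=
  forall p, p \in A -> is_sphere (bd_cone A p).

End PLPosets.

Section Complexes.
Variables (R : realType) (d : Order.disp_t) (P : finPOrderType d).
Implicit Types A Z : {set P}.

Definition cell_complex_cobd A Z : Prop :=
  [/\ open_in A Z,
      forall p, p \in A -> p \notin Z -> is_sphere R (opset (bd_cone A p))
    & forall p, p \in Z ->
        is_ball R (opset (bd_cone A p)) (opset (bd_cone Z p))].

Definition pseudo_manifold (n : int) A Z : Prop :=
  [/\ purely_dim n A, cell_complex_cobd A Z
    & cell_complex R (skel1 (opset A))].

End Complexes.

Definition pseudostar_manifold (R : realType) (d : Order.disp_t)
    (P : finPOrderType d) (n : int) (A B : {set P}) : Prop :=
  pseudo_manifold R n (opset A) (opset B).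

Section Maps.
Variables (R : realType) (d d' : Order.disp_t).
Variables (P : finPOrderType d) (Q : finPOrderType d').
Implicit Type f : P -> Q.

Definition monotone f : Prop := {homo f : x y / (x <= y)%O}.

Definition cellular f : Prop :=
  monotone f /\
  forall q : Q, cell_complex_cobd R
    (f @^-1: dual_cone [set: Q] q) (f @^-1: bd_dual_cone [set: Q] q).

Definition pure_dual_cones : Prop :=
  forall s : Q^d, pure (cone [set: Q^d] s).

Definition comanifold_of_dim f (m : int) : Prop :=
  [/\ monotone f, pure_dual_cones
    & forall s : Q, is_manifold R (m - dim_poset (cone [set: Q^d] (s : Q^d)))
        (f @^-1: cone [set: Q] s) (f @^-1: bd_cone [set: Q] s)].

Definition pseudo_comanifold_of_dim f (m : int) : Prop :=
  [/\ monotone f, pure_dual_cones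
    & forall s : Q,
        pseudostar_manifold R (m - dim_poset (cone [set: Q^d] (s : Q^d)))
        (f @^-1: cone [set: Q] s) (f @^-1: bd_cone [set: Q] s)].

End Maps.

(* Main.v *)
From HB Require Import structures.
From mathcomp Require Import all_boot all_order all_algebra.
From mathcomp Require Import ring lra.
From mathcomp Require Import boolp classical_sets filter reals topology normedtype.
From mathcomp Require Import fintype finset.
Require Import Defs.

(** Write K(A) for the cone over the polyhedron |A|, that is, the set of the
    nonnegative vectors indexed by the poset whose support is a chain of A.
    Homogenisation turns PL maps of polyhedra into positively homogeneous PL
    maps of their cones, and a homeomorphism of cones that preserves the sum of
    the coordinates restricts to a PL homeomorphism of polyhedra
    ([cone_of_pl_homeo], [pl_homeo_of_cone]). Joins of polyhedra become products
    of cones. The cones over a simplex and over its boundary are an orthant and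
    its boundary; that the join of two spheres is a sphere, and the join of a
    sphere and a ball a ball, is then one explicit piecewise linear map
    ([join_orthant]).

    Both halves of the theorem rest on one statement ([fibration]). Let Q be a
    poset and let T assign conical sets to its closed subsets, compatibly with
    unions and intersections, so that for each q the set T over the closed cone
    of q is the product of T over its boundary with a half-line (a collar, that
    is, a cone with T over the boundary as its base). Then T(Q) is homeomorphic
    to T(empty) x K(Q), compatibly with closed subsets. The homeomorphism is
    built by adding one element of Q at a time. No obstruction arises, because a
    homeomorphism between the bases of two cones extends to the cones.

    For a cellular map f and p in P, let T(E) be the cone over the elements
    below p whose image is f(p) or lies in E. The hypothesis says that the pieces
    of T are balls, hence cones over their boundaries, and that T(empty) is the
    cone over a sphere S. So the boundary of the cone of p is the join of S with
    the boundary of the cone of f(p) ([cellular_below]). This gives the direct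
    implication; for the converse, S is empty when p is minimal in its fibre.

    For a comanifold f and a point x of |M|, let e be the largest element of the
    chain that carries x, and let T(E) be the tangent cone at x of the part of M
    that maps below f(e) or into E. The manifold charts have derivatives at x,
    which are homeomorphisms of tangent cones. The point x is interior over f(e),
    so T(empty) is a vector space; over a larger element x lies on the boundary,
    so the tangent cone there is a half-space, collared by its boundary. Hence
    the tangent cone of |M| at x is a vector space times the cone over the
    elements above f(e), which form a sphere or a ball. It is therefore a vector
    space or a half-space, and multiplying by a small scalar makes such an
    identification into a chart ([chart_of_tangent]). Two classical facts are needed in
    their PL form. Charts at different points agree on what the boundary is,
    because no PL homeomorphism takes a corner to a vector space
    ([corner_not_flat]); and the dimension of a sphere that realises a poset is
    given by the longest chain ([has_rank_chomeo]).

    The pseudo-manifold case is formal: the cell complex condition is the first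
    half of the theorem for the dual map, and the conditions on dimension and on
    the skeleton can be tested over the cone of a single element of N. *)

Set Implicit Arguments.
Unset Strict Implicit.
Unset Printing Implicit Defensive.

Import Order.TTheory GRing.Theory Num.Theory.
Import numFieldNormedType.Exports.

Local Open Scope ring_scope.

(** * Conical piecewise linear maps *)

Section Conical.
Variable R : realType.

Definition polycone n (C : set 'rV[R]_n) : Prop :=
  exists (k : nat) (A : 'M[R]_(n, k)), forall x, C x <-> forall j, (x *m A) 0 j <= 0.

Lemma linear_mulmx n m (f : 'rV[R]_n -> 'rV[R]_m) :
  linear f -> exists A : 'M[R]_(n, m), forall x, f x = x *m A.
Proof.
move=> flin; pose F := GRing.isLinear.Build R 'rV[R]_n 'rV[R]_m *:%R f flin.
pose L : {linear 'rV[R]_n -> 'rV[R]_m} := HB.pack f F.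
by exists (lin1_mx L) => x; rewrite mul_rV_lin1.
Qed.

Lemma linear_mul n m (A : 'M[R]_(n, m)) : linear (fun x : 'rV[R]_n => x *m A).
Proof. by move=> a u v; rewrite mulmxDl scalemxAl. Qed.

Lemma scalar_mul n m (A : 'M[R]_(n, m)) j : scalar (fun x : 'rV[R]_n => (x *m A) 0 j).
Proof. by move=> a u v; rewrite mulmxDl -scalemxAl !mxE. Qed.

Lemma polycone_le n (J : finType) (l : J -> 'rV[R]_n -> R) :
  (forall j, scalar (l j)) -> polycone [set x | forall j, l j x <= 0]%classic.
Proof.
move=> llin; have [|A HA] := @linear_mulmx n #|J| (fun x => \row_j l (enum_val j) x).
  by move=> a u v; apply/rowP => j; rewrite !mxE llin.
exists #|J|, A => x /=; split=> Hx j; first by rewrite -HA mxE.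
by have := Hx (enum_rank j); rewrite -HA mxE enum_rankK.
Qed.

Lemma polycone_ext n (C D : set 'rV[R]_n) :
  polycone C -> (forall x, C x <-> D x) -> polycone D.
Proof. by move=> [k [A CA]] CD; exists k, A => x; rewrite -CD. Qed.

Lemma polyconeT n : polycone (fun _ : 'rV[R]_n => True).
Proof. by exists 0, 0 => x; split=> // _ []. Qed.

Lemma polycone_half n (l : 'rV[R]_n -> R) :
  scalar l -> polycone (fun x => l x <= 0).
Proof.
move=> ll; apply: (polycone_ext (polycone_le (fun _ : unit => ll))) => x /=.
by split=> [/(_ tt)|].
Qed.

Lemma polyconeI n (C D : set 'rV[R]_n) :
  polycone C -> polycone D -> polycone (fun x => C x /\ D x).
Proof.
move=> [k [A CA]] [k' [B DB]]; exists (k + k')%N, (row_mx A B) => x.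
rewrite CA DB mul_mx_row; split=> [[HA HB] j|H].
  by rewrite mxE; case: splitP => i _.
split=> j; first by have := H (lshift _ j); rewrite row_mxEl.
by have := H (rshift _ j); rewrite row_mxEr.
Qed.

Lemma polycone_forall n (J : finType) (C : J -> set 'rV[R]_n) :
  (forall j, polycone (C j)) -> polycone (fun x => forall j, C j x).
Proof.
move=> HC; have : polycone (fun x => forall j, j \in enum J -> C j x).
  elim: (enum J) => [|a r IH]; first by apply: polycone_ext (polyconeT n) _.
  apply: polycone_ext (polyconeI (HC a) IH) _ => x; split=> [[Ca Cr] j|H].
    by rewrite inE => /orP[/eqP ->|/Cr].
  by split=> [|j jr]; apply: H; rewrite inE ?eqxx ?jr ?orbT.
by move/polycone_ext; apply=> x; split=> H j // ; apply: H; rewrite mem_enum.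
Qed.

Lemma polycone_preim n m (f : 'rV[R]_n -> 'rV[R]_m) (C : set 'rV[R]_m) :
  linear f -> polycone C -> polycone (fun x => C (f x)).
Proof.
move=> /linear_mulmx[A fA] [k [B CB]]; exists k, (A *m B) => x.
by rewrite CB fA mulmxA.
Qed.

Lemma polycone_eq0 n (l : 'rV[R]_n -> R) :
  scalar l -> polycone (fun x => l x = 0).
Proof.
move=> ll; have nl : scalar (fun x => - l x) by move=> a u v; rewrite ll; ring.
apply: polycone_ext (polyconeI (polycone_half ll) (polycone_half nl)) _ => x.
by split=> [[]|->]; rewrite ?oppr0; lra.
Qed.

Lemma polyconeZ n (C : set 'rV[R]_n) t x : polycone C -> 0 <= t -> C x -> C (t *: x).
Proof.
move=> [k [A CA]] t0 /CA Cx; apply/CA => j.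
by rewrite -scalemxAl mxE mulr_ge0_le0.
Qed.

Lemma polyconeZ_iff n (C : set 'rV[R]_n) t x : polycone C -> 0 < t ->
  (C (t *: x) <-> C x).
Proof.
move=> PC t0; split=> [|Cx]; last by apply: polyconeZ => //; apply: ltW.
move=> /(@polyconeZ _ _ t^-1 _ PC); rewrite scalerA mulVf ?gt_eqF // scale1r.
by apply; rewrite invr_ge0 ltW.
Qed.

(** The pieces are cones with apex 0, so such a map is positively homogeneous.
    They are closed and finite in number, which makes the map continuous on X,
    and lets maps be glued without any condition besides agreement on overlaps. *)
Definition cpl_on n m (X : set 'rV[R]_n) (f : 'rV[R]_n -> 'rV[R]_m) : Prop :=
  exists (J : finType) (C : J -> set 'rV[R]_n) (A : J -> 'M[R]_(n, m)),
    [/\ forall j, polycone (C j), forall x, X x <-> exists j, C j x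
      & forall j x, C j x -> f x = x *m A j].

Lemma cpl_pieces n m (J : finType) (C : J -> set 'rV[R]_n)
    (F : J -> 'rV[R]_n -> 'rV[R]_m) (X : set 'rV[R]_n) f :
    (forall j, polycone (C j)) -> (forall j, linear (F j)) ->
    (forall x, X x <-> exists j, C j x) -> (forall j x, C j x -> f x = F j x) ->
  cpl_on X f.
Proof.
move=> HC HF XC fF; have [A HA] := choice (fun j => linear_mulmx (HF j)).
by exists J, C, A; split=> // j x /[dup] Cx /fF ->.
Qed.

Lemma cpl_ext n m (X Y : set 'rV[R]_n) (f g : 'rV[R]_n -> 'rV[R]_m) :
  cpl_on X f -> (forall x, X x <-> Y x) -> (forall x, X x -> f x = g x) ->
  cpl_on Y g.
Proof.
move=> [J [C [A [HC XC fA]]]] XY fg; exists J, C, A; split=> // [x|j x Cx].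
  by rewrite -XY.
by rewrite -fg ?(fA j) //; apply/XC; exists j.
Qed.

Lemma cpl_homo n m (X : set 'rV[R]_n) (f : 'rV[R]_n -> 'rV[R]_m) t x :
  cpl_on X f -> 0 <= t -> X x -> X (t *: x) /\ f (t *: x) = t *: f x.
Proof.
move=> [J [C [A [HC XC fA]]]] t0 /XC[j Cx].
have Ctx := polyconeZ (HC j) t0 Cx; split; first by apply/XC; exists j.
by rewrite !(fA j) // scalemxAl.
Qed.

Lemma cpl_comp n m k (X : set 'rV[R]_n) (Y : set 'rV[R]_m)
    (f : 'rV[R]_n -> 'rV[R]_m) (g : 'rV[R]_m -> 'rV[R]_k) :
  cpl_on X f -> cpl_on Y g -> cpl_on (fun x => X x /\ Y (f x)) (g \o f).
Proof.
move=> [J [C [A [HC XC fA]]]] [J' [C' [A' [HC' YC gA]]]].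
exists (J * J')%type, (fun p x => C p.1 x /\ C' p.2 (x *m A p.1)),
  (fun p => A p.1 *m A' p.2); split=> [[j j']|x|[j j'] x [/= Cx C'x]] /=.
- by apply: polyconeI => //; apply: polycone_preim => //; apply: linear_mul.
- split=> [[/XC[j Cx] /YC[j' C'x]]|[[j j'] /= [Cx C'x]]].
    by exists (j, j'); rewrite -(fA j).
  by split; [apply/XC; exists j|apply/YC; exists j'; rewrite (fA j)].
- by rewrite (fA j) // (gA j') // mulmxA.
Qed.

Lemma cpl_comp_to n m k (X : set 'rV[R]_n) (Y : set 'rV[R]_m)
    (f : 'rV[R]_n -> 'rV[R]_m) (g : 'rV[R]_m -> 'rV[R]_k) :
  cpl_on X f -> cpl_on Y g -> (forall x, X x -> Y (f x)) -> cpl_on X (g \o f).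
Proof.
move=> Xf Yg XY; apply: cpl_ext (cpl_comp Xf Yg) _ _ => // x.
by split=> [[]|Xx] //; split=> //; apply: XY.
Qed.

Lemma cpl_lin n m (X : set 'rV[R]_n) (f : 'rV[R]_n -> 'rV[R]_m) :
  cpl_on X idfun -> linear f -> cpl_on X f.
Proof.
move=> [J [C [A [HC XC _]]]] flin.
by apply: (@cpl_pieces n m J C (fun _ => f)).
Qed.

Lemma cpl_id n m (X : set 'rV[R]_n) (f : 'rV[R]_n -> 'rV[R]_m) :
  cpl_on X f -> cpl_on X idfun.
Proof.
move=> [J [C [A [HC XC _]]]].
by apply: (@cpl_pieces n n J C (fun _ => idfun)).
Qed.

Lemma cpl_polycone n (C : set 'rV[R]_n) : polycone C -> cpl_on C idfun.
Proof.
move=> HC; apply: (@cpl_pieces n n unit (fun _ => C) (fun _ => idfun)) => //.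
by move=> x; split=> [|[]] //; exists tt.
Qed.

Lemma cpl_sub n m (X Y : set 'rV[R]_n) (f : 'rV[R]_n -> 'rV[R]_m) :
  cpl_on X f -> cpl_on Y idfun -> (forall x, Y x -> X x) -> cpl_on Y f.
Proof. by move=> Xf Yi YX; apply: cpl_comp_to Yi Xf YX. Qed.

Lemma cpl_setI n (X Y : set 'rV[R]_n) :
  cpl_on X idfun -> cpl_on Y idfun -> cpl_on (fun x => X x /\ Y x) idfun.
Proof. by move=> Xi Yi; have := cpl_comp Xi Yi. Qed.

Lemma cpl_preim n m (X : set 'rV[R]_n) (Y : set 'rV[R]_m) f :
  cpl_on X f -> cpl_on Y idfun -> cpl_on (fun x => X x /\ Y (f x)) idfun.
Proof. by move=> Xf Yi; apply: cpl_id (cpl_comp Xf Yi). Qed.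

Lemma cpl_setU n m (X Y : set 'rV[R]_n) (f : 'rV[R]_n -> 'rV[R]_m) :
  cpl_on X f -> cpl_on Y f -> cpl_on (fun x => X x \/ Y x) f.
Proof.
move=> [J [C [A [HC XC fA]]]] [J' [C' [A' [HC' YC fA']]]].
exists (J + J')%type, (fun p => match p with inl j => C j | inr j => C' j end),
  (fun p => match p with inl j => A j | inr j => A' j end).
split=> [[]|x|[]] //; rewrite XC YC; split.
  by case=> -[j Cx]; [exists (inl j)|exists (inr j)].
by case=> -[j|j] Cx; [left|right]; exists j.
Qed.

Lemma cpl_pair n m k (X : set 'rV[R]_n) (f : 'rV[R]_n -> 'rV[R]_m)
    (g : 'rV[R]_n -> 'rV[R]_k) :
  cpl_on X f -> cpl_on X g -> cpl_on X (fun x => row_mx (f x) (g x)).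
Proof.
move=> [J [C [A [HC XC fA]]]] [J' [C' [A' [HC' XC' gA]]]].
exists (J * J')%type, (fun p x => C p.1 x /\ C' p.2 x),
  (fun p => row_mx (A p.1) (A' p.2)); split=> [[j j']|x|[j j'] x [/= Cx C'x]] /=.
- exact: polyconeI.
- split=> [Xx|[[j j'] /= [Cx _]]]; last by apply/XC; exists j.
  by have [j Cx] := (XC x).1 Xx; have [j' Cx'] := (XC' x).1 Xx; exists (j, j').
- by rewrite (fA j) // (gA j') // mul_mx_row.
Qed.

Lemma mulmx_bound n m (A : 'M[R]_(n, m)) :
  exists2 K, 0 < K & forall (x : 'rV[R]_n) d, 0 <= d -> (forall i, `|x 0 i| <= d) ->
    forall i, `|(x *m A) 0 i| <= K * d.
Proof.
exists (1 + \sum_i \sum_l `|A i l|).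
  by rewrite ltr_wpDr // sumr_ge0 // => i _; rewrite sumr_ge0.
move=> x d d0 xd l; rewrite mxE.
have Hl : forall i, `|A i l| <= \sum_l `|A i l|.
  by move=> i; rewrite (bigD1 l) //= ler_wpDr // sumr_ge0.
apply: le_trans (ler_norm_sum _ _ _) _; rewrite mulrDl mul1r mulr_suml.
apply: le_trans (_ : \sum_i (\sum_l `|A i l|) * d <= _); last by rewrite lerDr.
apply: ler_sum => i _; rewrite normrM mulrC ler_pM //.
Qed.

Lemma cpl_lipschitz n m (X : set 'rV[R]_n) (f : 'rV[R]_n -> 'rV[R]_m) :
  cpl_on X f -> exists2 K, 0 < K & forall x d, 0 <= d -> X x ->
    (forall i, `|x 0 i| <= d) -> forall i, `|f x 0 i| <= K * d.
Proof.
move=> [J [C [A [_ XC fA]]]].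
have /choice[K HK] : forall j, exists K, 0 < K /\ forall (x : 'rV[R]_n) d, 0 <= d ->
    (forall i, `|x 0 i| <= d) -> forall i, `|(x *m A j) 0 i| <= K * d.
  by move=> j; have [K K0 HK] := mulmx_bound (A j); exists K.
exists (1 + \sum_j K j).
  by rewrite ltr_wpDr // sumr_ge0 // => j _; apply: ltW (HK j).1.
move=> x d d0 /XC[j Cx] xd i; rewrite (fA j) //.
apply: le_trans ((HK j).2 x d d0 xd i) _; apply: ler_wpM2r => //.
rewrite (bigD1 j) //= addrCA lerDl addr_ge0 // sumr_ge0 // => j' _.
exact: ltW (HK j').1.
Qed.

(** * Homeomorphisms that preserve a gauge *)

(** With the sum of the coordinates as gauges, these are the cones over PL
    homeomorphisms of compact polyhedra. With zero gauges they identify germs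
    only: a homeomorphism of cones need not respect any chosen slice. *)
Definition chomeo n m (s : 'rV[R]_n -> R) (s' : 'rV[R]_m -> R)
    (X : set 'rV[R]_n) (Y : set 'rV[R]_m) h g : Prop :=
  [/\ cpl_on X h, cpl_on Y g,
      forall x, X x -> [/\ Y (h x), g (h x) = x & s' (h x) = s x]
    & forall y, Y y -> X (g y) /\ h (g y) = y].

Section Homeo.
Variables (n m : nat) (s : 'rV[R]_n -> R) (s' : 'rV[R]_m -> R).
Variables (X : set 'rV[R]_n) (Y : set 'rV[R]_m).
Variables (h : 'rV[R]_n -> 'rV[R]_m) (g : 'rV[R]_m -> 'rV[R]_n).
Hypothesis hg : chomeo s s' X Y h g.

Lemma chomeo_sym : chomeo s' s Y X g h.
Proof.
case: hg => Xh Yg XY YX; split=> // [y /[dup] Yy /YX[Xg hgy]|x /XY[]//].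
by split=> //; have [_ _ <-] := XY _ Xg; rewrite hgy.
Qed.

Lemma chomeo_sub (X' : set 'rV[R]_n) (Y' : set 'rV[R]_m) :
  cpl_on Y' idfun -> (forall x, X' x -> X x) -> (forall y, Y' y -> Y y) ->
  (forall x, X x -> (X' x <-> Y' (h x))) -> chomeo s s' X' Y' h g.
Proof.
case: hg => Xh Yg XY YX Y'i X'X Y'Y X'Y'.
have X'i : cpl_on X' idfun.
  apply: cpl_ext (cpl_preim Xh Y'i) _ _ => // x; split=> [[Xx]|X'x].
    exact: (X'Y' x Xx).2.
  by have Xx := X'X x X'x; split=> //; apply: (X'Y' x Xx).1.
split; [exact: cpl_sub Xh X'i X'X|exact: cpl_sub Yg Y'i Y'Y| |] => x.
  by move=> X'x; have [Yhx ghx shx] := XY x (X'X x X'x); split=> //;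
    apply: (X'Y' x (X'X x X'x)).1.
move=> Y'x; have [Xg hgx] := YX x (Y'Y x Y'x); split=> //.
by apply: (X'Y' _ Xg).2; rewrite hgx.
Qed.

End Homeo.

Lemma chomeo_trans n m k (s : 'rV[R]_n -> R) (s' : 'rV[R]_m -> R)
    (s'' : 'rV[R]_k -> R) X Y Z h g h' g' :
  chomeo s s' X Y h g -> chomeo s' s'' Y Z h' g' ->
  chomeo s s'' X Z (h' \o h) (g \o g').
Proof.
move=> [Xh Yg XY YX] [Yh Zg YZ ZY]; split=> [||x Xx|z Zz] /=.
- by apply: (cpl_comp_to Xh Yh) => x /XY[].
- by apply: (cpl_comp_to Zg Yg) => x /ZY[].
- have [Yh' ghx shx] := XY x Xx; have [Zhx gh'x shx'] := YZ _ Yh'.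
  by split=> //; rewrite ?gh'x ?shx'.
- have [Yg' hgz] := ZY z Zz; have [Xg hgz'] := YX _ Yg'.
  by split=> //; rewrite hgz'.
Qed.

Lemma chomeo_ext n m (s s1 : 'rV[R]_n -> R) (s' s1' : 'rV[R]_m -> R)
    X X1 Y Y1 h g :
  chomeo s s' X Y h g -> (forall x, X x <-> X1 x) -> (forall y, Y y <-> Y1 y) ->
  (forall x, X x -> s x = s1 x) -> (forall y, Y y -> s' y = s1' y) ->
  chomeo s1 s1' X1 Y1 h g.
Proof.
move=> [Xh Yg XY YX] XX1 YY1 ss1 ss1'; split.
- by apply: cpl_ext Xh _ _.
- by apply: cpl_ext Yg _ _.
- by move=> x /XX1 Xx; have [Yh gh sh] := XY x Xx; split=> //; [apply/YY1|rewrite -ss1' // -ss1].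
- by move=> y /YY1 Yy; have [Xg hgy] := YX y Yy; split=> //; apply/XX1.
Qed.

Lemma chomeo_ungauge n m (s : 'rV[R]_n -> R) (s' : 'rV[R]_m -> R) X Y h g :
  chomeo s s' X Y h g -> chomeo (fun=> 0) (fun=> 0) X Y h g.
Proof. by move=> [Xh Yg XY YX]; split=> // x /XY[]. Qed.

Lemma chomeo_lin n m (s : 'rV[R]_n -> R) (s' : 'rV[R]_m -> R) X Y h g :
  cpl_on X idfun -> cpl_on Y idfun -> linear h -> linear g ->
  (forall x, X x -> [/\ Y (h x), g (h x) = x & s' (h x) = s x]) ->
  (forall y, Y y -> X (g y) /\ h (g y) = y) ->
  chomeo s s' X Y h g.
Proof. by move=> Xi Yi hl gl XY YX; split=> //; apply: cpl_lin. Qed.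

Lemma chomeo_id n (s : 'rV[R]_n -> R) X : cpl_on X idfun -> chomeo s s X X idfun idfun.
Proof. by move=> Xi; split. Qed.

Lemma chomeo_glue n m (s : 'rV[R]_n -> R) (s' : 'rV[R]_m -> R)
    X1 Y1 h1 g1 X2 Y2 h2 g2 :
  chomeo s s' X1 Y1 h1 g1 -> chomeo s s' X2 Y2 h2 g2 ->
  (forall x, X1 x -> X2 x -> h1 x = h2 x) ->
  (forall y, Y1 y -> Y2 y -> g1 y = g2 y) ->
  exists h g, [/\ chomeo s s' (fun x => X1 x \/ X2 x) (fun y => Y1 y \/ Y2 y) h g,
    forall x, X1 x -> h x = h1 x & forall x, X2 x -> h x = h2 x].
Proof.
move=> [Xh1 Yg1 XY1 YX1] [Xh2 Yg2 XY2 YX2] h12 g12.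
pose h x := if pselect (X1 x) then h1 x else h2 x.
pose g y := if pselect (Y1 y) then g1 y else g2 y.
have hh1 : forall x, X1 x -> h x = h1 x by move=> x; rewrite /h; case: pselect.
have hh2 : forall x, X2 x -> h x = h2 x.
  by move=> x X2x; rewrite /h; case: pselect => // X1x; apply: h12.
have gg1 : forall y, Y1 y -> g y = g1 y by move=> y; rewrite /g; case: pselect.
have gg2 : forall y, Y2 y -> g y = g2 y.
  by move=> y Y2y; rewrite /g; case: pselect => // Y1y; apply: g12.
exists h, g; split=> //; split.
- apply: cpl_setU; first by apply: cpl_ext Xh1 _ _ => // x Xx; rewrite hh1.
  by apply: cpl_ext Xh2 _ _ => // x Xx; rewrite hh2.
- apply: cpl_setU; first by apply: cpl_ext Yg1 _ _ => // x Xx; rewrite gg1.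
  by apply: cpl_ext Yg2 _ _ => // x Xx; rewrite gg2.
- move=> x [] Xx; first by have [Yh ghx shx] := XY1 x Xx; rewrite hh1 // gg1 //; split=> //; left.
  by have [Yh ghx shx] := XY2 x Xx; rewrite hh2 // gg2 //; split=> //; right.
- move=> y [] Yy; first by have [Xg hgy] := YX1 y Yy; rewrite gg1 // hh1 //; split=> //; left.
  by have [Xg hgy] := YX2 y Yy; rewrite gg2 // hh2 //; split=> //; right.
Qed.

(** * Products and collars *)

Definition prodc n m (X : set 'rV[R]_n) (Y : set 'rV[R]_m) : set 'rV[R]_(n + m) :=
  fun z => X (lsubmx z) /\ Y (rsubmx z).

Definition sum_gauge n m (s : 'rV[R]_n -> R) (s' : 'rV[R]_m -> R) (z : 'rV[R]_(n + m)) :=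
  s (lsubmx z) + s' (rsubmx z).

Lemma linear_lsub n m : linear (fun z : 'rV[R]_(n + m) => lsubmx z).
Proof. by move=> a u v; apply/rowP => i; rewrite !mxE. Qed.

Lemma linear_rsub n m : linear (fun z : 'rV[R]_(n + m) => rsubmx z).
Proof. by move=> a u v; apply/rowP => i; rewrite !mxE. Qed.

Lemma cpl_full n : cpl_on (fun _ : 'rV[R]_n => True) idfun.
Proof. by apply: cpl_polycone; apply: polyconeT. Qed.

Lemma cpl_prod n m (X : set 'rV[R]_n) (Y : set 'rV[R]_m) :
  cpl_on X idfun -> cpl_on Y idfun -> cpl_on (prodc X Y) idfun.
Proof.
move=> Xi Yi; have L : cpl_on (fun z : 'rV[R]_(n + m) => True) idfun := @cpl_full _.
apply: cpl_ext (cpl_setI (cpl_preim (cpl_lin L (@linear_lsub n m)) Xi)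
                         (cpl_preim (cpl_lin L (@linear_rsub n m)) Yi)) _ _ => // z.
by split=> [[[_ Xz] [_ Yz]]|[Xz Yz]].
Qed.

Lemma chomeo_prod n m n' m' (s : 'rV[R]_n -> R) (s' : 'rV[R]_m -> R)
    (t : 'rV[R]_n' -> R) (t' : 'rV[R]_m' -> R) X Y h g X' Y' h' g' :
  chomeo s s' X Y h g -> chomeo t t' X' Y' h' g' ->
  chomeo (sum_gauge s t) (sum_gauge s' t') (prodc X X') (prodc Y Y')
    (fun z => row_mx (h (lsubmx z)) (h' (rsubmx z)))
    (fun z => row_mx (g (lsubmx z)) (g' (rsubmx z))).
Proof.
move=> [Xh Yg XY YX] [Xh' Yg' XY' YX'].
have XX' := cpl_prod (cpl_id Xh) (cpl_id Xh').
have YY' := cpl_prod (cpl_id Yg) (cpl_id Yg').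
split.
- apply: cpl_pair.
    by apply: (cpl_comp_to (cpl_lin XX' (@linear_lsub _ _)) Xh) => x [].
  by apply: (cpl_comp_to (cpl_lin XX' (@linear_rsub _ _)) Xh') => x [].
- apply: cpl_pair.
    by apply: (cpl_comp_to (cpl_lin YY' (@linear_lsub _ _)) Yg) => x [].
  by apply: (cpl_comp_to (cpl_lin YY' (@linear_rsub _ _)) Yg') => x [].
- move=> z [/XY[Yh gh sh] /XY'[Yh' gh' sh']].
  by rewrite /prodc /sum_gauge !row_mxKl !row_mxKr gh gh' sh sh' hsubmxK.
- move=> z [/YX[Xg hgz] /YX'[Xg' hgz']].
  by rewrite /prodc !row_mxKl !row_mxKr hgz hgz' hsubmxK.
Qed.

Definition halfline : set 'rV[R]_1 := fun t => 0 <= t 0 0.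

Definition scale_gauge (w : R) (t : 'rV[R]_1) := w * t 0 0.

Lemma scalar_coord n (i : 'I_n) : scalar (fun x : 'rV[R]_n => x 0 i).
Proof. by move=> a u v; rewrite !mxE. Qed.

Lemma cpl_halfline : cpl_on halfline idfun.
Proof.
apply: cpl_polycone; apply: (@polycone_ext _ (fun t => - t 0 0 <= 0)).
  by apply: polycone_half => a u v; rewrite !mxE; ring.
by move=> x; rewrite /halfline oppr_le0.
Qed.

(** T is a cone with base B: the product of the cone over a polyhedron with a
    half-line is the cone over a cone. The number w is the gauge of the unit
    vector of the half-line: 1 for cones over polyhedra, 0 for germs. *)
Definition collared w n (s : 'rV[R]_n -> R) (T B : set 'rV[R]_n) : Prop :=
  (forall x, B x -> T x) /\
  exists h g, chomeo s (sum_gauge s (scale_gauge w)) T (prodc B halfline) h g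
    /\ forall b, B b -> h b = row_mx b 0.

Lemma collared_base w n (s : 'rV[R]_n -> R) T B : collared w s T B -> cpl_on B idfun.
Proof.
move=> [BT [h [g [[Th Bg TB BT'] hB]]]].
have H : linear (fun x : 'rV[R]_n => row_mx x (0 : 'rV[R]_1)).
  by move=> a u v; apply/rowP => i; rewrite !mxE; case: splitP => j _; rewrite !mxE; ring.
apply: cpl_ext (cpl_preim (cpl_lin (@cpl_full _) H) (cpl_id Bg)) _ _ => // x.
rewrite /prodc row_mxKl row_mxKr /halfline mxE lexx.
by split=> [[_ []]|].
Qed.

Lemma collared_sub w n (s : 'rV[R]_n -> R) T B T' B' :
  collared w s T B -> (forall x, T x <-> T' x) -> (forall x, B x <-> B' x) ->
  collared w s T' B'.
Proof.
move=> [BT [h [g [hgT hB]]]] TT' BB'; split=> [x /BB'/BT/TT'//|].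
exists h, g; split=> [|b /BB'/hB//]; apply: chomeo_ext hgT _ _ _ _ => // y.
by rewrite /prodc BB'.
Qed.

Lemma collared_transport w n m (s : 'rV[R]_n -> R) (s' : 'rV[R]_m -> R) T B T' B' h g :
  chomeo s s' T T' h g -> (forall x, B x -> T x) ->
  (forall x, T x -> (B x <-> B' (h x))) -> collared w s' T' B' -> collared w s T B.
Proof.
move=> TT' BT BB' HB; have [B'T' [h' [g' [hg' hB']]]] := HB.
have hgB := chomeo_sub TT' (collared_base HB) BT B'T' BB'.
have hgB' := chomeo_sym (chomeo_prod hgB (chomeo_id (scale_gauge w) cpl_halfline)).
split=> //; do 2!eexists; split; first exact: chomeo_trans (chomeo_trans TT' hg') hgB'.
move=> b Bb /=; have Tb := BT b Bb.
have [_ _ XY _] := hgB; have [B'b ghb _] := XY _ Bb.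
by rewrite hB' // row_mxKl row_mxKr ghb.
Qed.

End Conical.

(** * Orthants and their joins *)

Section Orthants.
Variable R : realType.

Definition total n (x : 'rV[R]_n) := \sum_i x 0 i.

Lemma scalar_total n : scalar (@total n).
Proof.
move=> a u v; rewrite /total mulr_sumr -big_split /=.
by apply: eq_bigr => i _; rewrite !mxE.
Qed.

Definition orthant n : set 'rV[R]_n := fun x => forall i, 0 <= x 0 i.
Arguments orthant : clear implicits.

Definition bd_orthant n : set 'rV[R]_n := fun x => orthant n x /\ exists i, x 0 i = 0.
Arguments bd_orthant : clear implicits.

Lemma scalar_opp n (l : 'rV[R]_n -> R) : scalar l -> scalar (fun x => - l x).
Proof. by move=> ll a u v; rewrite ll; ring. Qed.

Lemma scalar_sub n (l l' : 'rV[R]_n -> R) : scalar l -> scalar l' ->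
  scalar (fun x => l x - l' x).
Proof. by move=> ll ll' a u v; rewrite ll ll'; ring. Qed.

Lemma scalar_0 n (l : 'rV[R]_n -> R) : scalar l -> l 0 = 0.
Proof. by move=> ll; have := ll 1 0 0; rewrite scaler0 addr0 mul1r; lra. Qed.

Lemma polycone_nonneg n (I : pred 'I_n) :
  polycone (fun x : 'rV[R]_n => forall i, I i -> 0 <= x 0 i).
Proof.
pose l (i : {i | I i}) (x : 'rV[R]_n) := - x 0 (val i).
apply: polycone_ext (@polycone_le R n {i | I i} l _) _ => [i|x] /=.
  by apply: scalar_opp; apply: scalar_coord.
split=> [H i Ii|H [i Ii]]; first by have := H (exist _ i Ii); rewrite /l /= oppr_le0.
by rewrite /l oppr_le0 H.
Qed.

Lemma polycone_orthant n : polycone (orthant n).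
Proof.
apply: polycone_ext (polycone_nonneg (xpredT : pred 'I_n)) _ => x.
by split=> H i; [apply: H|move=> _; apply: H].
Qed.

Lemma cpl_bd_orthant n : cpl_on (bd_orthant n) idfun.
Proof.
apply: (@cpl_pieces R n n 'I_n (fun i x => orthant n x /\ x 0 i = 0) (fun _ => idfun)) => //.
  move=> i; apply: polyconeI; first exact: polycone_orthant.
  by apply: polycone_eq0; apply: scalar_coord.
by move=> x; split=> [[Ox [i xi]]|[i [Ox xi]]]; [exists i|split=> //; exists i].
Qed.

Section Min.
Variables (n : nat) (I : pred 'I_n) (i0 : 'I_n).
Hypothesis Ii0 : I i0.

Definition min_coord (x : 'rV[R]_n) : R := x 0 [arg min_(i < i0 | I i) x 0 i]%O.

Lemma min_coord_le (x : 'rV[R]_n) i : I i -> min_coord x <= x 0 i.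
Proof. by move=> Ii; rewrite /min_coord; case: arg_minP => // j Ij; apply. Qed.

Lemma min_coord_ex (x : 'rV[R]_n) : exists2 i, I i & x 0 i = min_coord x.
Proof. by rewrite /min_coord; case: arg_minP => // j Ij _; exists j. Qed.

Lemma min_coordE (x : 'rV[R]_n) i : I i -> (forall j, I j -> x 0 i <= x 0 j) -> min_coord x = x 0 i.
Proof.
move=> Ii xi; apply/eqP; rewrite eq_le min_coord_le //=.
by have [j Ij <-] := min_coord_ex x; apply: xi.
Qed.

Lemma cpl_min_coord (X : set 'rV[R]_n) : cpl_on X idfun ->
  cpl_on X (fun x => (min_coord x)%:M : 'rV[R]_1).
Proof.
pose C (p : {i | I i}) (x : 'rV[R]_n) := forall q : {i | I i}, x 0 (val p) - x 0 (val q) <= 0.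
have T : cpl_on (fun _ => True) (fun x => (min_coord x)%:M : 'rV[R]_1).
  apply: (@cpl_pieces R n 1 {i | I i} C (fun p x => (x 0 (val p))%:M)).
  - by move=> p; apply: polycone_le => q; apply: scalar_sub; apply: scalar_coord.
  - by move=> p a u v; apply/rowP => i; rewrite !mxE !ord1 !mulr1n.
  - move=> x; split=> // _; have [i Ii xi] := min_coord_ex x.
    by exists (exist _ i Ii) => -[j Ij] /=; rewrite subr_le0 xi min_coord_le.
  - move=> [i Ii] x Cx; rewrite (min_coordE Ii) // => j Ij.
    by have := Cx (exist _ j Ij); rewrite /= subr_le0.
by move=> Xi; apply: cpl_sub T Xi _.
Qed.

Definition corner (V : set 'rV[R]_n) : set 'rV[R]_n :=
  fun x => V x /\ forall i, I i -> 0 <= x 0 i.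
Definition bd_corner V : set 'rV[R]_n :=
  fun x => corner V x /\ exists2 i, I i & x 0 i = 0.

Lemma polycone_corner V : polycone V -> polycone (corner V).
Proof. by move=> PV; apply: polyconeI => //; apply: polycone_nonneg. Qed.

Lemma cpl_bd_corner V : polycone V -> cpl_on (bd_corner V) idfun.
Proof.
move=> PV; pose C (i : {i | I i}) x := corner V x /\ x 0 (val i) = 0.
apply: (@cpl_pieces R n n _ C (fun _ => idfun)) => //.
  move=> i; apply: polyconeI; first exact: polycone_corner.
  by apply: polycone_eq0; apply: scalar_coord.
move=> x; split=> [[Ox [i Ii xi]]|[[i Ii] [Ox xi]]]; first by exists (exist _ i Ii).
by split=> //; exists i.
Qed.

Lemma linear_add_scale (w : 'rV[R]_n) :
  linear (fun z : 'rV[R]_(n + 1) => lsubmx z + rsubmx z 0 0 *: w).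
Proof. by move=> a u v; apply/rowP => i; rewrite !mxE; ring. Qed.

(** Subtracting t w lowers all coordinates on I by t om. So each point x of the
    corner is b + t w for exactly one b on the boundary and one t >= 0, where t is
    the least coordinate of x on I, divided by om. *)
Lemma corner_collared (V : set 'rV[R]_n) (s : 'rV[R]_n -> R) (w : 'rV[R]_n) om :
  polycone V -> (forall t x, V x -> V (x + t *: w)) -> scalar s -> 0 < om ->
  (forall i, I i -> w 0 i = om) -> collared (s w) s (corner V) (bd_corner V).
Proof.
move=> PV Vw sl om0 wI; split=> [x []//|].
pose t x := min_coord x / om.
exists (fun x => row_mx (x - t x *: w) (t x)%:M).
exists (fun z => lsubmx z + rsubmx z 0 0 *: w).
have cC := cpl_polycone (polycone_corner PV).
have ct : cpl_on (corner V) (fun x => (t x)%:M : 'rV[R]_1).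
  have lin := cpl_lin (@cpl_full R 1) (@linear_mul R 1 1 (om^-1)%:M).
  apply: cpl_ext (cpl_comp_to (cpl_min_coord cC) lin _) _ _ => // x _.
  by rewrite /= -scalar_mxM.
split; last first.
  move=> b [[_ b0] [i Ii bi]]; have t0 : t b = 0.
    by rewrite /t (@min_coordE b i) ?bi ?mul0r // => j Ij; rewrite ?bi b0.
  by rewrite t0 scale0r subr0 raddf0.
split.
- apply: cpl_pair => //.
  have lin := cpl_lin (@cpl_full R (n + 1)) (linear_add_scale (- w)).
  apply: cpl_ext (cpl_comp_to (cpl_pair cC ct) lin _) _ _ => // x _.
  by rewrite /= row_mxKl row_mxKr mxE mulr1n scalerN.
- apply: cpl_lin; last exact: linear_add_scale.
  by apply: cpl_prod; [apply: cpl_bd_corner|apply: cpl_halfline].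
- move=> x [Vx x0]; have [j Ij xj] := min_coord_ex x.
  have tom : t x * om = min_coord x by rewrite /t divfK // gt_eqF.
  rewrite /prodc /sum_gauge /scale_gauge !row_mxKl !row_mxKr /halfline !mxE mulr1n subrK; split=> //.
    split; last by rewrite divr_ge0 ?(ltW om0) // -xj; apply: x0.
    split; last by exists j; rewrite // !mxE wI // tom xj subrr.
    split=> [|i Ii]; first by rewrite -scaleNr; apply: Vw.
    by rewrite !mxE wI // tom subr_ge0 min_coord_le.
  by rewrite -scaleNr addrC [in LHS]addrC [X in s X]addrC sl; ring.
- move=> z [] []; rewrite /halfline -[RHS]hsubmxK.
  move: (lsubmx z) (rsubmx z) => b r [Vb b0] [j Ij bj] r0.
  have tE : t (b + r 0 0 *: w) = r 0 0.
    rewrite /t (@min_coordE _ j) //; first by rewrite !mxE wI // bj add0r mulfK // gt_eqF.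
    by move=> i Ii; rewrite !mxE !wI // bj lerD2r b0.
  split; first split; first exact: Vw.
    by move=> i Ii; rewrite !mxE wI // addr_ge0 ?b0 // mulr_ge0 // ltW.
  rewrite tE addrK; congr row_mx.
  by apply/rowP => i; rewrite !ord1 mxE mulr1n.
Qed.

End Min.

(** A simplex is the cone over its boundary, with the barycentre as apex; the
    gauge 1 is the sum of the coordinates of the barycentre. *)
Lemma orthant_collared n :
  collared 1 (@total n.+1) (orthant n.+1) (bd_orthant n.+1).
Proof.
pose w : 'rV[R]_n.+1 := const_mx (n.+1%:R^-1).
have tw : total w = 1.
  rewrite /total (eq_bigr (fun=> n.+1%:R^-1)) => [|i _]; last by rewrite mxE.
  by rewrite sumr_const card_ord -[LHS]mulr_natl divff // pnatr_eq0.
rewrite -tw.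
have := @corner_collared n.+1 xpredT ord0 isT (fun _ => True) (@total _) w n.+1%:R^-1
  (@polyconeT R _).
move=> /(_ (fun _ _ _ => I) (@scalar_total _) _ (fun i _ => mxE _ _ _ _)).
move=> /(_ _)/collared_sub; apply; first by rewrite invr_gt0 ltr0n.
- by move=> x; rewrite /corner; split=> [[_ H] i|H]; [apply: H|split=> // i _; apply: H].
- move=> x; rewrite /bd_corner /corner; split=> [[[_ H] [i _ Hi]]|[H [i Hi]]].
    by split; [move=> j; apply: H|exists i].
  by split; [split=> // j _; apply: H|exists i].
Qed.

Lemma linear_comp n m k (f : 'rV[R]_n -> 'rV[R]_m) (g : 'rV[R]_m -> 'rV[R]_k) :
  linear f -> linear g -> linear (g \o f).
Proof. by move=> fl gl a u v; rewrite /= fl gl. Qed.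

Lemma linear_row_mx n m k (f : 'rV[R]_n -> 'rV[R]_m) (g : 'rV[R]_n -> 'rV[R]_k) :
  linear f -> linear g -> linear (fun x => row_mx (f x) (g x)).
Proof. by move=> fl gl a u v; rewrite fl gl scale_row_mx add_row_mx. Qed.

Lemma orthantD n m (z : 'rV[R]_(n + m)) :
  orthant (n + m) z <-> orthant n (lsubmx z) /\ orthant m (rsubmx z).
Proof.
split=> [H|[Hl Hr] i]; first by split=> i; rewrite mxE; apply: H.
by rewrite -[z]hsubmxK mxE; case: splitP => j _; [apply: Hl|apply: Hr].
Qed.

Lemma totalD n m (z : 'rV[R]_(n + m)) : total z = sum_gauge (@total n) (@total m) z.
Proof.
by rewrite /total big_split_ord; congr (_ + _); apply: eq_bigr => i _; rewrite mxE.
Qed.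

Lemma bd_orthantD n m (z : 'rV[R]_(n + m)) : orthant (n + m) z ->
  (bd_orthant (n + m) z <-> bd_orthant n (lsubmx z) \/ bd_orthant m (rsubmx z)).
Proof.
move=> /[dup] Oz /orthantD[Ol Or]; split=> [[_ [i]]|].
  rewrite -[z]hsubmxK mxE; case: splitP => j _ zj; [left|right];
    rewrite ?hsubmxK ?row_mxKl ?row_mxKr; by split=> //; exists j; rewrite -zj ?row_mxKl ?row_mxKr.
by case=> -[_ [i zi]]; split=> //; [exists (lshift _ i)|exists (rshift _ i)]; rewrite mxE in zi.
Qed.

Lemma halflineE (t : 'rV[R]_1) : halfline t <-> orthant 1 t.
Proof. by split=> [H i|]; [rewrite (ord1 i)|apply]. Qed.

Lemma total1 (t : 'rV[R]_1) : total t = t 0 0.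
Proof. by rewrite /total big_ord1. Qed.

Lemma bd_orthant1 (t : 'rV[R]_1) : bd_orthant 1 t <-> t = 0.
Proof.
split=> [[_ [i ti]]|->]; first by apply/rowP => j; rewrite mxE (ord1 j) -ti (ord1 i).
by split=> [i|]; [rewrite mxE|exists 0; rewrite mxE].
Qed.

(** Let D be a simplex with a + 1 vertices, dD its boundary, and E a simplex
    with b vertices. As D is the cone over dD with an apex v,
      D * E = (dD * v) * E = dD * (v * E),
    and v * E is a simplex with 1 + b vertices. The point v is the barycentre of
    the face D, so on boundaries this exhibits dD * d(v * E) as the result of
    starring the sphere d(D * E) at the face D. *)
Lemma join_orthant a b : exists h g,
  chomeo (sum_gauge (@total a.+1) (@total (1 + b))) (@total (a.+1 + b))
    (prodc (bd_orthant a.+1) (orthant (1 + b))) (orthant (a.+1 + b)) h g /\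
  forall z, prodc (bd_orthant a.+1) (orthant (1 + b)) z ->
    (bd_orthant (1 + b) (rsubmx z) <-> bd_orthant (a.+1 + b) (h z)).
Proof.
have [BT [h [g [[Th Bg TB BT'] hB]]]] := orthant_collared a.
pose L (z : 'rV[R]_(a.+1 + (1 + b))) := row_mx (lsubmx z) (lsubmx (rsubmx z)).
have Ll : linear L.
  apply: linear_row_mx; first exact: linear_lsub.
  exact: linear_comp (@linear_rsub _ _ _) (@linear_lsub _ _ _).
pose F z := row_mx (g (L z)) (rsubmx (rsubmx z)).
pose G (u : 'rV[R]_(a.+1 + b)) :=
  row_mx (lsubmx (h (lsubmx u))) (row_mx (rsubmx (h (lsubmx u))) (rsubmx u)).
have LB z : prodc (bd_orthant a.+1) (orthant (1 + b)) z ->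
    prodc (bd_orthant a.+1) (@halfline R) (L z).
  by move=> [Bz /orthantD[Oz _]]; split; rewrite ?row_mxKl ?row_mxKr //; apply/halflineE.
have LE z : rsubmx z = row_mx (rsubmx (L z)) (rsubmx (rsubmx z)).
  by rewrite row_mxKr hsubmxK.
have cO k : cpl_on (orthant k) idfun by apply: cpl_polycone; apply: polycone_orthant.
have cX := cpl_prod (@cpl_bd_orthant a.+1) (cO (1 + b)%N).
have cF x : prodc (bd_orthant a.+1) (orthant (1 + b)) x ->
    [/\ orthant (a.+1 + b) (F x), G (F x) = x
      & total (F x) = sum_gauge (@total a.+1) (@total (1 + b)) x].
  move=> Xx; have LBx := LB x Xx; have [Og hgL] := BT' _ LBx.
  have [_ _ sg] := TB _ Og; rewrite hgL in sg.
  case: Xx => Bx /orthantD[_ Orr]; split.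
  - by apply/orthantD; rewrite /F row_mxKl row_mxKr.
  - by rewrite /G /F row_mxKl row_mxKr hgL /L row_mxKl row_mxKr !hsubmxK.
  - rewrite totalD /sum_gauge /F row_mxKl row_mxKr -sg /sum_gauge /scale_gauge /L row_mxKl row_mxKr.
    by rewrite [total (rsubmx x)]totalD /sum_gauge total1 mul1r addrA.
have cG y : orthant (a.+1 + b) y ->
    prodc (bd_orthant a.+1) (orthant (1 + b)) (G y) /\ F (G y) = y.
  move=> /orthantD[Ol Or]; have [[Bl Hr] gh _] := TB _ Ol.
  rewrite /G /F /L /prodc !(row_mxKl, row_mxKr) hsubmxK gh hsubmxK; split=> //; split=> //.
  by apply/orthantD; rewrite !row_mxKl !row_mxKr; split=> //; apply/halflineE.
exists F, G; split; first split=> //.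
- apply: cpl_pair; first by apply: cpl_comp_to (cpl_lin cX Ll) Bg LB.
  apply: cpl_lin => //.
  exact: linear_comp (@linear_rsub _ _ _) (@linear_rsub _ _ _).
- have cl : cpl_on (orthant (a.+1 + b)) (fun u => h (lsubmx u)).
    by apply: cpl_comp_to (cpl_lin (cO _) (@linear_lsub _ _ _)) Th _ => u /orthantD[].
  apply: cpl_pair; first exact: cpl_comp_to cl (cpl_lin (@cpl_full _ _) (@linear_lsub _ _ _)) _.
  apply: cpl_pair; last by apply: cpl_lin (cO _) (@linear_rsub _ _ _).
  exact: cpl_comp_to cl (cpl_lin (@cpl_full _ _) (@linear_rsub _ _ _)) _.
- move=> z Xz; have [OF _ _] := cF z Xz; have LBz := LB z Xz.
  have [Og hgL] := BT' _ LBz; case: Xz => Bz Oz.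
  have -> : bd_orthant (1 + b) (rsubmx z) <->
     bd_orthant 1 (lsubmx (rsubmx z)) \/ bd_orthant b (rsubmx (rsubmx z)).
    exact: bd_orthantD.
  have -> : bd_orthant (a.+1 + b) (F z) <->
     bd_orthant a.+1 (g (L z)) \/ bd_orthant b (rsubmx (rsubmx z)).
    by have := bd_orthantD OF; rewrite /F row_mxKl row_mxKr.
  have -> // : bd_orthant 1 (lsubmx (rsubmx z)) <-> bd_orthant a.+1 (g (L z)).
  rewrite bd_orthant1; split=> [z0|/[dup] Bg' /hB].
    have LE' : L z = row_mx (lsubmx z) 0 by rewrite /L z0.
    by rewrite LE' -hB //; have [_ -> _] := TB _ (BT _ Bz).
  by rewrite hgL => /(congr1 rsubmx); rewrite !row_mxKr.
Qed.

(** Projection along the diagonal: each line parallel to it meets the boundary of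
    the orthant exactly once. Only germs are compared, so the sum of the
    coordinates need not be preserved. *)
Lemma bd_orthant_linear k : exists h g,
  chomeo (fun=> 0) (fun=> 0) (bd_orthant k.+1) (fun x : 'rV[R]_k.+1 => total x = 0) h g.
Proof.
pose one : 'rV[R]_k.+1 := const_mx 1.
pose h (x : 'rV[R]_k.+1) := x - (total x / k.+1%:R) *: one.
pose mn := @min_coord k.+1 xpredT ord0.
pose g (x : 'rV[R]_k.+1) := x - mn x *: one.
have k0 : k.+1%:R != 0 :> R by rewrite pnatr_eq0.
have t1 : total one = k.+1%:R.
  rewrite /total (eq_bigr (fun=> 1)) => [|i _]; last by rewrite mxE.
  by rewrite sumr_const card_ord.
have tg t x : total (x - t *: one) = total x - t * k.+1%:R.
  by rewrite -scaleNr addrC scalar_total t1; ring.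
have mnE x t : mn (x - t *: one) = mn x - t.
  have [i _ xi] := @min_coord_ex k.+1 xpredT ord0 isT x.
  rewrite /mn (@min_coordE k.+1 xpredT ord0 isT (x - t *: one) i) //.
    by rewrite !mxE xi mulr1.
  by move=> j _; rewrite !mxE lerD2r xi; apply: min_coord_le.
have mn0 x : bd_orthant k.+1 x -> mn x = 0.
  move=> [Ox [i xi]]; rewrite /mn (@min_coordE _ _ _ isT x i) // => j _.
  by rewrite xi; apply: Ox.
have cV : cpl_on (fun x : 'rV[R]_k.+1 => total x = 0) idfun.
  by apply: cpl_polycone; apply: polycone_eq0; apply: scalar_total.
exists h, g; split.
- apply: cpl_lin; first exact: cpl_bd_orthant.
  move=> a u v; rewrite /h scalar_total; apply/rowP => i; rewrite !mxE; move: k0.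
  by move: (k.+1%:R : R) => K K0; field.
- have lin := cpl_lin (@cpl_full R (k.+1 + 1)) (@linear_add_scale _ (- one)).
  apply: cpl_ext (cpl_comp_to (cpl_pair cV (cpl_min_coord isT cV)) lin _) _ _ => // x _.
  by rewrite /= row_mxKl row_mxKr mxE mulr1n scalerN.
- move=> x Bx; rewrite /h tg divfK // subrr; split=> //.
  by rewrite /g mnE mn0 // sub0r scaleNr opprK subrK.
- move=> y ty; split; last by rewrite /h {2}/g tg ty sub0r mulNr mulfK // /g scaleNr opprK subrK.
  have [i _ yi] := @min_coord_ex k.+1 xpredT ord0 isT y.
  split=> [j|]; last by exists i; rewrite !mxE mulr1 yi subrr.
  by rewrite !mxE mulr1 subr_ge0; apply: min_coord_le.
Qed.

End Orthants.

(** * Cones over polyhedra *)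

Section Cones.
Variable R : realType.

Lemma polycone_convex n (C : set 'rV[R]_n) : polycone C -> convex_polyhedron C.
Proof.
move=> [k [B CB]]; exists k, B, 0; apply/seteqP.
by split=> x /= => [/CB H j|H]; [rewrite [leRHS]mxE|apply/CB => j; have := H j; rewrite [leRHS]mxE].
Qed.

Lemma convex_ext n (C D : set 'rV[R]_n) :
  convex_polyhedron C -> (forall x, C x <-> D x) -> convex_polyhedron D.
Proof.
move=> [k [A [b CE]]] CD; exists k, A, b; rewrite -CE.
by apply/seteqP; split=> x; apply CD.
Qed.

Lemma row_mx_le n m (u u' : 'rV[R]_n) (v v' : 'rV[R]_m) :
  (forall j, row_mx u v 0 j <= row_mx u' v' 0 j) <->
  (forall j, u 0 j <= u' 0 j) /\ (forall j, v 0 j <= v' 0 j).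
Proof.
split=> [H|[Hu Hv] j]; last by rewrite !mxE; case: splitP.
by split=> j; [have := H (lshift _ j)|have := H (rshift _ j)]; rewrite ?row_mxEl ?row_mxEr.
Qed.

Lemma convex_preim n m (A : 'M[R]_(n, m)) (b : 'rV[R]_m) (C : set 'rV[R]_m) :
  convex_polyhedron C -> convex_polyhedron (fun y => C (y *m A + b)).
Proof.
move=> [k [B [c ->]]]; exists k, (A *m B), (c - b *m B); apply/seteqP.
have E1 y j : ((y *m A + b) *m B) 0 j = (y *m (A *m B)) 0 j + (b *m B) 0 j.
  by rewrite mulmxDl mulmxA [LHS]mxE.
have E2 j : (c - b *m B) 0 j = c 0 j - (b *m B) 0 j by rewrite [LHS]mxE [X in _ + X]mxE.
by split=> y /= H j; have := H j; rewrite E1 E2 lerBrDr.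
Qed.

Lemma convexI n (C D : set 'rV[R]_n) : convex_polyhedron C -> convex_polyhedron D ->
  convex_polyhedron (fun y => C y /\ D y).
Proof.
move=> [k [A [b ->]]] [k' [A' [b' ->]]]; exists (k + k')%N, (row_mx A A'), (row_mx b b').
by apply/seteqP; split=> y /=; rewrite mul_mx_row row_mx_le.
Qed.

Lemma convex_total1 n : convex_polyhedron (fun x : 'rV[R]_n => total x = 1).
Proof.
have P0 : convex_polyhedron (fun y : 'rV[R]_1 => y 0 0 = 0).
  by apply: polycone_convex; apply: polycone_eq0; apply: scalar_coord.
apply: convex_ext (convex_preim (const_mx 1) (- 1)%:M P0) _ => x.
have -> : (x *m const_mx 1 + (- 1)%:M) 0 0 = total x - 1.
  by rewrite !mxE mulr1n; congr (_ - 1); apply: eq_bigr => i _; rewrite mxE mulr1.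
by split=> [/eqP|->]; rewrite ?subrr // subr_eq0 => /eqP.
Qed.

(** KX is the cone over the polyhedron X, together with the origin even if X is
    empty. *)
Definition slice n (KX X : set 'rV[R]_n) : Prop :=
  [/\ forall x, KX x -> orthant x, KX 0,
      forall t x, 0 < t -> KX x -> KX (t *: x) & forall x, X x <-> KX x /\ total x = 1].

Lemma totalZ n t (x : 'rV[R]_n) : total (t *: x) = t * total x.
Proof. by rewrite /total mulr_sumr; apply: eq_bigr => i _; rewrite mxE. Qed.

Lemma orthant_total0 n (x : 'rV[R]_n) : orthant x -> total x = 0 -> x = 0.
Proof.
move=> Ox /eqP; rewrite /total psumr_eq0 => [/allP x0|i _]; last exact: Ox.
by apply/rowP => i; rewrite mxE; apply/eqP/x0; rewrite mem_index_enum.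
Qed.

Lemma orthant_total_ge0 n (x : 'rV[R]_n) : orthant x -> 0 <= total x.
Proof. by move=> Ox; apply: sumr_ge0. Qed.

Lemma slice_scale n (KX X : set 'rV[R]_n) x : slice KX X -> KX x -> x <> 0 ->
  0 < total x /\ X ((total x)^-1 *: x).
Proof.
move=> [KO K0 KZ KX1] Kx x0.
have t0 : 0 < total x.
  rewrite lt_neqAle orthant_total_ge0 ?andbT; last exact: KO.
  by apply/eqP => /esym/(orthant_total0 (KO _ Kx)).
split=> //; apply/KX1; split; first by apply: KZ; rewrite ?invr_gt0.
by rewrite totalZ mulVf // gt_eqF.
Qed.

Definition homogenize n m (h : 'rV[R]_n -> 'rV[R]_m) (x : 'rV[R]_n) :=
  total x *: h ((total x)^-1 *: x).

(** Over a piece on which h is x A + b, homogenisation gives x A + (total x) b,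
    which is linear. *)
Lemma cpl_cone n m (KX X : set 'rV[R]_n) (h : 'rV[R]_n -> 'rV[R]_m) :
  slice KX X -> pl_on X h ->
  cpl_on KX (homogenize h).
Proof.
move=> SX [k [C [HC XC hC]]]; have [KO K0 KZ KX1] := SX.
have /choice[B HB] : forall i, exists B : 'M[R]_(n, m),
    forall x, orthant x -> C i x -> total x = 1 -> h x = x *m B.
  move=> i; have [A [b hA]] := hC i.
  have [|B HB] := @linear_mulmx R n m (fun x => x *m A + total x *: b).
    by move=> a u v; rewrite scalar_total mulmxDl -scalemxAl !scalerDr scalerDl scalerA addrACA.
  by exists B => x _ Cx tx; rewrite -HB tx scale1r; apply: hA.
have X0 i x : C i x -> X x by move=> Cx; rewrite XC; exists i.
(* the piece None is for the origin, in case X and the family of its pieces are empty *)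
pose D (i : option 'I_k) (x : 'rV[R]_n) := match i with
  | None => x = 0 | Some i => x = 0 \/ [/\ orthant x, 0 < total x & C i ((total x)^-1 *: x)] end.
pose F (i : option 'I_k) := match i with None => 0 | Some i => B i end.
exists (option 'I_k), D, F; split.
- case=> [i|] /=; last first.
    apply: polycone_ext (@polycone_forall R n 'I_n (fun i x => x 0 i = 0) _) _.
      by move=> j; apply: polycone_eq0; apply: scalar_coord.
    by move=> x; split=> [H|-> j]; [apply/rowP => j; rewrite mxE|rewrite mxE].
  have [l [A [b CA]]] := HC i.
  apply: polycone_ext (polyconeI (@polycone_orthant R n)
    (@polycone_le R n 'I_l (fun j x => (x *m A) 0 j - total x * b 0 j) _)) _.
    move=> j; apply: scalar_sub; first exact: scalar_mul.
    by move=> a u v; rewrite scalar_total; ring.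
  have tC x : 0 < total x ->
      (forall j, (x *m A) 0 j - total x * b 0 j <= 0) <-> C i ((total x)^-1 *: x).
    move=> tx; rewrite CA /=.
    have E j : (((total x)^-1 *: x) *m A) 0 j = (total x)^-1 * (x *m A) 0 j.
      by rewrite -scalemxAl mxE.
    by split=> H j; have := H j; rewrite subr_le0 E ler_pdivrMl.
  move=> x; split=> [[Ox Hx]|[->|[Ox tx Cx]]].
  + have := orthant_total_ge0 Ox; rewrite le_eqVlt.
    move=> /orP[/eqP/esym/(orthant_total0 Ox)|tx]; first by left.
    by right; split=> //; apply/tC.
  + split=> [j|j]; first by rewrite mxE.
    by rewrite mul0mx mxE (scalar_0 (@scalar_total R n)) mul0r subrr.
  + by split=> //; apply/tC.
- move=> x; split=> [Kx|].
    have [->|/eqP x0] := eqVneq x 0; first by exists None.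
    have [t0 Xx] := slice_scale SX Kx x0.
    by rewrite XC in Xx; case: Xx => i _ Ci; exists (Some i); right; split=> //; apply: KO.
  case=> -[i|] /=; last by move=> ->.
  case=> [-> //|[Ox tx /X0 /KX1[Kx _]]].
  by have := KZ (total x) _ tx Kx; rewrite scalerA divff ?gt_eqF // scale1r.
- rewrite /homogenize; case=> [i|] x /=; last by move=> ->; rewrite (scalar_0 (@scalar_total R n)) scale0r mulmx0.
  case=> [->|[Ox tx Cx]]; first by rewrite (scalar_0 (@scalar_total R n)) scale0r mul0mx.
  rewrite (HB i) // ?totalZ ?mulVf ?gt_eqF //; last first.
    by move=> j; rewrite mxE mulr_ge0 ?invr_ge0 ?(ltW tx) //; apply: Ox.
  by rewrite -scalemxAl scalerA divff ?gt_eqF // scale1r.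
Qed.

Lemma cone_of_pl_homeo n m (KX X : set 'rV[R]_n) (KY Y : set 'rV[R]_m) h :
  slice KX X -> slice KY Y -> pl_homeo X Y h ->
  exists H G, chomeo (@total R n) (@total R m) KX KY H G /\
    forall x, X x -> H x = h x.
Proof.
move=> SX SY [Xh XY [g [Yg YX gh hg]]].
exists (homogenize h), (homogenize g).
have aux k l (KX' X' : set 'rV[R]_k) (KY' Y' : set 'rV[R]_l) h' g' :
    slice KX' X' -> slice KY' Y' -> (forall x, X' x -> Y' (h' x)) ->
    (forall x, X' x -> g' (h' x) = x) -> forall x, KX' x ->
    [/\ KY' (homogenize h' x), homogenize g' (homogenize h' x) = x
      & total (homogenize h' x) = total x].
  move=> SX' SY' XY' gh' x Kx; have [KO' K0' KZ' KX1'] := SY'; rewrite /homogenize.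
  have [->|/eqP x0] := eqVneq x 0.
    by rewrite !(scalar_0 (@scalar_total R _), scale0r).
  have [t0 Xx] := slice_scale SX' Kx x0.
  have [Kh th] := (KX1' _).1 (XY' _ Xx).
  rewrite totalZ th mulr1 (scalerA (total x)^-1) mulVf ?gt_eqF // scale1r gh' //.
  by rewrite scalerA divff ?gt_eqF // scale1r; split=> //; apply: KZ'.
split; first split.
- exact: cpl_cone SX Xh.
- exact: cpl_cone SY Yg.
- exact: aux SX SY XY gh.
- by move=> y Ky; have [] := aux _ _ _ _ _ _ g h SY SX YX hg y Ky.
- move=> x Xx; have [_ _ _ KX1] := SX; have [_ tx] := (KX1 x).1 Xx.
  by rewrite /homogenize tx invr1 !scale1r.
Qed.

Lemma pl_on_slice n m (KX X : set 'rV[R]_n) (h : 'rV[R]_n -> 'rV[R]_m) :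
  slice KX X -> cpl_on KX h -> pl_on X h.
Proof.
move=> [_ _ _ KX1] [J [C [A [HC XC hA]]]].
exists #|J|, (fun i x => C (enum_val i) x /\ total x = 1); split.
- by move=> i; apply: convexI; [apply: polycone_convex|apply: convex_total1].
- apply/seteqP; split=> x /=.
    by move=> /KX1[/XC[j Cx] tx]; exists (enum_rank j) => //; rewrite enum_rankK.
  by move=> [i _ [Cx tx]]; apply/KX1; split=> //; apply/XC; exists (enum_val i).
- by move=> i; exists (A (enum_val i)), 0 => x [Cx _]; rewrite addr0 (hA (enum_val i)).
Qed.

Lemma pl_homeo_of_cone n m (KX X : set 'rV[R]_n) (KY Y : set 'rV[R]_m) H G :
  slice KX X -> slice KY Y -> chomeo (@total R n) (@total R m) KX KY H G ->
  pl_homeo X Y H.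
Proof.
move=> SX SY [XH YG XY YX]; have [_ _ _ KX1] := SX; have [_ _ _ KY1] := SY.
split; first exact: pl_on_slice SX XH.
  by move=> x /KX1[/XY[YH _ tH] tx]; apply/KY1; rewrite tH.
exists G; split; first exact: pl_on_slice SY YG.
- move=> y /KY1[/YX[XGy HG] ty]; apply/KX1; split=> //.
  by have [_ _ <-] := XY _ XGy; rewrite HG.
- by move=> x /KX1[/XY[]].
- by move=> y /KY1[/YX[]].
Qed.

Lemma slice_simplex n : slice (@orthant R n.+1) (@simplex R n).
Proof.
split=> //; first by move=> i; rewrite mxE.
by move=> t x t0 Ox i; rewrite mxE mulr_ge0 ?(ltW t0) //; apply: Ox.
Qed.

Lemma slice_bd_simplex n : slice (@bd_orthant R n.+1) (@bd_simplex R n).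
Proof.
split=> [x []//||t x t0 [Ox [i xi]]|x].
- by split=> [i|]; [rewrite mxE|exists ord0; rewrite mxE].
- by split=> [j|]; [by rewrite mxE mulr_ge0 ?(ltW t0) //; apply: Ox|exists i; rewrite mxE xi mulr0].
- by split=> [[[Ox tx] Hx]|[[Ox Hx] tx]].
Qed.

(** * Cones over order complexes *)

Lemma maximal_ex (d : Order.disp_t) (P : finPOrderType d) (D : {set P}) :
  D != finset.set0 -> exists2 t, t \in D & forall p, p \in D -> ~~ (t < p)%O.
Proof.
move=> /set0Pn[x xD]; pose below q := #|[set r in D | (r <= q)%O]|.
have [t tD tmax] := @arg_maxP _ _ _ x (mem D) below xD.
exists t => // p pD; apply/negP => tp.
have le_tp : (below p <= below t)%N := tmax p pD.
have : [set r in D | (r <= t)%O] == [set r in D | (r <= p)%O].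
  rewrite eqEcard le_tp andbT; apply/subsetP => r; rewrite !inE => /andP[-> rt].
  exact: le_trans rt (ltW tp).
move=> /eqP/setP/(_ p); rewrite !inE pD lexx /= => pt.
by have := lt_le_trans tp pt; rewrite ltxx.
Qed.

Section OrderCone.
Variables (d : Order.disp_t) (P : finPOrderType d).
Implicit Types (A B : {set P}) (y : 'rV[R]_#|P|).

Definition carrier y : {set P} := finset (fun t : P => y 0 (enum_rank t) != 0).

Definition order_cone A : set 'rV[R]_#|P| :=
  fun y => [/\ orthant y, chain (carrier y) & carrier y \subset A].

Lemma carrierP y p : (p \in carrier y) = (y 0 (enum_rank p) != 0).
Proof. by rewrite inE. Qed.

Lemma carrierZ t y : t != 0 -> carrier (t *: y) = carrier y.
Proof. by move=> t0; apply/setP => p; rewrite !inE mxE mulf_eq0 negb_or t0. Qed.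

Lemma carrier0 : carrier 0 = finset.set0.
Proof. by apply/setP => p; rewrite !inE mxE eqxx. Qed.

Lemma carrier_eq0 y : (carrier y == finset.set0) = (y == 0).
Proof.
apply/eqP/eqP => [/setP y0|->]; last exact: carrier0.
apply/rowP => i; rewrite mxE; apply/eqP; have := y0 (enum_val i).
by rewrite carrierP enum_valK inE => /negbFE.
Qed.

Lemma chainP (c : {set P}) :
  reflect (forall p q, p \in c -> q \in c -> (p >=< q)%O) (chain c).
Proof.
apply: (iffP forall_inP) => [H p q pc qc|H p pc]; first by have /forall_inP := H p pc; apply.
by apply/forall_inP => q qc; apply: H.
Qed.

Lemma chain_sub (c c' : {set P}) : chain c -> c' \subset c -> chain c'.
Proof. by move=> /chainP cc /subsetP s; apply/chainP => p q /s pc /s qc; apply: cc. Qed.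

Lemma slice_order_cone A : slice (order_cone A) (@polyhedron R d P A).
Proof.
split=> [x []//||t x t0 [Ox cx xA]|x].
- split; rewrite ?carrier0 ?sub0set //; first by move=> i; rewrite mxE.
  by apply/chainP => p q; rewrite inE.
- split; rewrite ?carrierZ ?gt_eqF //.
  by move=> i; rewrite mxE mulr_ge0 ?(ltW t0) //; apply: Ox.
- rewrite /polyhedron /realization /=; split=> [[Ox tx]|[[Ox cx xA] tx]].
    by rewrite inE => /and3P[_ xA cx].
  split=> //; rewrite inE; apply/and3P; split=> //.
  rewrite carrier_eq0; apply/eqP => x0; move: tx.
  by rewrite x0 (scalar_0 (@scalar_total R _)) => /eqP; rewrite eq_sym oner_eq0.
Qed.

Lemma cpl_order_cone A : cpl_on (order_cone A) idfun.
Proof.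
pose J := {c : {set P} | chain c && (c \subset A)}.
pose C (c : J) y := orthant y /\ forall p, p \notin val c -> y 0 (enum_rank p) = 0.
apply: (@cpl_pieces R _ _ J C (fun _ => idfun)) => //.
  move=> [c ccA]; rewrite /C /=; apply: polyconeI; first exact: polycone_orthant.
  pose D (p : {p | p \notin c}) (y : 'rV[R]_#|P|) := y 0 (enum_rank (val p)) = 0.
  apply: polycone_ext (@polycone_forall R _ _ D _) _.
    by move=> p; apply: polycone_eq0; apply: scalar_coord.
  by move=> y; split=> [H p pc|H [p pc]]; [have := H (exist _ p pc)|apply: H].
have sc (c : {set P}) y : carrier y \subset c <-> forall p, p \notin c -> y 0 (enum_rank p) = 0.
  split=> [/subsetP s p|H].
    by apply: contraNeq => yp; apply: s; rewrite carrierP.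
  by apply/subsetP => p; rewrite carrierP; apply: contraR => /H ->.
move=> y; split=> [[Oy cy yA]|[[c ccA] [Oy /(sc c) ys]]].
  have cP : chain (carrier y) && (carrier y \subset A) by rewrite cy yA.
  exists (exist (fun c : {set P} => is_true (chain c && (c \subset A))) (carrier y) cP).
  by split=> //; apply/sc.
have /andP[cc cA] := ccA.
by split=> //; [apply: chain_sub cc ys|apply: subset_trans ys cA].
Qed.

Lemma order_coneI A B y : order_cone (A :&: B) y <-> order_cone A y /\ order_cone B y.
Proof.
split=> [[Oy cy]|[[Oy cy yA] [_ _ yB]]]; first by rewrite subsetI => /andP[].
by split; rewrite // subsetI yA.
Qed.

Lemma order_coneS A B y : A \subset B -> order_cone A y -> order_cone B y.
Proof. by move=> AB [Oy cy yA]; split=> //; apply: subset_trans yA AB. Qed.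

Lemma order_cone0 y : order_cone finset.set0 y <-> y = 0.
Proof.
split=> [[_ _]|->]; first by rewrite subset0 carrier_eq0 => /eqP.
by have [] := slice_order_cone finset.set0.
Qed.

Lemma chain_max (c : {set P}) : chain c -> c != finset.set0 ->
  exists2 p, p \in c & forall q, q \in c -> (q <= p)%O.
Proof.
move=> /chainP cc /maximal_ex[p pc pmax]; exists p => // q qc.
have /orP[//|] := cc q p qc pc; rewrite le_eqVlt => /orP[/eqP -> //|pq].
by have := pmax q qc; rewrite pq.
Qed.

(** A chain of A union B lies in the one of A and B that contains its largest
    element, both being closed. *)
Lemma order_coneU A B y : closed_in (A :|: B) A -> closed_in (A :|: B) B ->
  (order_cone (A :|: B) y <-> order_cone A y \/ order_cone B y).
Proof.
move=> [_ Acl] [_ Bcl]; split=> [[Oy cy yAB]|[]]; last 2 first.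
- by apply: order_coneS; apply: subsetUl.
- by apply: order_coneS; apply: subsetUr.
have [y0|y0] := eqVneq (carrier y) finset.set0.
  by left; split=> //; rewrite y0 sub0set.
have [p pc pmax] := chain_max cy y0.
have := subsetP yAB p pc; rewrite inE => /orP[pA|pB]; [left|right]; split=> //;
  apply/subsetP => q qc; [apply: (Acl q p)|apply: (Bcl q p)] => //.
- exact: (subsetP yAB).
- exact: pmax.
- exact: (subsetP yAB).
- exact: pmax.
Qed.

Lemma is_sphereP A : is_sphere R A <-> exists n H G,
  chomeo (@total R _) (@total R n.+1) (order_cone A) (@bd_orthant R n.+1) H G.
Proof.
split=> [[n [h hh]]|[n [H [G HG]]]]; exists n.
  have [H [G [HG _]]] := cone_of_pl_homeo (slice_order_cone A) (slice_bd_simplex n) hh.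
  by exists H, G.
by exists H; apply: pl_homeo_of_cone (slice_order_cone A) (slice_bd_simplex n) HG.
Qed.

(** The condition on boundaries passes between the slices and the cones because
    both sides of it are invariant under positive scaling. *)
Lemma is_ballP A B : is_ball R A B <-> closed_in A B /\ exists n H G,
  chomeo (@total R _) (@total R n.+1) (order_cone A) (@orthant R n.+1) H G /\
  forall x, order_cone A x -> (order_cone B x <-> bd_orthant (H x)).
Proof.
have SA := slice_order_cone A; have SB := slice_order_cone B.
split=> -[Bcl [n]].
  move=> [h [hh hB]]; split=> //; exists n.
  have [H [G [HG Hh]]] := cone_of_pl_homeo SA (slice_simplex n) hh.
  exists H, G; split=> // x Ax; have [_ _ _ A1] := SA.
  have [_ B0 BZ B1] := SB; have [_ D0 DZ D1] := slice_bd_simplex n.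
  have [->|/eqP x0] := eqVneq x 0.
    by have [XH _ _ _] := HG; have [] := cpl_homo XH (lexx 0) Ax; rewrite !scale0r => _ ->.
  have [t0 Xx] := slice_scale SA Ax x0.
  have E : H x = total x *: h ((total x)^-1 *: x).
    have [XH _ _ _] := HG; have [_ ] := cpl_homo XH (ltW t0) ((A1 _).1 Xx).1.
    by rewrite scalerA divff ?gt_eqF // scale1r (Hh _ Xx).
  have := hB _ Xx; rewrite E; set z := h _ => Hz.
  have scal m (KC C : set 'rV[R]_m) w u : slice KC C -> 0 < u -> total w = u ->
      (KC w <-> C (u^-1 *: w)).
    move=> [_ _ CZ C1] u0 wu; rewrite C1; split=> [Cw|[Cw _]].
      by split; [apply: CZ; rewrite ?invr_gt0|rewrite totalZ wu mulVf ?gt_eqF].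
    by have := CZ u _ u0 Cw; rewrite scalerA divff ?gt_eqF // scale1r.
  have tz : total z = 1 by have [_ hS _] := hh; have [_ ] := hS _ Xx.
  rewrite (scal _ _ _ _ _ SB t0 erefl) Hz.
  rewrite (scal _ _ _ _ _ (slice_bd_simplex n) t0) ?totalZ ?tz ?mulr1 //.
  by rewrite scalerA mulVf ?gt_eqF // scale1r.
move=> [H [G [HG HB]]]; split=> //; exists n, H; split.
  exact: pl_homeo_of_cone SA (slice_simplex n) HG.
have [_ _ _ A1] := SA; have [_ _ _ B1] := SB; have [_ _ _ D1] := slice_bd_simplex n.
move=> x /A1[Ax tx]; have [XH _ XY _] := HG; have [_ _ tH] := XY x Ax.
by rewrite B1 D1 tH; have := HB x Ax; tauto.
Qed.

End OrderCone.
End Cones.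

(** * The fibration lemma *)

Section Closed.
Variables (d : Order.disp_t) (Q : finPOrderType d) (L : {set Q}).
Implicit Types D E : {set Q}.

Lemma closed_in_self : closed_in L L.
Proof. by split=> //; rewrite subxx. Qed.

Lemma closed_inI D E : closed_in L D -> closed_in L E -> closed_in L (D :&: E).
Proof.
move=> [DL Dcl] [EL Ecl]; split=> [|p q pL].
  exact: subset_trans (subsetIl _ _) DL.
by rewrite !inE => /andP[qD qE] pq; rewrite (Dcl p q) ?(Ecl p q).
Qed.

Lemma closed_cone t : closed_in L (cone L t).
Proof.
split=> [|p q pL]; first by apply/subsetP => p; rewrite inE => /andP[].
by rewrite !inE pL => /andP[_ qt] pq; apply: le_trans pq qt.
Qed.

Lemma closed_bd_cone t : closed_in L (bd_cone L t).
Proof.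
split=> [|p q pL]; first by apply/subsetP => p; rewrite inE => /andP[].
by rewrite !inE pL => /andP[_ qt] pq; apply: le_lt_trans pq qt.
Qed.

Lemma closed_sub D E : closed_in L D -> D \subset E -> E \subset L -> closed_in E D.
Proof. by move=> [_ Dcl] DE /subsetP EL; split=> // p q /EL; apply: Dcl. Qed.

Lemma closed_del D t : closed_in L D -> (forall p, p \in D -> ~~ (t < p)%O) ->
  closed_in L (D :\ t).
Proof.
move=> [DL Dcl] tmax; split=> [|p q pL]; first exact: subset_trans (subD1set _ _) DL.
rewrite !inE => /andP[qt qD] pq; rewrite (Dcl p q) // andbT.
apply: contraNneq qt => pt; rewrite pt in pq.
by have := tmax q qD; rewrite lt_neqAle pq andbT negbK eq_sym.
Qed.

End Closed.

Section Fibration.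
Variables (R : realType) (d : Order.disp_t) (Q : finPOrderType d) (L : {set Q}).
Variables (n : nat) (s : 'rV[R]_n -> R) (w : R) (T : {set Q} -> set 'rV[R]_n).
Hypothesis TI : forall E F x, closed_in L E -> closed_in L F ->
  (T (E :&: F) x <-> T E x /\ T F x).
Hypothesis TU : forall E F x, closed_in L E -> closed_in L F ->
  (T (E :|: F) x <-> T E x \/ T F x).
Hypothesis Tcol : forall t, t \in L -> collared w s (T (cone L t)) (T (bd_cone L t)).
Hypothesis T0 : cpl_on (T finset.set0) idfun.

Let sg := sum_gauge s (fun y : 'rV[R]_#|Q| => w * total y).
Let fib E := prodc (T finset.set0) (@order_cone R d Q E).

Let cpl_fib E : cpl_on (fib E) idfun.
Proof. by apply: cpl_prod => //; apply: cpl_order_cone. Qed.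

Let TS (E F : {set Q}) x : closed_in L E -> closed_in L F -> E \subset F -> T E x -> T F x.
Proof. by move=> Ecl Fcl /setIidPl EF; rewrite -EF => /(TI x Ecl Fcl)[]. Qed.

Section Vertex.
Variable t : Q.
Hypothesis tL : t \in L.

Let e : 'rV[R]_(n + #|Q|) := row_mx 0 (delta_mx 0 (enum_rank t)).
Let ht (y : 'rV[R]_(n + #|Q|)) := y 0 (rshift n (enum_rank t)).

Let up (z : 'rV[R]_((n + #|Q|) + 1)) := lsubmx z + rsubmx z 0 0 *: e.
Let down (y : 'rV[R]_(n + #|Q|)) : 'rV[R]_((n + #|Q|) + 1) := row_mx (y - ht y *: e) (ht y)%:M.

Lemma carrier_vertex (z : 'rV[R]_#|Q|) r :
  carrier (z + r *: delta_mx 0 (enum_rank t)) \subset t |: carrier z.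
Proof.
apply/subsetP => p; rewrite !inE !mxE eqxx /=.
by case: (eqVneq p t) => //= pt; rewrite (inj_eq enum_rank_inj) (negPf pt) mulr0 addr0.
Qed.

Lemma order_cone_vertex (z : 'rV[R]_#|Q|) r : order_cone (bd_cone L t) z -> 0 <= r ->
  order_cone (cone L t) (z + r *: delta_mx 0 (enum_rank t)).
Proof.
move=> [Oz /chainP cz zb] r0; have cs := carrier_vertex z r; split.
- by move=> i; rewrite !mxE addr_ge0 ?Oz // mulr_ge0 // mulr_ge0 // ler0n.
- apply: chain_sub cs; apply/chainP => p q; rewrite !in_setU1.
  case/predU1P => [->|pz]; case/predU1P => [->|qz]; rewrite ?comparablexx //.
  + by apply: ge_comparable; have := subsetP zb q qz; rewrite inE => /andP[_ /ltW].
  + by apply: le_comparable; have := subsetP zb p pz; rewrite inE => /andP[_ /ltW].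
  + exact: cz.
- apply: subset_trans cs _; apply/subsetP => p; rewrite in_setU1.
  case/predU1P => [->|/(subsetP zb)]; first by rewrite inE tL lexx.
  by rewrite !inE => /andP[-> /ltW].
Qed.

Lemma order_cone_unvertex (z : 'rV[R]_#|Q|) : order_cone (cone L t) z ->
  order_cone (bd_cone L t) (z - z 0 (enum_rank t) *: delta_mx 0 (enum_rank t)).
Proof.
move=> [Oz cz zc].
have E i : (z - z 0 (enum_rank t) *: delta_mx 0 (enum_rank t)) 0 i =
    if i == enum_rank t then 0 else z 0 i.
  by rewrite !mxE eqxx /=; case: eqP => [->|_]; rewrite ?mulr1 ?subrr // mulr0 subr0.
have cs : carrier (z - z 0 (enum_rank t) *: delta_mx 0 (enum_rank t)) = carrier z :\ t.
  apply/setP => p; rewrite carrierP E !inE (inj_eq enum_rank_inj).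
  by case: (p == t) => //=; rewrite eqxx.
split.
- by move=> i; rewrite E; case: ifP => // _; apply: Oz.
- by rewrite cs; apply: chain_sub cz _; apply: subD1set.
- rewrite cs; apply/subsetP => p; rewrite !in_setD1 => /andP[pt /(subsetP zc)].
  by rewrite !inE lt_neqAle pt => /andP[-> ->].
Qed.

Lemma order_cone_bd0 (z : 'rV[R]_#|Q|) : order_cone (bd_cone L t) z -> z 0 (enum_rank t) = 0.
Proof.
move=> [_ _ /subsetP/(_ t)]; rewrite carrierP inE ltxx andbF.
by case: eqP => // _ /(_ isT).
Qed.

(** In the notation of the section, [fib E] is T(empty) x K(E). Adding to K(E)
    the cone of a new maximal element t multiplies the part over the boundary of
    that cone by a half-line, spanned by the basis vector of t. *)
Lemma chomeo_vertex : chomeo (sum_gauge sg (scale_gauge w)) sg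
  (prodc (fib (bd_cone L t)) (@halfline R)) (fib (cone L t)) up down.
Proof.
have upl z : lsubmx (up z) = lsubmx (lsubmx z).
  by rewrite /up addrC linear_lsub row_mxKl scaler0 add0r.
have upr z : rsubmx (up z) = rsubmx (lsubmx z) + rsubmx z 0 0 *: delta_mx 0 (enum_rank t).
  by rewrite /up addrC linear_rsub row_mxKr addrC.
have htl y : ht y = rsubmx y 0 (enum_rank t) by rewrite mxE.
have dnl y : lsubmx (y - ht y *: e) = lsubmx y.
  by rewrite -scaleNr addrC linear_lsub row_mxKl scaler0 add0r.
have dnr y : rsubmx (y - ht y *: e) = rsubmx y - ht y *: delta_mx 0 (enum_rank t).
  by rewrite -scaleNr addrC linear_rsub row_mxKr addrC scaleNr.
apply: chomeo_lin.
- by apply: cpl_prod => //; apply: cpl_halfline.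
- exact: cpl_fib.
- exact: linear_add_scale.
- apply: linear_row_mx => a u v; last by apply/rowP => i; rewrite /ht !mxE !ord1; ring.
  by rewrite /ht; apply/rowP => i; rewrite !mxE; ring.
- move=> z [[Xz Kz] rz].
  have htz : ht (up z) = rsubmx z 0 0.
    by rewrite htl upr [LHS]mxE (order_cone_bd0 Kz) add0r !mxE !eqxx mulr1.
  split.
  + by split; rewrite ?upl ?upr //; apply: order_cone_vertex.
  + rewrite /down htz /up addrK -[RHS]hsubmxK; congr row_mx.
    by apply/rowP => i; rewrite !ord1 [LHS]mxE mulr1n.
  + rewrite /sg /sum_gauge upl upr /scale_gauge; set r := rsubmx z 0 0.
    rewrite [in total _]addrC scalar_total mulrDr.
    have -> : total (delta_mx 0 (enum_rank t)) = 1 :> R.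
      rewrite /total (bigD1 (enum_rank t)) //= mxE !eqxx big1 ?addr0 // => i it.
      by rewrite mxE (negPf it) andbF.
    by ring.
- move=> y [Xy Ky]; split.
    rewrite /down; split; rewrite ?row_mxKl ?row_mxKr.
      by split; rewrite ?dnl ?dnr // htl; apply: order_cone_unvertex.
    by rewrite /halfline mxE mulr1n htl; case: Ky.
  by rewrite /up /down row_mxKl row_mxKr mxE mulr1n subrK.
Qed.

Lemma up_base x : up (row_mx x 0) = x.
Proof. by rewrite /up row_mxKl row_mxKr mxE scale0r addr0. Qed.

Lemma down_base y : fib (bd_cone L t) y -> down y = row_mx y 0.
Proof.
move=> [_ /order_cone_bd0]; rewrite mxE => hty.
by rewrite /down /ht hty scale0r subr0 raddf0.
Qed.

(** A homeomorphism of bases extends to the cones over them. *)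
Lemma fibration_extend h g :
  chomeo s sg (T (bd_cone L t)) (fib (bd_cone L t)) h g ->
  exists h' g', [/\ chomeo s sg (T (cone L t)) (fib (cone L t)) h' g',
    forall x, T (bd_cone L t) x -> h' x = h x &
    forall y, fib (bd_cone L t) y -> g' y = g y].
Proof.
move=> hg; have [BT [hc [gc [hgc hB]]]] := Tcol tL.
have hg1 := chomeo_prod hg (chomeo_id (scale_gauge w) (@cpl_halfline R)).
have H := chomeo_trans (chomeo_trans hgc hg1) chomeo_vertex.
do 2!eexists; split; first exact: H.
  by move=> x Bx /=; rewrite hB // row_mxKl row_mxKr up_base.
move=> y By /=; rewrite down_base // row_mxKl row_mxKr.
have [_ _ _ YX] := hg; have [Bg _] := YX y By.
rewrite -[row_mx (g y) _]hB //.
by have [_ _ XY _] := hgc; have [_ -> _] := XY _ (BT _ Bg).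
Qed.

End Vertex.

Let fibS (E F : {set Q}) y : E \subset F -> fib E y -> fib F y.
Proof. by move=> EF [Xy Ky]; split=> //; apply: order_coneS Ky. Qed.

Let fibI (E F : {set Q}) y : fib E y -> fib F y -> fib (E :&: F) y.
Proof. by move=> [Xy Ey] [_ Fy]; split=> //; apply/order_coneI. Qed.

Let fibU (E F : {set Q}) y : closed_in L E -> closed_in L F ->
  (fib (E :|: F) y <-> fib E y \/ fib F y).
Proof.
move=> Ecl Fcl; have EFL : E :|: F \subset L by rewrite subUset Ecl.1 Fcl.1.
have := order_coneU (rsubmx y) (closed_sub Ecl (subsetUl _ _) EFL)
  (closed_sub Fcl (subsetUr _ _) EFL).
by rewrite /fib /prodc; tauto.
Qed.

(** By induction on the number of elements of D. For t maximal in D, the part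
    over D is the union of the parts over D minus t and over the cone of t, which
    meet in the part over the boundary of that cone. There the map is given
    already; it is extended over the cone of t and the two maps are glued. *)
Lemma fibration_on D : closed_in L D -> exists h g,
  chomeo s sg (T D) (fib D) h g /\
  forall E x, closed_in L E -> E \subset D -> T D x -> (T E x <-> fib E (h x)).
Proof.
have [m] := ubnP #|D|; elim: m D => // m IH D Dm Dcl.
have [D0|Dn0] := eqVneq D finset.set0.
  subst D; exists (fun x => row_mx x 0), (fun y => lsubmx y); split; last first.
    move=> E x _; rewrite subset0 => /eqP -> Tx; split=> // _.
    split; rewrite ?row_mxKl ?row_mxKr //.
    exact/order_cone0.
  apply: chomeo_lin => //.
  - by move=> a u v; rewrite scale_row_mx add_row_mx scaler0 addr0.
  - exact: linear_lsub.
  - move=> x Tx; rewrite row_mxKl; split=> //.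
      by split; rewrite ?row_mxKl ?row_mxKr //; apply/order_cone0.
    by rewrite /sg /sum_gauge row_mxKl row_mxKr (scalar_0 (@scalar_total R _)) mulr0 addr0.
  - by move=> y [Ty /order_cone0 Ky]; split=> //; rewrite -[RHS]hsubmxK Ky.
have [t tD tmax] := maximal_ex Dn0; have tL := subsetP Dcl.1 t tD.
have D'cl := closed_del Dcl tmax; set D' := D :\ t in D'cl.
have Ccl := closed_cone L t; have Bcl := closed_bd_cone L t.
have CD : cone L t \subset D.
  by apply/subsetP => p; rewrite inE => /andP[pL pt]; apply: Dcl.2 pL tD pt.
have CE : cone L t = t |: bd_cone L t.
  by apply/setP => p; rewrite !inE le_eqVlt; case: eqP => // ->; rewrite tL.
have BD' : bd_cone L t \subset D'.
  apply/subsetP => p pB; rewrite in_setD1 (subsetP CD) ?andbT.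
    by move: pB; rewrite inE lt_neqAle => /and3P[].
  by rewrite CE in_setU1 pB orbT.
have BC : bd_cone L t \subset cone L t by rewrite CE subsetUr.
have DU : D' :|: cone L t = D.
  apply/setP => p; rewrite inE in_setD1; apply/orP/idP => [[/andP[]//|/(subsetP CD)//]|pD].
  by have [->|pt] := eqVneq p t; [right; rewrite inE tL lexx|left].
have DI : D' :&: cone L t = bd_cone L t.
  apply/setP => p; rewrite CE inE in_setD1 in_setU1 [in RHS]inE.
  apply/andP/idP => [[/andP[/negPf -> _]]|pB]; first by rewrite inE.
  by have := subsetP BD' p; rewrite !inE pB orbT => /(_ isT).
have D'm : (#|D'| < m)%N by move: Dm; rewrite (cardsD1 t) tD.
have [h' [g' [hg' hE']]] := IH D' D'm D'cl.
have hgB : chomeo s sg (T (bd_cone L t)) (fib (bd_cone L t)) h' g'.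
  have H := @chomeo_sub R _ _ _ _ _ _ _ _ hg' (T (bd_cone L t)) (fib (bd_cone L t)).
  apply: H => //; first by move=> x; apply: TS.
  - by move=> y; apply: fibS.
  - by move=> x Tx; apply: hE'.
have [h2 [g2 [hg2 h2B g2B]]] := fibration_extend tL hgB.
have TBI x : T D' x -> T (cone L t) x -> T (bd_cone L t) x.
  by move=> Dx Cx; rewrite -DI; apply/TI.
have [h [g [hg hh' hh2]]] : exists h g,
    [/\ chomeo s sg (fun x => T D' x \/ T (cone L t) x)
          (fun y => fib D' y \/ fib (cone L t) y) h g,
    forall x, T D' x -> h x = h' x & forall x, T (cone L t) x -> h x = h2 x].
  apply: chomeo_glue hg' hg2 _ _ => [x Dx Cx|y Dy Cy].
    by rewrite h2B //; apply: TBI.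
  by rewrite g2B // -DI; apply: fibI.
have TD x : T D x <-> T D' x \/ T (cone L t) x by rewrite -DU; apply: TU.
exists h, g; split.
  by apply: chomeo_ext hg _ _ _ _ => // y; [rewrite TD|rewrite -DU fibU].
move=> E x Ecl ED /TD Tx.
have HC x' : T (cone L t) x' -> fib (cone L t) (h2 x') by have [_ _ XY _] := hg2 => /XY[].
have HD x' : T D' x' -> fib D' (h' x') by have [_ _ XY _] := hg' => /XY[].
have back x' : T (cone L t) x' -> fib (bd_cone L t) (h2 x') -> T (bd_cone L t) x'.
  move=> Cx' /[dup] Bh /g2B; have [_ _ XY _] := hg2; have [_ -> _] := XY x' Cx' => ->.
  by have [_ _ _ YX] := hgB; have [] := YX _ Bh.
have EI : closed_in L (E :&: D') by apply: closed_inI.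
have EID' : E :&: D' \subset D' by apply: subsetIr.
have onD' : T D' x -> (T E x <-> fib E (h x)).
  move=> Dx; rewrite hh' //; have := hE' (E :&: D') x EI EID' Dx.
  rewrite TI // => H; split=> [Ex|hEx].
    by apply: fibS (subsetIl E D') _; apply/H.
  by apply: (H.2 _).1; apply: fibI => //; apply: HD.
case: Tx => [|Cx]; first exact: onD'.
have [tE|tE] := boolP (t \in E).
  have CsE : cone L t \subset E.
    by apply/subsetP => p; rewrite inE => /andP[pL pt]; apply: Ecl.2 pL tE pt.
  split=> _; first by rewrite hh2 //; apply: fibS CsE _; apply: HC.
  exact: TS CsE Cx.
have EC : E :&: cone L t \subset bd_cone L t.
  apply/subsetP => p; rewrite CE !inE => /andP[pE /orP[/eqP pt|//]].
  by rewrite pt (negPf tE) in pE.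
split=> [Ex|hEx].
  apply/onD' => //; apply: TS BD' _ => //; apply: TS EC _ => //; first exact: closed_inI.
  by apply/TI.
have Bx : T (bd_cone L t) x.
  apply: back => //; apply: fibS EC _; rewrite -hh2 //.
  by apply: fibI => //; rewrite hh2 //; apply: HC.
by apply/onD' => //; apply: TS BD' Bx.
Qed.

Lemma fibration : exists h g,
  chomeo s sg (T L) (fib L) h g /\
  forall E x, closed_in L E -> T L x -> (T E x <-> fib E (h x)).
Proof.
have [h [g [hg hE]]] := fibration_on (closed_in_self L); exists h, g; split=> // E x Ecl Tx.
by apply: hE => //; case: Ecl.
Qed.

End Fibration.

(** * Cellular maps *)

Section Join.
Variable R : realType.
Variables (n m : nat) (sX : 'rV[R]_n -> R) (sY : 'rV[R]_m -> R).
Variables (X : set 'rV[R]_n) (Y : set 'rV[R]_m) (a b : nat).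
Variables (hX : 'rV[R]_n -> 'rV[R]_a.+1) (gX : 'rV[R]_a.+1 -> 'rV[R]_n).
Variables (hY : 'rV[R]_m -> 'rV[R]_b.+1) (gY : 'rV[R]_b.+1 -> 'rV[R]_m).
Hypothesis hgX : chomeo sX (@total R _) X (@bd_orthant R a.+1) hX gX.

Lemma join_ball : chomeo sY (@total R _) Y (@orthant R b.+1) hY gY ->
  exists h g, chomeo (sum_gauge sX sY) (@total R _) (prodc X Y) (@orthant R (a + b).+1) h g /\
    forall z, prodc X Y z -> (bd_orthant (hY (rsubmx z)) <-> bd_orthant (h z)).
Proof.
move=> hgY; have [h [g [hg hB]]] := join_orthant R a b.
have H := chomeo_prod hgX hgY.
do 2!eexists; split; first exact: chomeo_trans H hg.
move=> z Xz; have [_ _ XY _] := H; have [zO _ _] := XY z Xz.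
by have := hB _ zO; rewrite row_mxKr.
Qed.

Lemma join_sphere : chomeo sY (@total R _) Y (@bd_orthant R b.+1) hY gY ->
  exists h g, chomeo (sum_gauge sX sY) (@total R _) (prodc X Y) (@bd_orthant R (a + b).+1) h g.
Proof.
move=> hgY; have [h [g [hg hB]]] := join_orthant R a b.
have H := chomeo_prod hgX hgY.
have hg' : chomeo (sum_gauge (@total R a.+1) (@total R (1 + b))) (@total R (a.+1 + b))
    (prodc (@bd_orthant R a.+1) (@bd_orthant R (1 + b))) (@bd_orthant R (a.+1 + b)) h g.
  apply: (chomeo_sub hg) => [|z []|z []//|z Oz].
  - exact: cpl_bd_orthant.
  - by move=> ? [].
  - by rewrite -hB // /prodc; case: Oz => [? ?]; tauto.
by do 2!eexists; exact: chomeo_trans H hg'.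
Qed.

End Join.

Lemma open_bd_cone (d : Order.disp_t) (Q : finPOrderType d) (Z : {set Q}) q : open_in [set: Q] Z ->
  closed_in (opset (bd_cone [set: Q] q)) (opset (bd_cone Z q)).
Proof.
move=> [_ Zop]; split; first by apply/subsetP => y; rewrite !inE => /andP[].
move=> y z; rewrite !inE /= => yq /andP[zZ zq] yz; rewrite yq andbT.
by apply: (Zop y z) => //; rewrite inE.
Qed.

Section Cellular.
Variables (R : realType) (d d' : Order.disp_t).
Variables (P : finPOrderType d) (Q : finPOrderType d') (f : P -> Q).
Hypothesis fcell : cellular R f.

Let fmono x y : (x <= y)%O -> (f x <= f y)%O.
Proof. by case: fcell => fm _; apply: fm. Qed.

Section At.
Variable p : P.

(** The lower link of p in its fibre. *)
Definition fiber_below : {set P^d} := opset [set x | (x < p)%O && (f x == f p)].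

Lemma fiber_below_sphere : is_sphere R fiber_below.
Proof.
have [_ /(_ (f p)) [_ + _]] := fcell.
move=> /(_ p); rewrite !inE lexx ltxx => /(_ isT isT).
congr is_sphere; apply/setP => x; rewrite !inE /= andbC.
case: (boolP ((x : P) < p)%O) => //= xp.
by rewrite eq_le (fmono (ltW xp)).  
Qed.

Let L : {set Q^d} := opset (bd_cone [set: Q] (f p)).
Let A (E : {set Q^d}) : {set P^d} :=
  opset [set x | (x < p)%O && ((f x == f p) || ((f x : Q^d) \in E))].
Let T E := @order_cone R _ _ (A E).

Let inL (q : Q) : ((q : Q^d) \in L) = (q < f p)%O.
Proof. by rewrite !inE. Qed.

Let AU E F : closed_in L E -> closed_in L F -> closed_in (A (E :|: F)) (A E).
Proof.
move=> [EL Ecl] [FL Fcl]; split.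
  by apply/subsetP => x; rewrite !inE => /andP[-> /orP[->|->]]; rewrite ?orbT.
move=> x y; rewrite !inE => /andP[xp fx] /andP[yp fy] xy; rewrite xp /=.
have xy' : ((y : P) <= x)%O := xy.
have fyx := fmono xy'; have fxp := fmono (ltW xp).
case/orP: fy => [/eqP fy|fy].
  by apply/orP; left; rewrite eq_le fxp -fy.
have [//|fxp'] := eqVneq (f x) (f p).
apply: (Ecl (f x : Q^d) (f y)) => //.
by rewrite inL lt_neqAle fxp' fxp.
Qed.

(** The boundary of the cone of p is the join of a sphere and the boundary of
    the cone of f p. Orders are reversed, so that the preimages of open subsets
    of Q are indexed by closed subsets; the pieces are balls by cellularity. *)
Lemma cellular_below : exists h g,
  chomeo (@total R _) (sum_gauge (@total R _) (@total R _))
    (@order_cone R _ _ (opset (bd_cone [set: P] p)))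
    (prodc (@order_cone R _ _ fiber_below)
       (@order_cone R _ _ (opset (bd_cone [set: Q] (f p))))) h g /\
  forall Z, open_in [set: Q] Z -> f p \in Z ->
    forall x, order_cone (opset (bd_cone [set: P] p)) x ->
      (order_cone (opset (bd_cone (f @^-1: Z) p)) x <->
       order_cone (opset (bd_cone Z (f p))) (rsubmx (h x))).
Proof.
have A0 : A finset.set0 = fiber_below by apply/setP => x; rewrite !inE orbF.
have AL : A L = opset (bd_cone [set: P] p).
  apply/setP => x; rewrite !inE /=; case: (boolP ((x : P) < p)%O) => //= /ltW/fmono.
  by rewrite le_eqVlt.
have TI E F x : closed_in L E -> closed_in L F -> (T (E :&: F) x <-> T E x /\ T F x).
  move=> _ _; rewrite -order_coneI /T; suff -> : A (E :&: F) = A E :&: A F by [].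
  by apply/setP => y; rewrite !inE; case: (_ < _)%O; case: (_ == _).
have TU E F x : closed_in L E -> closed_in L F -> (T (E :|: F) x <-> T E x \/ T F x).
  move=> Ecl Fcl; have AEF : A (E :|: F) = A E :|: A F.
    by apply/setP => y; rewrite !inE; case: (_ < _)%O; case: (_ == _).
  rewrite /T AEF; apply: order_coneU; rewrite -AEF; first exact: AU.
  by rewrite finset.setUC; apply: AU.
have Tcol t : t \in L -> collared 1 (@total R _) (T (cone L t)) (T (bd_cone L t)).
  rewrite inL => tp; have [_ /(_ t) [_ _]] := fcell.
  move=> /(_ p); rewrite !inE => /(_ tp) /is_ballP[[BT _] [n [H [G [HG HB]]]]].
  apply: collared_sub (collared_transport HG _ HB (orthant_collared R n)) _ _.
  - by move=> x; apply: order_coneS.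
  - move=> x; suff -> : opset (bd_cone (f @^-1: dual_cone [set: Q] t) p) = A (cone L t) by [].
    apply/setP => y; rewrite !inE /= andbC; case: (boolP ((y : P) < p)%O) => //= /ltW/fmono.
    rewrite le_eqVlt; case: eqP => [->|_] /=; first by rewrite ltW.
    by move=> ->.
  - move=> x; suff -> : opset (bd_cone (f @^-1: bd_dual_cone [set: Q] t) p) = A (bd_cone L t) by [].
    apply/setP => y; rewrite !inE /= andbC; case: (boolP ((y : P) < p)%O) => //= /ltW/fmono.
    rewrite le_eqVlt; case: eqP => [->|_] /=; first by rewrite tp.
    by move=> ->.
have [h [g [hg hE]]] := fibration TI TU Tcol (cpl_order_cone R (A finset.set0)).
rewrite /T AL in hg hE; rewrite A0 in hg hE.
exists h, g; split.
  by apply: chomeo_ext hg _ _ _ _ => // y _; rewrite /sum_gauge mul1r.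
move=> Z Zop pZ x Px; have [_ _ XY _] := hg; have [[Xh _] _ _] := XY x Px.
have Ecl : closed_in L (opset (bd_cone Z (f p))) := open_bd_cone (f p) Zop.
have := hE _ x Ecl Px.
suff -> : A (opset (bd_cone Z (f p))) = opset (bd_cone (f @^-1: Z) p) by rewrite /prodc; tauto.
apply/setP => y; rewrite !inE /= [RHS]andbC; case: (boolP ((y : P) < p)%O) => //= /ltW/fmono.
rewrite le_eqVlt; case: eqP => [->|_] /=; first by rewrite pZ.
by move=> ->; rewrite andbT.
Qed.

End At.

End Cellular.

Section CellComplexes.
Variables (R : realType) (d d' : Order.disp_t).
Variables (P : finPOrderType d) (Q : finPOrderType d') (f : P -> Q) (Z : {set Q}).
Hypothesis fcell : cellular R f.
Hypothesis Zop : open_in [set: Q] Z.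

Lemma preim_open : open_in [set: P] (f @^-1: Z).
Proof.
split=> [|x y _]; first exact: subsetT.
rewrite !inE => fyZ yx; apply: Zop.2 fyZ _; rewrite ?inE //.
by case: fcell => fm _; apply: fm.
Qed.

Lemma cellular_pullback : cell_complex_cobd R [set: Q] Z ->
  cell_complex_cobd R [set: P] (f @^-1: Z).
Proof.
move=> [_ Qs Qb]; split; first exact: preim_open.
  move=> p _; rewrite inE => pZ; apply/is_sphereP.
  have [h [g [hg _]]] := cellular_below fcell p.
  have [a [hX [gX hgX]]] := (is_sphereP R _).1 (fiber_below_sphere fcell p).
  have [b [hY [gY hgY]]] := (is_sphereP R _).1 (Qs _ (in_setT _) pZ).
  have [h' [g' hg']] := join_sphere hgX hgY.
  by exists (a + b)%N; do 2!eexists; exact: chomeo_trans hg hg'.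
move=> p; rewrite inE => pZ; apply/is_ballP; split; first exact: open_bd_cone preim_open.
have [h [g [hg hZ]]] := cellular_below fcell p.
have [a [hX [gX hgX]]] := (is_sphereP R _).1 (fiber_below_sphere fcell p).
have [_ [b [hY [gY [hgY HB]]]]] := (is_ballP R _ _).1 (Qb _ pZ).
have [h' [g' [hg' hB']]] := join_ball hgX hgY.
exists (a + b)%N; do 2!eexists; split; first exact: chomeo_trans hg hg'.
move=> x Px; rewrite hZ //=; have [_ _ XY _] := hg; have [Xh _ _] := XY x Px.
by rewrite -hB' // -HB //; case: Xh.
Qed.

(** Over q, take p minimal in its fibre: the spherical factor is then empty, and
    the boundaries of the cones of p and q are homeomorphic. *)
Lemma cellular_pushforward : (forall q, exists p, f p = q) ->
  cell_complex_cobd R [set: P] (f @^-1: Z) -> cell_complex_cobd R [set: Q] Z.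
Proof.
move=> fsurj [_ Ps Pb].
have min q : exists2 p, f p = q & fiber_below f p = finset.set0.
  have : (opset (f @^-1: [set q]) : {set P^d}) != finset.set0.
    by have [p fp] := fsurj q; apply/set0Pn; exists p; rewrite !inE fp.
  move=> /maximal_ex[p]; rewrite !inE => /eqP fp pmin; exists p => //.
  apply/setP => x; rewrite !inE; apply/andP => -[xp fx].
  have := pmin x; rewrite !inE (eqP fx) fp eqxx => /(_ isT).
  by move=> /negP; apply; exact: xp.
have below q : exists p h g, [/\ f p = q,
    chomeo (@total R _) (@total R _) (@order_cone R _ _ (opset (bd_cone [set: P] p)))
      (@order_cone R _ _ (opset (bd_cone [set: Q] q))) h g &
    q \in Z -> forall x, order_cone (opset (bd_cone [set: P] p)) x ->
      (order_cone (opset (bd_cone (f @^-1: Z) p)) x <->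
       order_cone (opset (bd_cone Z q)) (h x))].
  have [p fp p0] := min q; have [h [g [hg hZ]]] := cellular_below fcell p.
  rewrite p0 fp in hg hZ; exists p; do 2!eexists; split=> //.
    apply: chomeo_trans hg _.
    apply: (@chomeo_lin R _ _ _ _ _ _ (fun z => rsubmx z) (fun y => row_mx 0 y)).
    - by apply: cpl_prod; apply: cpl_order_cone.
    - exact: cpl_order_cone.
    - exact: linear_rsub.
    - by move=> a u v; rewrite scale_row_mx add_row_mx scaler0 addr0.
    - move=> z [/order_cone0 z0 Kz]; split=> //; first by rewrite -z0 hsubmxK.
      by rewrite /sum_gauge z0 (scalar_0 (@scalar_total R _)) add0r.
    - by move=> y Ky; rewrite /prodc row_mxKl row_mxKr; split=> //; split=> //; apply/order_cone0.
  by move=> qZ x Px; apply: hZ.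
split=> // q.
  move=> _ qZ; have [p [h [g [fp hg _]]]] := below q.
  have pZ : p \notin f @^-1: Z by rewrite inE fp.
  have [a [hX [gX hgX]]] := (is_sphereP R _).1 (Ps _ (in_setT _) pZ).
  by apply/is_sphereP; exists a; do 2!eexists; exact: chomeo_trans (chomeo_sym hg) hgX.
move=> qZ; have [p [h [g [fp hg hZ]]]] := below q.
have pZ : p \in f @^-1: Z by rewrite inE fp.
have [_ [a [hX [gX [hgX HB]]]]] := (is_ballP R _ _).1 (Pb _ pZ).
apply/is_ballP; split; first exact: open_bd_cone.
exists a; do 2!eexists; split; first exact: chomeo_trans (chomeo_sym hg) hgX.
move=> y Ky; have [_ _ _ YX] := hg; have [Pg hgy] := YX y Ky.
by rewrite /= -HB // hZ // hgy.
Qed.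

End CellComplexes.

(** * One-skeleta and pseudo-comanifolds *)

Section Skeleton.
Variables (d : Order.disp_t) (P : finPOrderType d) (A B : {set P}).
Hypothesis Acl : closed_in B A.

Lemma bd_cone_closed p : p \in A -> bd_cone A p = bd_cone B p.
Proof.
move=> pA; apply/setP => q; rewrite !inE; case: (boolP (q < p)%O) => [qp|]; last by rewrite !andbF.
rewrite !andbT; apply/idP/idP => [/(subsetP Acl.1)//|qB].
exact: Acl.2 qB pA (ltW qp).
Qed.

Lemma atom_closed p : p \in A -> atom A p = atom B p.
Proof. by move=> pA; rewrite /atom bd_cone_closed // pA (subsetP Acl.1). Qed.

Lemma covers_closed p q : p \in A -> covers_in A p q = covers_in B p q.
Proof.
move=> pA; rewrite /covers_in pA (subsetP Acl.1 p pA) /=.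
case: (boolP (q < p)%O) => [qp|]; last by rewrite !andbF.
have -> : (q \in A) = (q \in B).
  by have := congr1 (fun X : {set P} => q \in X) (bd_cone_closed pA); rewrite !inE qp !andbT.
congr (_ && _); apply/forall_inP/forall_inP => H r.
  move=> rB; apply/negP => /andP[qr rp]; have rA := Acl.2 r p rB pA (ltW rp).
  by have := H r rA; rewrite qr rp.
by move=> /(subsetP Acl.1); apply: H.
Qed.

Lemma skel1_closed p : p \in A -> (p \in skel1 A) = (p \in skel1 B).
Proof.
move=> pA; rewrite !inE atom_closed // pA (subsetP Acl.1 p pA) /=.
congr (_ || _); apply: eq_existsb => q; rewrite covers_closed //.
have [cq|_] := boolP (covers_in B p q); last by rewrite !andbF.
have := cq; rewrite -covers_closed // => /and4P[_ qA _ _].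
by rewrite !andbT atom_closed.
Qed.

(** Atoms, covers and boundaries of cones involve only smaller elements, so they
    are not affected by passing to a closed subset. *)
Lemma bd_cone_skel1_closed p : p \in A -> bd_cone (skel1 A) p = bd_cone (skel1 B) p.
Proof.
move=> pA; apply/setP => q; rewrite [LHS]inE [RHS]inE.
case: (boolP (q < p)%O) => [qp|]; last by rewrite !andbF.
rewrite !andbT; have [qA|qA] := boolP (q \in A); first by rewrite skel1_closed.
apply/idP/idP; rewrite inE => /andP[qB _]; first by rewrite qB in qA.
by rewrite (Acl.2 q p qB pA (ltW qp)) in qA.
Qed.

End Skeleton.

Lemma order_complex1 (d : Order.disp_t) (P : finPOrderType d) (t : P) :
  dim_poset [set t] = 0.
Proof.
rewrite /dim_poset; suff -> : (\max_(c in order_complex [set t]) #|c| = 1)%N by [].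
apply/eqP; rewrite eqn_leq; apply/andP; split.
  apply/bigmax_leqP => c; rewrite inE => /and3P[_ ct _].
  by have := subset_leq_card ct; rewrite cards1.
have tc : [set t] \in order_complex [set t].
  rewrite inE; apply/and3P; split=> //; first by apply/set0Pn; exists t; rewrite inE.
  by apply/chainP => p q; rewrite !inE => /eqP -> /eqP ->; apply: comparablexx.
by apply: leq_trans (leq_bigmax_cond _ tc); rewrite cards1.
Qed.

Section Pseudo.
Variables (R : realType) (d d' : Order.disp_t).
Variables (M : finPOrderType d) (N : finPOrderType d') (f : M -> N) (m : int) (Z : {set N}).

(** For purity, a chain of M maps below some maximal element t of N, and the
    preimage of the cone of t has dimension m, as the cone of t in the dual of N
    is a point. *)
Lemma pseudo_comanifold_total :
  cell_complex_cobd R (opset [set: N]) (opset Z) -> pseudo_comanifold_of_dim R f m ->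
  pseudostar_manifold R m [set: M] (f @^-1: Z).
Proof.
move=> NZ [fmono _ fM]; split.
- move=> c; rewrite inE => /and3P[c0 _ cc].
  have cM : chain (c : {set M}).
    by apply/chainP => p q pc qc; have /chainP := cc; move=> /(_ q p qc pc).
  have [e ec emax] := chain_max cM c0.
  have [t te tmax] : exists2 t, (f e <= t)%O & forall u, ~~ (t < u)%O.
    have : [set u | (f e <= u)%O] != finset.set0 by apply/set0Pn; exists (f e); rewrite inE.
    move=> /maximal_ex[t]; rewrite inE => et tmax; exists t => // u.
    apply/negP => tu; have := tmax u; rewrite inE (le_trans et (ltW tu)) tu.
    by move=> /(_ isT).
  have [pure _ _] := fM t; have E : cone [set: N^d] (t : N^d) = [set (t : N^d)].
    apply/setP => u; rewrite !inE /=; apply/idP/eqP => [|->//].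
    change ((t <= u)%O -> u = t); have := tmax u.
    by rewrite lt_neqAle negb_and negbK => /orP[/eqP ->|/negPf ->].
  rewrite E order_complex1 subr0 in pure.
  have [|c' [c'c cc' c'm]] := pure c.
    rewrite inE c0 cc andbT /=; apply/subsetP => x xc; rewrite !inE.
    by apply: le_trans te; apply: fmono; apply: emax.
  exists c'; split=> //; move: c'c; rewrite !inE => /and3P[-> _ ->]; rewrite andbT /=.
  by apply/subsetP => x _; rewrite !inE.
- have opT (d0 : Order.disp_t) (T : finPOrderType d0) : opset [set: T] = [set: T^d].
    by apply/setP => x; rewrite !inE.
  rewrite opT in NZ *.
  have fcell : @cellular R _ _ M^d N^d f.
    split=> [x y xy|q]; first by apply: (fmono y x).
    have [_ H _] := fM q; move: H; congr cell_complex_cobd; apply/setP => x; rewrite !inE //.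
  have [Zop _ _] := NZ.
  have := cellular_pullback fcell Zop NZ; congr cell_complex_cobd;
  by apply/(@setP M^d) => x; rewrite !inE.
- move=> p pS; have [_ _ /(_ p)] := fM (f p).
  set A := opset (opset _); have Acl : closed_in (opset (opset [set: M])) A.
    split; first by apply/subsetP => x _; rewrite !inE.
    move=> x y _; rewrite !inE /= => yp xy.
    by apply: le_trans yp; apply: (fmono x y).
  have pA : p \in A by rewrite !inE /=.
  by rewrite (skel1_closed Acl pA) => /(_ pS); rewrite (bd_cone_skel1_closed Acl pA).
Qed.

End Pseudo.

(** * Germs and tangent cones *)

Section Germs.
Variable R : realType.

Definition small (E : R -> Prop) : Prop :=
  exists2 d, 0 < d & forall e, 0 < e -> e <= d -> E e.

Lemma fin_lower (J : finType) (f : J -> R) : (forall j, 0 < f j) ->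
  exists2 d, 0 < d & forall j, d <= f j.
Proof.
move=> f0; have S0 : 0 <= \sum_j (f j)^-1.
  by apply: sumr_ge0 => j _; rewrite invr_ge0 ltW.
exists (1 + \sum_j (f j)^-1)^-1 => [|j]; first by rewrite invr_gt0 ltr_pwDl.
rewrite -[leRHS]invrK lef_pV2 ?posrE ?invr_gt0 ?ltr_pwDl //.
rewrite (bigD1 j) //= addrCA lerDl addr_ge0 // sumr_ge0 // => i _.
by rewrite invr_ge0 ltW.
Qed.

Lemma small_all (J : finType) (E : J -> R -> Prop) :
  (forall j, small (E j)) -> small (fun e => forall j, E j e).
Proof.
move=> H; have /choice[f Hf] : forall j, exists d, 0 < d /\ forall e, 0 < e -> e <= d -> E j e.
  by move=> j; have [d d0 Hd] := H j; exists d.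
have [d d0 df] := fin_lower (fun j => (Hf j).1).
by exists d => // e e0 ed j; apply: (Hf j).2 => //; apply: le_trans ed (df j).
Qed.

Lemma small_and (E F : R -> Prop) : small E -> small F -> small (fun e => E e /\ F e).
Proof.
move=> [d d0 HE] [d' d'0 HF]; exists (Num.min d d'); first by rewrite lt_min d0.
by move=> e e0; rewrite le_min => /andP[ed ed']; split; [apply: HE|apply: HF].
Qed.

Lemma small_imp (E F : R -> Prop) : small E -> (forall e, 0 < e -> E e -> F e) -> small F.
Proof. by move=> [d d0 H] EF; exists d => // e e0 ed; apply: EF => //; apply: H. Qed.

Lemma small_ex (E : R -> Prop) : small E -> exists2 e, 0 < e & E e.
Proof. by move=> [d d0 H]; exists d => //; apply: H. Qed.

Lemma small_le d : 0 < d -> small (fun e => e <= d).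
Proof. by move=> d0; exists d. Qed.

Definition box n (d : R) (v : 'rV[R]_n) : Prop := forall i, `|v 0 i| <= d.

Lemma boxS n d d' (v : 'rV[R]_n) : d <= d' -> box d v -> box d' v.
Proof. by move=> dd' H i; apply: le_trans dd'. Qed.

Lemma small_box n d (v : 'rV[R]_n) : 0 < d -> small (fun e => box d (e *: v)).
Proof.
move=> d0; apply: small_all => i.
have v0 : 0 < 1 + `|v 0 i| by rewrite ltr_pwDl.
exists (d / (1 + `|v 0 i|)) => [|e e0]; first by rewrite divr_gt0.
rewrite ler_pdivlMr // => ed; rewrite mxE normrM gtr0_norm //.
by apply: le_trans ed; rewrite ler_pM2l // lerDr.
Qed.

Definition tangent n (X : set 'rV[R]_n) x : set 'rV[R]_n :=
  fun v => small (fun e => X (x + e *: v)).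

Lemma tangent_local n (X Y : set 'rV[R]_n) x r v : 0 < r ->
  (forall v, box r v -> X (x + v) <-> Y (x + v)) -> tangent X x v <-> tangent Y x v.
Proof.
move=> r0 XY; have S := small_box v r0.
by split=> H; apply: small_imp (small_and S H) _ => e _ [bv]; apply (XY _ bv).
Qed.

Lemma tangentI n (X Y : set 'rV[R]_n) x v :
  tangent (fun y => X y /\ Y y) x v <-> tangent X x v /\ tangent Y x v.
Proof.
split=> [H|[HX HY]]; last exact: small_and.
by split; apply: small_imp H _ => e _ [].
Qed.

Lemma tangentS n (X Y : set 'rV[R]_n) x v :
  (forall y, X y -> Y y) -> tangent X x v -> tangent Y x v.
Proof. by move=> XY H; apply: small_imp H _ => e _; apply: XY. Qed.

(** Near x, the constraints that are strict at x are satisfied, those that fail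
    at x fail, and the ones that are tight at x are linear in the displacement. *)
Lemma convex_local n (C : set 'rV[R]_n) x : convex_polyhedron C ->
  exists d D, [/\ 0 < d, polycone D & forall v, box d v -> (C (x + v) <-> C x /\ D v)].
Proof.
move=> [k [A [b CE]]].
pose l j := (x *m A) 0 j - b 0 j.
have CP y : C y <-> forall j, (y *m A) 0 j <= b 0 j by rewrite CE.
have [K K0 HK] := mulmx_bound A.
have [d d0 dl] : exists2 d, 0 < d & forall j, d <= if l j == 0 then 1 else `|l j| / 2.
  by apply: fin_lower => j; case: eqP => // /eqP lj; rewrite divr_gt0 ?normr_gt0.
exists (d / K), (fun v => forall j : {j | l j == 0}, (v *m A) 0 (val j) <= 0); split.
- by rewrite divr_gt0.
- by apply: (@polycone_le R n _ (fun j v => (v *m A) 0 (val j))) => j; apply: scalar_mul.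
- move=> v bv.
  have vA j : `|(v *m A) 0 j| <= d.
    have dK : 0 <= d / K by rewrite divr_ge0 ?ltW.
    by apply: le_trans (HK v (d / K) dK bv j) _; rewrite mulrC divfK // gt_eqF.
  have xv j : ((x + v) *m A) 0 j - b 0 j = l j + (v *m A) 0 j.
    by rewrite mulmxDl mxE /l; ring.
  have far j : l j != 0 -> `|(v *m A) 0 j| < `|l j|.
    move=> lj; apply: le_lt_trans (vA j) _; have := dl j; rewrite (negPf lj).
    move=> dlj; apply: le_lt_trans dlj _.
    by rewrite ltr_pdivrMr // ltr_pMr ?normr_gt0 // ltr1n.
  split=> [/CP Cxv|[/CP Cx Dv]].
    split=> [|[j /= /eqP lj]]; last first.
      by have := Cxv j; rewrite -subr_le0 xv lj add0r.
    apply/CP => j; rewrite -subr_le0 -/(l j); have := Cxv j; rewrite -subr_le0 xv.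
    have [->//|/far] := eqVneq (l j) 0.
    rewrite leNgt => H1 H2; rewrite leNgt; apply/negP => lj0.
    move/negP: H2; apply; move: H1; rewrite (gtr0_norm lj0) ltr_norml; lra.
  apply/CP => j; rewrite -subr_le0 xv.
  have [lj|lj] := eqVneq (l j) 0.
    by rewrite lj add0r; apply: (Dv (exist _ j (introT eqP lj))).
  have : l j <= 0 by rewrite /l subr_le0.
  by have := far j lj => + lj0; rewrite (ler0_norm lj0) ltr_norml; lra.
Qed.

Lemma convex_dichotomy n (C : set 'rV[R]_n) x v : convex_polyhedron C ->
  small (fun e => C (x + e *: v)) \/ small (fun e => ~ C (x + e *: v)).
Proof.
move=> /(convex_local x)[d [D [d0 PD HC]]]; have S := small_box v d0.
have [H|H] := pselect (C x /\ D v); [left|right]; apply: small_imp S _ => e e0 /HC -> ;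
  by have := polyconeZ_iff v PD e0; tauto.
Qed.

(** A PL map has a derivative at each point: near x the set X is a cone with
    apex x, and h is affine along its rays. The value of the derivative at a
    vector v is a difference quotient at the scale [es v], small enough for the
    pieces of h that contain x to be cones. *)
Lemma germ n m (X : set 'rV[R]_n) (h : 'rV[R]_n -> 'rV[R]_m) x :
  pl_on X h -> X x -> exists d F, [/\ 0 < d, cpl_on (tangent X x) F,
    forall v, box d v -> (X (x + v) <-> tangent X x v) &
    forall v, box d v -> X (x + v) -> h (x + v) = h x + F v].
Proof.
move=> [k [C [HC XC hA]]] Xx.
have XP y : X y <-> exists i, C i y.
  by rewrite XC; split=> [[i _ Ci]|[i Ci]]; exists i.
have /choice[dD HdD] : forall i, exists dD : R * set 'rV[R]_n,
    [/\ 0 < dD.1, polycone dD.2 & forall v, box dD.1 v -> (C i (x + v) <-> C i x /\ dD.2 v)].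
  by move=> i; have [d [D [d0 PD HD]]] := convex_local x (HC i); exists (d, D).
have /choice[AB HAB] : forall i, exists AB : 'M[R]_(n, m) * 'rV[R]_m,
    forall y, C i y -> h y = y *m AB.1 + AB.2.
  by move=> i; have [A [b H]] := hA i; exists (A, b).
have [d d0 dle] : exists2 d, 0 < d & forall i, d <= (dD i).1.
  by apply: fin_lower => i; have [] := HdD i.
have HD i v : box d v -> (C i (x + v) <-> C i x /\ (dD i).2 v).
  by move=> bv; have [_ _] := HdD i; apply; apply: boxS bv.
have PD i : polycone (dD i).2 by have [] := HdD i.
pose J := {i | `[< C i x >]}.
have DZ i e v : 0 < e -> (dD i).2 (e *: v) <-> (dD i).2 v.
  exact: polyconeZ_iff.
have TD v : tangent X x v <-> exists j : J, (dD (val j)).2 v.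
  split=> [H|[[i /= /asboolP Ci] Dv]].
    have [e e0 [/XP[i Ci] bv]] := small_ex (small_and H (small_box v d0)).
    have [Cx Dv] := (HD i _ bv).1 Ci.
    by exists (exist _ i (introT (asboolP _) Cx)); apply/(DZ _ e).
  apply: small_imp (small_box v d0) _ => e e0 bv; apply/XP; exists i.
  by apply/HD => //; split=> //; apply/DZ.
have lin i v : C i x -> C i (x + v) -> h (x + v) = h x + v *m (AB i).1.
  by move=> Cx Cv; rewrite (HAB i) // (HAB i x) // mulmxDl addrAC.
have /choice[es Hes] : forall v : 'rV[R]_n, exists e, 0 < e /\ box d (e *: v).
  by move=> v; have [e] := small_ex (small_box v d0); exists e.
pose F v := (es v)^-1 *: (h (x + es v *: v) - h x).
have FD i v : C i x -> (dD i).2 v -> F v = v *m (AB i).1.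
  move=> Cx Dv; have [e0 be] := Hes v; have De := (DZ i _ v e0).2 Dv.
  rewrite /F (lin i) //; last exact/HD.
  by rewrite addrAC subrr add0r -scalemxAl scalerA mulVf ?gt_eqF // scale1r.
exists d, F; split=> //.
- exists J, (fun j => (dD (val j)).2), (fun j => (AB (val j)).1); split=> //.
  by move=> [i /= /asboolP Cx] v; apply: FD.
- move=> v bv; rewrite XP TD; split=> [[i Ci]|[[i /= /asboolP Ci] Dv]].
    have [Cx Dv] := (HD i _ bv).1 Ci.
    by exists (exist _ i (introT (asboolP _) Cx)).
  by exists i; apply/HD.
- move=> v bv /XP[i Ci]; have [Cx Dv] := (HD i _ bv).1 Ci.
  by rewrite (FD i) // (lin i).
Qed.

Lemma cpl_pl n m (X : set 'rV[R]_n) (h : 'rV[R]_n -> 'rV[R]_m) :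
  cpl_on X h -> pl_on X h.
Proof.
move=> [J [C [A [HC XC hA]]]]; exists #|J|, (fun i => C (enum_val i)); split.
- by move=> i; apply: polycone_convex.
- apply/seteqP; split=> x /= => [/XC[j Cx]|[i _ Cx]]; last by apply/XC; exists (enum_val i).
  by exists (enum_rank j) => //; rewrite enum_rankK.
- by move=> i; exists (A (enum_val i)), 0 => x Cx; rewrite addr0 (hA (enum_val i)).
Qed.

(** If a ray is not eventually in X, it eventually avoids X, as X is
    polyhedral. *)
Lemma tangentU n (X Y : set 'rV[R]_n) x v : pl_on X idfun ->
  tangent (fun y => X y \/ Y y) x v -> tangent X x v \/ tangent Y x v.
Proof.
move=> [k [C [HC XC _]]] H.
have [[i Hi]|N] := pselect (exists i, small (fun e => C i (x + e *: v))).
  by left; apply: small_imp Hi _ => e _ Ci; rewrite XC; exists i.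
right; have : forall i, small (fun e => ~ C i (x + e *: v)).
  move=> i; case: (convex_dichotomy x v (HC i)) => // Hi; case: N; by exists i.
move=> /small_all/(small_and H) S; apply: small_imp S _ => e _ [[|//] + Hi].
by rewrite XC => -[i _ /Hi].
Qed.

(** Derivatives of h and of its inverse are inverse to each other near 0, hence
    everywhere by homogeneity. *)
Lemma germ_homeo n m (X : set 'rV[R]_n) (Y : set 'rV[R]_m) h x :
  pl_homeo X Y h -> X x -> exists d F G,
    [/\ 0 < d, chomeo (fun=> 0) (fun=> 0) (tangent X x) (tangent Y (h x)) F G &
      forall v, box d v -> X (x + v) -> h (x + v) = h x + F v].
Proof.
move=> [Xh XY [g [Yg YX gh hg]]] Xx.
have [d [F [d0 cF locX hF]]] := germ Xh Xx.
have [d' [G [d'0 cG locY gG]]] := germ Yg (XY x Xx).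
rewrite gh // in gG.
have FT v e : tangent X x v -> 0 < e -> box d (e *: v) -> box d' (e *: F v) ->
    [/\ tangent Y (h x) (F v) & G (F v) = v].
  move=> Tv e0 bv bFv.
  have [Tev Fev] := cpl_homo cF (ltW e0) Tv.
  have Xev := (locX _ bv).2 Tev; have := hF _ bv Xev; rewrite Fev => hev.
  have Yev : Y (h x + e *: F v) by rewrite -hev; apply: XY.
  have inv w : e^-1 *: (e *: w) = w :> 'rV[R]_n.
    by rewrite scalerA mulVf ?gt_eqF // scale1r.
  have e'0 : 0 <= e^-1 by rewrite invr_ge0 ltW.
  have [TF GF] := cpl_homo cG e'0 ((locY _ bFv).1 Yev).
  rewrite scalerA mulVf ?gt_eqF // scale1r in TF GF.
  split=> //; rewrite GF; have := gG _ bFv Yev; rewrite -hev gh //.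
  by move=> /addrI <-.
have GT v e : tangent Y (h x) v -> 0 < e -> box d' (e *: v) -> box d (e *: G v) ->
    [/\ tangent X x (G v) & F (G v) = v].
  move=> Tv e0 bv bGv.
  have [Tev Gev] := cpl_homo cG (ltW e0) Tv.
  have Yev := (locY _ bv).2 Tev; have := gG _ bv Yev; rewrite Gev => gev.
  have Xev : X (x + e *: G v) by rewrite -gev; apply: YX.
  have e'0 : 0 <= e^-1 by rewrite invr_ge0 ltW.
  have [TG FG] := cpl_homo cF e'0 ((locX _ bGv).1 Xev).
  rewrite scalerA mulVf ?gt_eqF // scale1r in TG FG.
  split=> //; rewrite FG; have := hF _ bGv Xev; rewrite -gev hg //.
  by move=> /addrI <-; rewrite scalerA mulVf ?gt_eqF // scale1r.
exists d, F, G; split=> //; split=> // v Tv.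
  have [e e0 [bv bFv]] := small_ex (small_and (small_box v d0) (small_box (F v) d'0)).
  by have [] := FT v e Tv e0 bv bFv.
have [e e0 [bv bGv]] := small_ex (small_and (small_box v d'0) (small_box (G v) d0)).
by have [] := GT v e Tv e0 bv bGv.
Qed.

Lemma germ_homeo_sub n m (X X' : set 'rV[R]_n) (Y' : set 'rV[R]_m) h F x d r v :
  0 < d -> 0 < r -> cpl_on (tangent X x) F ->
  (forall v, box d v -> X (x + v) -> h (x + v) = h x + F v) ->
  (forall v, box r v -> X (x + v) -> (X' (x + v) <-> Y' (h (x + v)))) ->
  tangent X x v -> (tangent X' x v <-> tangent Y' (h x) (F v)).
Proof.
move=> d0 r0 cF hF XY' Tv.
have S := small_and (small_and (small_box v d0) (small_box v r0)) Tv.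
have E e : 0 < e -> (box d (e *: v) /\ box r (e *: v)) /\ X (x + e *: v) ->
    (X' (x + e *: v) <-> Y' (h x + e *: F v)).
  move=> e0 [[bd br] Xv]; rewrite XY' // hF //.
  by have [_ ->] := cpl_homo cF (ltW e0) Tv.
by split=> H; apply: small_imp (small_and S H) _ => e e0 [/(E e e0) He]; apply He.
Qed.

End Germs.

(** * PL invariance of boundary and dimension *)

Section Generic.
Variable R : realType.

Definition powers n (t : R) : 'rV[R]_n := \row_i t ^+ i.

(** On the curve (1, t, t^2, ...) each nonzero linear form is a nonzero
    polynomial in t, so all but finitely many of the points of the curve avoid
    the zero sets of a finite family of forms. *)
Lemma generic_point n (J : finType) (c : J -> 'cV[R]_n) :
  exists2 t, 0 < t & forall j, c j != 0 -> (powers n t *m c j) 0 0 != 0.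
Proof.
pose p j := rVpoly (c j)^T.
have pE j t : (p j).[t] = (powers n t *m c j) 0 0.
  rewrite (@horner_coef_wide _ n) ?size_poly // mxE; apply: eq_bigr => i _.
  by rewrite /p coef_rVpoly_ord !mxE mulrC.
have p0 j : c j != 0 -> p j != 0.
  apply: contra_neq => pj; apply/colP => i.
  by have := coef_rVpoly_ord (c j)^T i; rewrite -/(p j) pj coef0 !mxE.
pose q := \prod_(j | c j != 0) p j.
have q0 : q != 0 by apply/prodf_neq0 => j /p0.
have [m qm] : exists m : nat, ~~ root q m.+1%:R.
  apply: contrapT => N; have H m : root q m.+1%:R.
    by apply: contrapT => Hm; apply: N; exists m; apply/negP.
  have := @max_poly_roots _ q [seq i.+1%:R | i <- iota 0 (size q)] q0.
  rewrite size_map size_iota ltnn => Hr; suff: false by [].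
  apply: Hr; first by apply/allP => x /mapP[i _ ->].
  by rewrite map_inj_uniq ?iota_uniq // => i j /eqP; rewrite eqr_nat => /eqP[].
exists m.+1%:R => [|j cj]; first by rewrite ltr0n.
rewrite -pE; move: qm; apply: contraNneq => pj.
by rewrite /root /q horner_prod (bigD1 j) //= pj mul0r.
Qed.

Lemma generic_columns n (J : finType) (k : J -> nat) (A : forall j, 'M[R]_(n, k j)) :
  exists2 t, 0 < t & forall j c, col c (A j) != 0 -> (powers n t *m A j) 0 c != 0.
Proof.
have [t t0 Ht] := @generic_point n {j : J & 'I_(k j)} (fun p => col (tagged p) (A (tag p))).
exists t => // j c Ac; have := Ht (Tagged (fun j => 'I_(k j)) c) Ac.
by congr (_ != _); rewrite !mxE; apply: eq_bigr => i _; rewrite !mxE.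
Qed.

Lemma small_affine_le0 (a b : R) : small (fun e => a + e * b <= 0) -> a <= 0.
Proof.
move=> H; rewrite leNgt; apply/negP => a0.
have b0 : 0 < 1 + `|b| by rewrite ltr_pwDl.
have d0 : 0 < a / 2 / (1 + `|b|) by rewrite !divr_gt0.
have [e e0 [He]] := small_ex (small_and H (small_le d0)).
rewrite ler_pdivlMr // mulrDr mulr1 => ee.
have : e * `|b| = `|e * b| by rewrite normrM gtr0_norm.
have := ler_norm (- (e * b)); rewrite normrN; lra.
Qed.

Lemma small_affine_lt0 (a b : R) : a < 0 -> small (fun e => a + e * b <= 0).
Proof.
move=> a0; have b0 : 0 < 1 + `|b| by rewrite ltr_pwDl.
have d0 : 0 < - a / (1 + `|b|) by rewrite divr_gt0 // oppr_gt0.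
apply: small_imp (small_le d0) _ => e e0; rewrite ler_pdivlMr // mulrDr mulr1.
have : e * `|b| = `|e * b| by rewrite normrM gtr0_norm.
by have := ler_norm (e * b); lra.
Qed.

Lemma cpl_matrices n m (X : set 'rV[R]_n) (f : 'rV[R]_n -> 'rV[R]_m) : cpl_on X f ->
  exists (J : finType) (k : J -> nat) (B : forall j, 'M[R]_(n, k j)) (A : J -> 'M[R]_(n, m)),
    (forall x, X x <-> exists j, forall c, (x *m B j) 0 c <= 0) /\
    (forall j x, (forall c, (x *m B j) 0 c <= 0) -> f x = x *m A j).
Proof.
move=> [J [C [A [HC XC fA]]]].
have /choice[D HD] : forall j, exists D : {k & 'M[R]_(n, k)},
    forall x, C j x <-> forall c, (x *m tagged D) 0 c <= 0.
  by move=> j; have [k [B CB]] := HC j; exists (Tagged (fun k => 'M[R]_(n, k)) B).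
exists J, (fun j => tag (D j)), (fun j => tagged (D j)), A; split.
  by move=> x; rewrite XC; split=> -[j /HD Cj]; exists j.
by move=> j x /HD; apply: fA.
Qed.

Section Facet.
Variables (n : nat) (I : pred 'I_n) (i j0 : 'I_n).
Hypotheses (Ii : I i) (Ij0 : ~~ I j0).

Let V : set 'rV[R]_n := fun x => total x = 0.

Let ij0 : i != j0.
Proof. by apply: contraNneq Ij0 => <-. Qed.

Let V_lin a x y : V x -> V y -> V (a *: x + y).
Proof. by rewrite /V => Vx Vy; rewrite scalar_total Vx Vy mulr0 addr0. Qed.

(** The matrix of a projection onto the span of the facet x_i = 0 in the
    hyperplane of sum zero: the basis vector of j, for j other than i and j0, goes to its difference with the
    basis vector of j0. Positive vectors go to points with positive coordinates
    outside i and j0. *)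
Definition facet_mx : 'M[R]_n := \matrix_(j, c)
  (if (j == i) || (j == j0) then 0 else (c == j)%:R - (c == j0)%:R).

Definition facet_dir : 'rV[R]_n := \row_c ((c == i)%:R - (c == j0)%:R).

Lemma total_delta (c0 : 'I_n) : \sum_(c < n) (c == c0)%:R = 1 :> R.
Proof. by rewrite (bigD1 c0) //= eqxx big1 ?addr0 // => c /negPf ->. Qed.

Lemma facet_dir_total : V facet_dir.
Proof.
rewrite /V /total (eq_bigr (fun c => (c == i)%:R - (c == j0)%:R)) => [|c _]; last by rewrite mxE.
by rewrite sumrB !total_delta subrr.
Qed.

Lemma facet_total (x : 'rV[R]_n) : V (x *m facet_mx).
Proof.
rewrite /V /total; under eq_bigr do rewrite mxE.
rewrite exchange_big big1 //= => j _; rewrite -mulr_sumr.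
have [jE|jE] := boolP ((j == i) || (j == j0)).
  by rewrite big1 ?mulr0 // => c _; rewrite mxE jE.
rewrite (eq_bigr (fun c => (c == j)%:R - (c == j0)%:R)) => [|c _]; last by rewrite mxE (negPf jE).
by rewrite sumrB !total_delta subrr mulr0.
Qed.

Lemma facet_coord (x : 'rV[R]_n) c : c != j0 -> (x *m facet_mx) 0 c = if c == i then 0 else x 0 c.
Proof.
move=> cj; rewrite mxE; case: (eqVneq c i) => [->|ci].
  rewrite big1 // => j _; rewrite mxE.
  have [_|/norP[ji _]] := boolP ((j == i) || (j == j0)); first by rewrite mulr0.
  by rewrite eq_sym (negPf ji) (negPf ij0) subrr mulr0.
rewrite (bigD1 c) //= big1 ?addr0 => [|j jc]; rewrite mxE (negPf cj).
  by rewrite (negPf ci) /= eqxx subr0 mulr1.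
by rewrite (eq_sym c) (negPf jc) subrr if_same mulr0.
Qed.

(** A linear form that vanishes on the facet is a multiple of the coordinate i,
    on the hyperplane. *)
Lemma facet_col (a : 'cV[R]_n) (w : 'rV[R]_n) : facet_mx *m a = 0 -> V w ->
  (w *m a) 0 0 = w 0 i * (facet_dir *m a) 0 0.
Proof.
move=> Ea Vw.
have aj j : j != i -> a j 0 = a j0 0.
  move=> ji; have [->//|jj0] := eqVneq j j0.
  have := congr1 (fun M : 'cV[R]_n => M j 0) Ea; rewrite !mxE.
  under eq_bigr do rewrite mxE (negPf ji) (negPf jj0) /= mulrBl.
  rewrite sumrB (bigD1 j) //= big1 => [|c /negPf ->]; last by rewrite mul0r.
  rewrite (bigD1 j0) //= big1 => [|c /negPf ->]; last by rewrite mul0r.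
  by rewrite !eqxx !addr0 !mul1r => /eqP; rewrite subr_eq0 => /eqP.
have aE y : V y -> (y *m a) 0 0 = y 0 i * (a i 0 - a j0 0).
  rewrite /V => Vy.
  have -> : (y *m a) 0 0 = \sum_j y 0 j * (a j 0 - a j0 0) + total y * a j0 0.
    by rewrite mxE /total mulr_suml -big_split /=; apply: eq_bigr => j _; ring.
  rewrite Vy mul0r addr0 (bigD1 i) //= big1 ?addr0 // => j ji.
  by rewrite aj // subrr mulr0.
rewrite aE // aE; last exact: facet_dir_total.
by rewrite [facet_dir 0 i]mxE eqxx (negPf ij0) subr0 mul1r.
Qed.

(** Let F be a homeomorphism from the corner to the whole hyperplane V. At a
    generic point q of the facet x_i = 0 some piece of F contains a neighbourhood
    of q in the half-space x_i >= 0, and there F is linear, with matrix A. The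
    vector u enters the half-space. As F is onto V, the direction opposite to u A
    is the image of some direction w' with w'_i >= 0. Then w' + u is a direction
    into the half-space that A annihilates, which contradicts injectivity. *)
Lemma corner_not_flat s s' F G : ~ chomeo s s' (corner I V) V F G.
Proof.
move=> [cF cG XY YX].
have [J [k [B [A [XB FA]]]]] := cpl_matrices cF.
have [t t0 Ht] := generic_columns (fun j => facet_mx *m B j).
pose q := powers n t *m facet_mx; pose u := facet_dir.
have Vq : V q := facet_total _.
have Vu : V u := facet_dir_total.
have qi : q 0 i = 0 by rewrite facet_coord // eqxx.
have ui : u 0 i = 1 by rewrite mxE eqxx (negPf ij0) subr0.
have Xq e : 0 < e -> corner I V (q + e *: u).
  move=> e0; split=> [|c Ic]; first by rewrite addrC; apply: V_lin.
  have cj0 : c != j0 by apply: contraNneq Ij0 => <-.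
  rewrite mxE facet_coord // !mxE (negPf cj0) subr0.
  case: eqP => _; first by rewrite add0r mulr1 ltW.
  by rewrite mulr0 addr0 exprn_ge0 // ltW.
pose C j (x : 'rV[R]_n) := forall c, (x *m B j) 0 c <= 0.
have PC j : polycone (C j) by exists (k j), (B j).
have [l Cl] : exists l, small (fun e => C l (q + e *: u)).
  apply: contrapT => N; have : forall j, small (fun e => ~ C j (q + e *: u)).
    move=> j; case: (convex_dichotomy q u (polycone_convex (PC j))) => // Hj.
    by case: N; exists j.
  by move=> /small_all/small_ex[e /Xq/XB[j Cj] /(_ j)].
have lin (x : 'rV[R]_n) e (w : 'rV[R]_n) c :
    ((x + e *: w) *m B l) 0 c = (x *m B l) 0 c + e * (w *m B l) 0 c.
  by rewrite mulmxDl -scalemxAl !mxE.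
(* a neighbourhood of q in the half-space lies in the piece l *)
have H w : V w -> 0 <= w 0 i -> small (fun e => C l (q + e *: w)).
  move=> Vw wi; apply: small_all => c.
  have Clc : small (fun e => (q *m B l) 0 c + e * (u *m B l) 0 c <= 0).
    by apply: small_imp Cl _ => e _ /(_ c); rewrite lin.
  have ql : (q *m B l) 0 c <= 0 by apply: small_affine_le0 Clc.
  have colE (M : 'rV[R]_n) : (M *m B l) 0 c = (M *m col c (B l)) 0 0.
    by rewrite !mxE; apply: eq_bigr => j _; rewrite !mxE.
  have [E0|E0] := eqVneq (col c (facet_mx *m B l)) 0; last first.
    have qn : (q *m B l) 0 c != 0 by rewrite /q -mulmxA; apply: Ht.
    have qlt : (q *m B l) 0 c < 0 by rewrite lt_neqAle qn.
    by apply: small_imp (small_affine_lt0 ((w *m B l) 0 c) qlt) _ => e _; rewrite lin.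
  have Ea : facet_mx *m col c (B l) = 0.
    by rewrite -E0; apply/colP => j; rewrite !mxE; apply: eq_bigr => j' _; rewrite !mxE.
  have q0 : (q *m B l) 0 c = 0 by rewrite colE /q -mulmxA Ea mulmx0 mxE.
  have wu : (w *m B l) 0 c = w 0 i * (u *m B l) 0 c by rewrite !colE; apply: facet_col.
  have [e e0 ue] := small_ex Clc; rewrite q0 add0r pmulr_rle0 // in ue.
  exists 1 => // e' e'0 _; rewrite lin q0 add0r wu.
  by rewrite pmulr_rle0 // mulr_ge0_le0.
have CX x : C l x -> corner I V x by move=> Cx; apply/XB; exists l.
have Cq : C l q.
  have V0 : V 0 by rewrite /V (scalar_0 (@scalar_total R n)).
  have i0 : 0 <= (0 : 'rV[R]_n) 0 i by rewrite mxE.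
  by have [e _] := small_ex (H 0 V0 i0); rewrite scaler0 addr0.
have Xq0 := CX q Cq; have [Vz Gz _] := XY q Xq0.
have Fq : F q = q *m A l by apply: FA.
pose z := F q; pose w := u *m A l.
have Fe e x : C l (q + e *: x) -> F (q + e *: x) = z + e *: (x *m A l).
  by move=> Cx; rewrite (FA l) // mulmxDl -scalemxAl /z Fq.
have Vw : V w.
  have [e e0 Ce] := small_ex Cl.
  have [] := XY _ (CX _ Ce); rewrite (Fe e u Ce) => Ve _ _.
  move: Ve; rewrite /V addrC scalar_total => Ve.
  have : e * total w = 0 by rewrite -Ve /z Vz addr0.
  by move=> /eqP; rewrite mulf_eq0 gt_eqF //= => /eqP.
have [d [G' [d0 cG' locV GG']]] := germ (cpl_pl cG) Vz.
have Vzw e : V (z + e *: - w).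
  by rewrite scalerN -scaleNr addrC; apply: V_lin.
have Tw : tangent V z (- w) by exists 1 => // e _ _; apply: Vzw.
(* the direction at q that F takes to - u A *)
pose w' := G' (- w).
have Ge : small (fun e => G (z + e *: - w) = q + e *: w').
  apply: small_imp (small_box (- w) d0) _ => e e0 be; rewrite GG' // Gz.
  by have [_ ->] := cpl_homo cG' (ltW e0) Tw.
have Xw' : small (fun e => corner I V (q + e *: w')).
  by apply: small_imp Ge _ => e e0 <-; have [] := YX _ (Vzw e).
have [e1 e10 [Ve1 Ie1]] := small_ex Xw'.
have Vw' : V w'.
  move: Ve1; rewrite /V addrC scalar_total Vq addr0 => /eqP.
  by rewrite mulf_eq0 gt_eqF //= => /eqP.
have w'i : 0 <= w' 0 i.
  by have := Ie1 i Ii; rewrite [X in 0 <= X]mxE qi add0r [X in 0 <= X]mxE pmulr_rge0.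
have [e e0 [Ge1 Ce]] := small_ex (small_and Ge (H w' Vw' w'i)).
have w'A : w' *m A l = - w.
  have [_ FGe] := YX _ (Vzw e).
  move: FGe; rewrite Ge1 Fe // => /addrI/(congr1 (fun y => e^-1 *: y)).
  by rewrite !scalerA mulVf ?gt_eqF // !scale1r.
have Vs : V (w' + u) by have := V_lin 1 Vw' Vu; rewrite scale1r.
have [|e' e'0 Ce'] := small_ex (H (w' + u) Vs _).
  by rewrite mxE ui addr_ge0.
have FE : F (q + e' *: (w' + u)) = F q.
  by rewrite Fe // mulmxDl w'A addNr scaler0 addr0.
have [_ GE _] := XY _ (CX _ Ce').
move: GE; rewrite FE Gz => /eqP; rewrite -subr_eq0 opprD addrA subrr add0r oppr_eq0.
rewrite scaler_eq0 gt_eqF //= => /eqP/(congr1 (fun y : 'rV[R]_n => y 0 i)).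
by rewrite mxE ui [RHS]mxE; move: w'i; lra.
Qed.

End Facet.

(** X contains a linear image of an orthant of dimension k: the dimension of a
    conical set is the largest such k. *)
Definition has_rank n (X : set 'rV[R]_n) k : Prop :=
  exists2 A : 'M[R]_(k, n), row_free A & forall u, orthant u -> X (u *m A).

Lemma orthant_split k (u : 'rV[R]_k) : exists a b, [/\ orthant a, orthant b & u = a - b].
Proof.
exists (\row_i Num.max (u 0 i) 0), (\row_i Num.max (- u 0 i) 0); split.
- by move=> i; rewrite mxE le_max lexx orbT.
- by move=> i; rewrite mxE le_max lexx orbT.
- apply/rowP => i; rewrite !mxE; have [u0|u0] := leP 0 (u 0 i).
    by rewrite max_r ?oppr_le0 // subr0.
  by rewrite max_l ?oppr_ge0 ?ltW // sub0r opprK.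
Qed.

Lemma row_free_inj k n (A : 'M[R]_(k, n)) : (forall u : 'rV_k, u *m A = 0 -> u = 0) -> row_free A.
Proof.
move=> H; rewrite -kermx_eq0; apply/eqP/row_matrixP => i; rewrite row0; apply: H.
by rewrite -row_mul mulmx_ker row0.
Qed.

(** A generic point p of the orthant is interior to some piece of the map, so
    p + e v_i lies in that piece for each basis vector v_i and some e > 0. These
    vectors span a smaller orthant on which the map is linear, and a linear map
    that is injective on an orthant is injective. *)
Lemma has_rank_chomeo n m (s : 'rV[R]_n -> R) (s' : 'rV[R]_m -> R) X Y h g k :
  chomeo s s' X Y h g -> has_rank X k -> has_rank Y k.
Proof.
move=> [Xh Yg XY YX] [A Afree XA].
have cO : cpl_on (@orthant R k) (fun u => h (u *m A)).
  apply: (cpl_comp_to _ Xh XA); apply: cpl_lin; last exact: linear_mul.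
  by apply: cpl_polycone; apply: polycone_orthant.
have [J [kk [B [M [OB fM]]]]] := cpl_matrices cO.
have [t t0 Ht] := generic_columns B.
pose p := powers k t.
have p0 i : 0 < p 0 i by rewrite mxE exprn_gt0.
have [l Cl] := (OB p).1 (fun i => ltW (p0 i)).
have lt0 c : col c (B l) != 0 -> (p *m B l) 0 c < 0.
  by move=> /Ht Hc; rewrite lt_neqAle Hc Cl.
have [e e0 Ce] : exists2 e, 0 < e & forall i c, ((p + e *: delta_mx 0 i) *m B l) 0 c <= 0.
  apply: small_ex; apply: small_all => i; apply: small_all => c.
  have lin e (w : 'rV[R]_k) : ((p + e *: w) *m B l) 0 c = (p *m B l) 0 c + e * (w *m B l) 0 c.
    by rewrite mulmxDl -scalemxAl !mxE.
  have [E0|E0] := eqVneq (col c (B l)) 0.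
    exists 1 => // e _ _; have colE (w : 'rV[R]_k) : (w *m B l) 0 c = (w *m col c (B l)) 0 0.
      by rewrite !mxE; apply: eq_bigr => j _; rewrite !mxE.
    by rewrite colE E0 mulmx0 mxE.
  apply: small_imp (small_affine_lt0 (((delta_mx 0 i : 'rV[R]_k) *m B l) 0 c) (lt0 c E0)) _ => e _.
  by rewrite lin.
pose A' : 'M[R]_k := \matrix_i (p + e *: delta_mx 0 i).
have A'E (u : 'rV[R]_k) : u *m A' = total u *: p + e *: u.
  rewrite mulmx_sum_row (eq_bigr (fun i => u 0 i *: p + e *: (u 0 i *: delta_mx 0 i))) => [|i _].
    by rewrite big_split /= -scaler_suml -scaler_sumr -row_sum_delta.
  by rewrite rowK scalerDr !scalerA (mulrC e).
have CA' u : orthant u -> forall c, (u *m A' *m B l) 0 c <= 0.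
  move=> Ou c; rewrite [u *m A']mulmx_sum_row mulmx_suml summxE; apply: sumr_le0 => i _.
  by rewrite -scalemxAl mxE rowK mulr_ge0_le0 //; apply: Ou.
have A'free (u : 'rV[R]_k) : u *m A' = 0 -> u = 0.
  rewrite A'E => uA; have := congr1 (@total R k) uA.
  rewrite scalar_total totalZ (scalar_0 (@scalar_total R k)) => tu.
  have tp : 0 <= total p by apply: sumr_ge0 => i _; apply: ltW.
  have : total u * (total p + e) = 0 by rewrite mulrDr [total u * e]mulrC.
  move=> /eqP; rewrite mulf_eq0 [_ + e == 0]gt_eqF ?ltr_wpDl // orbF => /eqP tu0.
  move: uA; rewrite tu0 scale0r add0r => /eqP; rewrite scaler_eq0 gt_eqF //=.
  by move/eqP.
have hM u : orthant u -> h (u *m A' *m A) = u *m (A' *m M l).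
  by move=> Ou; rewrite (fM l) ?mulmxA //; apply: CA'.
have XA' u : orthant u -> X (u *m A' *m A).
  by move=> Ou; apply: XA; apply/OB; exists l; apply: CA'.
exists (A' *m M l); last first.
  by move=> u Ou; rewrite -hM //; have [] := XY _ (XA' u Ou).
apply: row_free_inj => u; have [a [b [Oa Ob ->]]] := orthant_split u.
rewrite mulmxBl -!hM // => /eqP; rewrite subr_eq0 => /eqP hab.
have [_ ga _] := XY _ (XA' a Oa); have [_ gb _] := XY _ (XA' b Ob).
move: hab => /(congr1 g); rewrite ga gb => /eqP; rewrite -subr_eq0 -!mulmxBl => /eqP.
by move=> abA; apply: A'free; apply: (row_free_injr Afree); rewrite /= abA mul0mx.
Qed.

Lemma rank_support k n (A : 'M[R]_(k, n)) (S : {set 'I_n}) :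
  row_free A -> (forall i j, j \notin S -> A i j = 0) -> (k <= #|S|)%N.
Proof.
move=> /eqP rA AS; rewrite -[X in (X <= _)%N]rA.
pose D : 'M[R]_(#|S|, n) := \matrix_(i < #|S|) delta_mx 0 (enum_val i).
have H : (A <= D)%MS.
  apply/row_subP => i; rewrite [row i A]row_sum_delta; apply: summx_sub => j _.
  have [jS|jS] := boolP (j \in S); last by rewrite mxE AS // scale0r sub0mx.
  apply: scalemx_sub; rewrite -(enum_rankK_in jS jS).
  by have := row_sub (enum_rank_in jS j) D; rewrite rowK.
exact: leq_trans (mxrankS H) (rank_leq_row _).
Qed.

Lemma has_rank_coords n (X : set 'rV[R]_n) k (phi : 'I_k -> 'I_n) : injective phi ->
  (forall x, orthant x -> (forall j, x 0 j != 0 -> exists i, j = phi i) -> X x) -> has_rank X k.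
Proof.
move=> phiI HX; pose A : 'M[R]_(k, n) := \matrix_i delta_mx 0 (phi i).
have AE (u : 'rV[R]_k) : u *m A = \sum_i u 0 i *: delta_mx 0 (phi i).
  by rewrite mulmx_sum_row; apply: eq_bigr => i _; rewrite rowK.
have Aphi (u : 'rV[R]_k) i : (u *m A) 0 (phi i) = u 0 i.
  rewrite AE summxE (bigD1 i) //= big1 ?addr0 => [|j ji]; rewrite !mxE eqxx /=.
    by rewrite eqxx mulr1.
  by rewrite (inj_eq phiI) eq_sym (negPf ji) mulr0.
have Aout (u : 'rV[R]_k) j : (forall i, j <> phi i) -> (u *m A) 0 j = 0.
  move=> jphi; rewrite AE summxE big1 // => i _; rewrite !mxE eqxx /=.
  by case: eqP => [/jphi//|_]; rewrite mulr0.
exists A.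
  apply: row_free_inj => u uA; apply/rowP => i.
  by rewrite -Aphi uA !mxE.
move=> u Ou; have D j : (exists i, j = phi i) \/ (forall i, j <> phi i).
  by have [|N] := pselect (exists i, j = phi i); [left|right=> i E; apply: N; exists i].
apply: HX => j; case: (D j) => [[i ->]|/Aout ->] //; rewrite ?Aphi ?eqxx //.
by exists i.
Qed.

End Generic.

Section Charts.
Variable R : realType.

(** A coordinate that vanishes at an interior point of an orthant inside the
    nonnegative orthant vanishes on all of it. *)
Lemma has_rank_le n (X : set 'rV[R]_n) k : (forall x, X x -> orthant x) -> has_rank X k ->
  exists2 y, X y & (k <= #|[set j | y 0%R j != 0%R]|)%N.
Proof.
move=> XO [A Afree XA]; pose y : 'rV[R]_n := const_mx 1 *m A.
have Xy : X y by apply: XA => i; rewrite mxE ler01.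
exists y => //; apply: (rank_support Afree) => i j; rewrite inE negbK => /eqP yj.
have A0 i' : 0 <= A i' j.
  have -> : A i' j = ((delta_mx 0 i' : 'rV[R]_k) *m A) 0 j by rewrite -rowE mxE.
  by apply: XO; apply: XA => l; rewrite mxE ler0n.
have : \sum_i' A i' j == 0.
  by rewrite -[X in _ == X]yj mxE; apply/eqP/eq_bigr => l _; rewrite mxE mul1r.
by rewrite psumr_eq0 // => /allP/(_ i); rewrite mem_index_enum => /(_ isT)/eqP.
Qed.

Lemma rank_bd_orthant n : has_rank (@bd_orthant R n.+1) n.
Proof.
apply: (@has_rank_coords _ _ _ _ (lift ord0)); first exact: lift_inj.
move=> x Ox Hx; split=> //; exists ord0; apply/eqP; apply: contrapT => /negP /Hx[i].
by move=> /eqP; rewrite (negPf (neq_lift _ _)).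
Qed.

Lemma rank_bd_orthant_le n k : has_rank (@bd_orthant R n.+1) k -> (k <= n)%N.
Proof.
move=> /has_rank_le[x []//|y [_ [i yi]] ky]; apply: leq_trans ky _.
rewrite -ltnS -[X in (_ < X)%N]card_ord -cardsT; apply: proper_card.
by rewrite properE subsetT; apply/subsetPn; exists i; rewrite ?inE // yi eqxx.
Qed.

Lemma rank_orthant n : has_rank (@orthant R n) n.
Proof. by apply: (@has_rank_coords _ _ _ _ id). Qed.

Lemma rank_orthant_le n k : has_rank (@orthant R n) k -> (k <= n)%N.
Proof. by move=> [A /eqP rA _]; rewrite -rA; apply: rank_leq_col. Qed.

Section MaxChain.
Variables (d : Order.disp_t) (P : finPOrderType d).
Implicit Types A : {set P}.

Definition height A : nat := \max_(c in order_complex A) #|c|.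

Lemma height_ge A (c : {set P}) : chain c -> c \subset A -> (#|c| <= height A)%N.
Proof.
move=> cc cA; have [->|c0] := eqVneq c finset.set0; first by rewrite cards0.
by apply: (@leq_bigmax_cond _ _ (fun c : {set P} => #|c|)); rewrite inE c0 cA.
Qed.

Lemma height_ex A : exists c : {set P}, [/\ chain c, c \subset A & #|c| = height A].
Proof.
have [A0|/set0Pn[c0 c0A]] := eqVneq (order_complex A) finset.set0.
  exists finset.set0; rewrite sub0set cards0 /height A0 big_set0; split=> //.
  by apply/chainP => p q; rewrite inE.
have A0 : (0 < #|order_complex A|)%N by apply/card_gt0P; exists c0.
have [c] := @eq_bigmax_cond _ (mem (order_complex A)) (fun c : {set P} => #|c|) A0.
by rewrite inE => /and3P[_ cA cc] E; exists c.
Qed.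

Lemma rank_order_cone A : has_rank (@order_cone R _ _ A) (height A).
Proof.
have [c [cc cA <-]] := height_ex A.
apply: (@has_rank_coords _ _ _ _ (fun i => enum_rank (enum_val i : P))).
  by move=> i j /enum_rank_inj/enum_val_inj.
move=> x Ox Hx; have xc : carrier x \subset c.
  apply/subsetP => p; rewrite carrierP => /Hx[i /enum_rank_inj ->]; exact: enum_valP.
by split=> //; [apply: chain_sub cc xc|apply: subset_trans xc cA].
Qed.

Lemma rank_order_cone_le A k : has_rank (@order_cone R _ _ A) k -> (k <= height A)%N.
Proof.
move=> /has_rank_le[x []//|y [_ yc yA] ky]; apply: leq_trans ky _.
apply: leq_trans (height_ge yc yA).
suff -> : [set j | y 0%R j != 0%R] = [set enum_rank p | p in carrier y].
  exact: leq_imset_card.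
apply/setP => j; rewrite inE; apply/idP/imsetP => [yj|[p + ->]].
  by exists (enum_val j); rewrite ?carrierP enum_valK.
by rewrite carrierP.
Qed.

Lemma height_cone (s : P) : height (cone [set: P] s) = (height (bd_cone [set: P] s)).+1.
Proof.
apply/eqP; rewrite eqn_leq; apply/andP; split.
  have [c [cc cA <-]] := height_ex (cone [set: P] s).
  rewrite (cardsD1 s) -add1n leq_add //; first by case: (_ \in _).
  apply: height_ge; first by apply: chain_sub cc _; apply: subD1set.
  apply/subsetP => p; rewrite in_setD1 => /andP[ps /(subsetP cA)].
  by rewrite !inE lt_neqAle ps.
have [c [cc cA <-]] := height_ex (bd_cone [set: P] s).
have sc : s \notin c by apply/negP => /(subsetP cA); rewrite inE ltxx andbF.
have -> : (#|c|.+1 = #|s |: c|)%N by rewrite cardsU1 sc.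
apply: height_ge.
  have lts p : p \in c -> (p < s)%O by move=> /(subsetP cA); rewrite inE => /andP[].
  apply/chainP => p q; rewrite !in_setU1.
  case/predU1P => [->|pc]; case/predU1P => [->|qc]; rewrite ?comparablexx //.
  - by apply: ge_comparable; apply/ltW/lts.
  - by apply: le_comparable; apply/ltW/lts.
  - by have /chainP := cc; apply.
apply/subsetP => p; rewrite in_setU1 inE => /predU1P[->|/(subsetP cA)].
  by rewrite lexx inE.
by rewrite !inE => /ltW.
Qed.

End MaxChain.

Lemma height_opset (d : Order.disp_t) (P : finPOrderType d) (A : {set P}) :
  height (opset A) = height A.
Proof.
have E : order_complex (opset A) = order_complex A.
  apply/setP => c; rewrite !inE; congr [&& _, _ & _]; last first.
    by apply/chainP/chainP => H p q pc qc; apply: (H q p qc pc).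
  by apply/subsetP/subsetP => H p /H; rewrite ?inE.
exact: (congr1 (fun X : {set {set P}} => \max_(c in X) #|c|)%N E).
Qed.

(** * Tangent cones of the simplex *)

Definition zeros n (p : 'rV[R]_n) : pred 'I_n := fun i => p 0 i == 0.
Definition flat n : set 'rV[R]_n := fun x => total x = 0.

Lemma tangent_simplex k (p v : 'rV[R]_k.+1) : simplex p ->
  (tangent (@simplex R k) p v <-> corner (zeros p) (@flat k.+1) v).
Proof.
move=> [p0 tp]; split=> [H|[Vv v0]].
  have [e e0 [Ov tv]] := small_ex H; split.
    have : total (p + e *: v) = 1 by [].
    rewrite addrC scalar_total /total tp -{2}[1]add0r => /addIr/eqP.
    by rewrite mulf_eq0 gt_eqF //= => /eqP.
  move=> i /eqP pi; have := Ov i; rewrite !mxE pi add0r pmulr_rge0 //.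
apply: small_and; last first.
  exists 1 => // e _ _; have : total (p + e *: v) = 1; last by [].
  by rewrite addrC scalar_total Vv mulr0 add0r.
apply: small_all => i; have [pi|pi] := eqVneq (p 0 i) 0.
  by exists 1 => // e e0 _; rewrite !mxE pi add0r mulr_ge0 ?(ltW e0) //; apply: v0; apply/eqP.
have pi0 : - p 0 i < 0 by rewrite oppr_lt0 lt_neqAle eq_sym pi p0.
apply: small_imp (small_affine_lt0 (- v 0 i) pi0) _ => e _.
by rewrite !mxE; lra.
Qed.

Lemma tangent_bd_simplex k (p v : 'rV[R]_k.+1) : simplex p ->
  (tangent (@bd_simplex R k) p v <-> bd_corner (zeros p) (@flat k.+1) v).
Proof.
move=> Sp; have [p0 tp] := Sp; split=> [H|[/(tangent_simplex _ Sp) H [i /eqP pi vi]]]; last first.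
  apply: small_imp H _ => e e0 Hv; split=> //; exists i.
  by rewrite !mxE pi vi mulr0 addr0.
have cv : corner (zeros p) (@flat k.+1) v.
  by apply/tangent_simplex => //; apply: tangentS H => y [].
split=> //; apply: contrapT => N.
have vpos i : p 0 i = 0 -> 0 < v 0 i.
  move=> pi; have vi : 0 <= v 0 i by apply: cv.2; apply/eqP.
  by rewrite lt_neqAle vi andbT; apply/eqP => vi0; apply: N; exists i => //; apply/eqP.
have : small (fun e => forall i, 0 < p 0 i + e * v 0 i).
  apply: small_all => i; have [pi|pi] := eqVneq (p 0 i) 0.
    by exists 1 => // e e0 _; rewrite pi add0r mulr_gt0 // vpos.
  have ppos : 0 < p 0 i by rewrite lt_neqAle eq_sym pi p0.
  have pi0 : - (p 0 i / 2) < 0 by rewrite oppr_lt0 divr_gt0.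
  by apply: small_imp (small_affine_lt0 (- v 0 i) pi0) _ => e _; lra.
move=> /(small_and H)/small_ex[e e0 [[_ [i] +] /(_ i)]].
by rewrite !mxE => ->; rewrite ltxx.
Qed.

Lemma simplex_nonzero k (p : 'rV[R]_k.+1) : simplex p -> exists j, ~~ zeros p j.
Proof.
move=> [_ tp]; apply: contrapT => N; have : \sum_i p 0 i = 0.
  by apply: big1 => i _; apply/eqP; apply: contrapT => pi; apply: N; exists i; apply/negP.
by rewrite tp => /eqP; rewrite oner_eq0.
Qed.

Lemma polycone_flat n : polycone (@flat n).
Proof. by apply: polycone_eq0; apply: scalar_total. Qed.

(** The inward direction needs sum zero and the coordinate 1 on each zero of p;
    the sum is corrected at a coordinate j0 where p does not vanish. *)
Lemma tangent_simplex_collared k (p : 'rV[R]_k.+1) : bd_simplex p ->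
  collared 0 (fun=> 0) (tangent (@simplex R k) p) (tangent (@bd_simplex R k) p).
Proof.
move=> [Sp [i0 /eqP pi0]]; have [j0 pj0] := simplex_nonzero Sp.
pose w : 'rV[R]_k.+1 := \row_i (if i == j0 then - \sum_(j | zeros p j) 1 else (zeros p i)%:R).
have tw : total w = 0.
  rewrite /total (bigD1 j0) //= mxE eqxx [X in _ + X](bigID (zeros p)) /= [X in _ + (_ + X)]big1.
    rewrite addr0 [X in _ + X](eq_bigl (zeros p)) => [|i].
      rewrite [X in _ + X](eq_bigr (fun=> 1)) ?addNr // => i pi.
      by rewrite mxE pi; case: eqP => // E; rewrite E (negPf pj0) in pi.
    by case: eqP => // ->; rewrite (negPf pj0).
  by move=> i /andP[ij /negPf pi]; rewrite mxE (negPf ij) pi.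
have H := @corner_collared R k.+1 (zeros p) i0 pi0 (@flat k.+1) (fun=> 0) w 1 (@polycone_flat _).
apply: collared_sub (H _ _ ltr01 _) _ _.
- by move=> t x Vx; rewrite /flat addrC scalar_total tw mulr0 add0r.
- by move=> a u v; rewrite mulr0 addr0.
- by move=> i pi; rewrite mxE pi; case: eqP => // E; rewrite E (negPf pj0) in pi.
- by move=> x; rewrite tangent_simplex.
- by move=> x; rewrite tangent_bd_simplex.
Qed.

Lemma tangent_simplex_flat k (p v : 'rV[R]_k.+1) : simplex p -> ~ bd_simplex p ->
  (tangent (@simplex R k) p v <-> flat v).
Proof.
move=> Sp Np; rewrite tangent_simplex // /corner; split=> [[]//|Vv]; split=> // i /eqP pi.
by case: Np; split=> //; exists i.
Qed.

(** The tangent cone at a boundary point is a proper corner, that at an interior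
    point is the whole hyperplane. *)
Lemma bd_simplex_invariant k (p p' : 'rV[R]_k.+1) s s' F G : simplex p -> simplex p' ->
  chomeo s s' (tangent (@simplex R k) p) (tangent (@simplex R k) p') F G ->
  bd_simplex p -> bd_simplex p'.
Proof.
move=> Sp Sp' H [_ [i /eqP pi]]; apply: contrapT => N.
have [j0 pj0] := simplex_nonzero Sp.
apply: (@corner_not_flat R k.+1 (zeros p) i j0 pi pj0 s s' F G).
apply: chomeo_ext H _ _ _ _ => // v; first by rewrite tangent_simplex.
by rewrite tangent_simplex_flat.
Qed.

(** * Charts *)

Lemma nbhs_box n (x : 'rV[R]_n) (E : set 'rV[R]_n) :
  nbhs x E <-> exists2 r, 0 < r & forall v, box r v -> E (x + v).
Proof.
split=> [/nbhs_ballP[e /= e0 eE]|[r r0 rE]]; last first.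
  apply/nbhs_ballP; exists r => //= y [_ xy]; rewrite -[y](subrKC x); apply: rE => i.
  by have := xy 0 i; rewrite /ball /= distrC !mxE => /ltW.
exists (e / 2) => [|v bv]; first by rewrite divr_gt0.
apply: eE; split=> // i j; rewrite (ord1 i) /ball /= mxE opprD addNKr normrN.
by apply: le_lt_trans (bv j) _; rewrite ltr_pdivrMr // ltr_pMr // ltr1n.
Qed.

Lemma nbhs_within n (x : 'rV[R]_n) (X U : set 'rV[R]_n) :
  within X (nbhs x) U <-> exists2 r, 0 < r & forall v, box r v -> X (x + v) -> U (x + v).
Proof. exact: nbhs_box. Qed.

Lemma pl_comp n m k (X : set 'rV[R]_n) (Y : set 'rV[R]_m) (f : 'rV[R]_n -> 'rV[R]_m)
    (g : 'rV[R]_m -> 'rV[R]_k) :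
  pl_on X f -> pl_on Y g -> pl_on (fun x => X x /\ Y (f x)) (g \o f).
Proof.
move=> [a [C [HC XC fA]]] [a' [C' [HC' YC' gA]]].
have /choice[M HM] : forall i, exists M : 'M[R]_(n, m) * 'rV[R]_m,
    forall x, C i x -> f x = x *m M.1 + M.2.
  by move=> i; have [A [b H]] := fA i; exists (A, b).
pose J := ('I_a * 'I_a')%type.
pose D (p : J) x := C p.1 x /\ C' p.2 (x *m (M p.1).1 + (M p.1).2).
exists #|{: J}|, (fun i => D (enum_val i)); split.
- by move=> i; apply: convexI => //; apply: convex_preim.
- apply/seteqP; split=> x /=.
    rewrite XC YC' => -[[i _ Ci] [i' _ Ci']].
    by exists (enum_rank (i, i')) => //; rewrite enum_rankK /D /= -HM.
  move=> [i _ [Cx Cfx]]; split; first by rewrite XC; exists (enum_val i).1.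
  by rewrite YC' (HM (enum_val i).1) //; exists (enum_val i).2.
- move=> i; have [A [b H]] := gA (enum_val i).2.
  exists ((M (enum_val i).1).1 *m A), ((M (enum_val i).1).2 *m A + b) => x [Cx Cfx].
  by rewrite /= (HM (enum_val i).1) // H // mulmxDl mulmxA addrA.
Qed.

Lemma pl_ext n m (X Y : set 'rV[R]_n) (f g : 'rV[R]_n -> 'rV[R]_m) :
  pl_on X f -> (forall x, X x <-> Y x) -> (forall x, X x -> f x = g x) -> pl_on Y g.
Proof.
move=> [k [C [HC XC fA]]] XY fg; exists k, C; split=> //.
  by rewrite -XC; apply/seteqP; split=> x; apply XY.
move=> i; have [A [b H]] := fA i; exists A, b => x Cx; rewrite -fg ?H //.
by rewrite XC; exists i.
Qed.

Lemma pl_affine n (a : R) (b : 'rV[R]_n) : pl_on (fun _ => True) (fun x => a *: x + b).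
Proof.
exists 1, (fun _ _ => True); split.
- move=> _; exists 0, 0, 0; apply/seteqP; split=> x //= _; by case.
- by apply/seteqP; split=> x //= _; exists ord0.
- by move=> _; exists a%:M, b => x _; rewrite mul_mx_scalar.
Qed.

Lemma pl_simplex k : pl_on (@simplex R k) idfun.
Proof.
apply: pl_on_slice (slice_simplex R k) _; apply: cpl_polycone; exact: polycone_orthant.
Qed.

Lemma simplex_bound k (z p : 'rV[R]_k.+1) : simplex z -> simplex p -> box 1 (z - p).
Proof.
have le1 (y : 'rV[R]_k.+1) i : simplex y -> 0 <= y 0 i <= 1.
  move=> [y0 ty]; rewrite y0 /= -ty (bigD1 i) //= lerDl sumr_ge0 // => j _; exact: y0.
move=> Sz Sp i; rewrite !mxE ler_norml.
by have := le1 z i Sz; have := le1 p i Sp; lra.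
Qed.

(** With F an identification of the tangent cones, y goes to p + F(y - x) / e.
    The preimage of the simplex is as small as desired when e is, so it lies in
    the region where X agrees with its tangent cone. *)
Lemma chart_of_tangent n (X : set 'rV[R]_n) x k (p : 'rV[R]_k.+1) s s' F G :
  pl_on X idfun -> X x -> simplex p ->
  chomeo s s' (tangent X x) (tangent (@simplex R k) p) F G ->
  exists (U : set 'rV[R]_n) h, [/\ (forall y, U y -> X y), within X (nbhs x) U,
    pl_homeo U (@simplex R k) h & h x = p].
Proof.
move=> Xpl Xx Sp [cF cG XY YX].
have [d1 [_ [d10 _ loc1 _]]] := germ Xpl Xx.
have [d2 [_ [d20 _ loc2 _]]] := germ (pl_simplex k) Sp.
have [K K0 HK] := cpl_lipschitz cG; have [K' K'0 HK'] := cpl_lipschitz cF.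
(* K bounds the inverse of F, and points of the simplex differ by at most 1 *)
pose e := d1 / K; have e0 : 0 < e by rewrite divr_gt0.
have Ke : K * e = d1 by rewrite /e mulrC divfK // gt_eqF.
have e1 : 0 < e^-1 by rewrite invr_gt0.
pose h y := p + e^-1 *: F (y - x); pose g z := x + G (e *: (z - p)).
pose U : set 'rV[R]_n := fun y => tangent X x (y - x) /\ simplex (h y).
have Tz z : simplex z -> tangent (@simplex R k) p (e *: (z - p)).
  move=> Sz; have [|] // := @cpl_homo R _ _ _ _ e (z - p) cG (ltW e0) _.
  exists 1 => // t t0 t1; have [z0 tz] := Sz; have [p0 tp] := Sp.
  have -> : p + t *: (z - p) = (1 - t) *: p + t *: z.
    by apply/rowP => i; rewrite !mxE; ring.
  split=> [i|]; first by rewrite !mxE addr_ge0 // mulr_ge0 ?subr_ge0 // ltW.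
  by rewrite -[LHS]/(total _) scalar_total totalZ /total tz tp; ring.
have hx z : h z - p = e^-1 *: F (z - x) by rewrite /h addrAC subrr add0r.
have Fh y : F (y - x) = e *: (h y - p) by rewrite hx scalerA divff ?gt_eqF // scale1r.
have gh y : U y -> g (h y) = y.
  by move=> [Ty _]; rewrite /g -Fh; have [_ -> _] := XY _ Ty; rewrite addrC subrK.
have gx z : g z - x = G (e *: (z - p)) by rewrite /g addrAC subrr add0r.
have hg z : simplex z -> h (g z) = z.
  move=> Sz; have [_ FG] := YX _ (Tz z Sz).
  by rewrite /h gx FG scalerA mulVf ?gt_eqF // scale1r addrC subrK.
have UX y : U y -> X y.
  move=> Uy; rewrite -(gh y Uy); case: Uy => Ty Sh.
  have [TG _] := YX _ (Tz _ Sh); apply/loc1 => // i.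
  have be : box e (e *: (h y - p)).
    move=> j; rewrite mxE normrM gtr0_norm // -[leRHS]mulr1 ler_pM2l //.
    exact: simplex_bound.
  by have := HK _ e (ltW e0) (Tz _ Sh) be i; rewrite Ke.
have Ug z : simplex z -> U (g z).
  by move=> Sz; rewrite /U hg // gx; have [] := YX _ (Tz z Sz).
have xT : tangent X x 0 by exists 1 => // t _ _; rewrite scaler0 addr0.
have hx0 : h x = p.
  have [_ F0] := cpl_homo cF (lexx 0) xT; rewrite !scale0r in F0.
  by rewrite /h subrr F0 scaler0 addr0.
exists U, h; split=> //.
- apply/nbhs_within; have r0 : 0 < e * d2 / K' by rewrite divr_gt0 // mulr_gt0.
  exists (Num.min d1 (e * d2 / K')) => [|v bv Xv]; first by rewrite lt_min d10.
  have bv1 : box d1 v by apply: boxS bv; rewrite ge_min lexx.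
  have bv2 : box (e * d2 / K') v by apply: boxS bv; rewrite ge_min lexx orbT.
  have xv : x + v - x = v by rewrite addrAC subrr add0r.
  have Tv := (loc1 v bv1).1 Xv.
  rewrite /U /h xv; split=> //; have [TF _ _] := XY _ Tv.
  apply/loc2.
    move=> i; rewrite mxE normrM gtr0_norm // ler_pdivrMl //.
    by have := HK' v _ (ltW r0) Tv bv2 i; rewrite mulrC divfK // gt_eqF.
  by have [] := cpl_homo cG (ltW e1) TF.
- split.
  + have P1 := pl_comp (pl_affine 1 (- x)) (cpl_pl cF).
    have P2 := pl_comp (pl_comp P1 (pl_affine e^-1 p)) (pl_simplex k).
    apply: pl_ext P2 _ _ => y; first by rewrite /U /h /= scale1r [p + _]addrC; tauto.
    by move=> _; rewrite /h /= scale1r addrC.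
  + by move=> y [].
  + exists g; split=> //.
    have P1 := pl_comp (pl_comp (pl_simplex k) (pl_affine e (- (e *: p)))) (cpl_pl cG).
    apply: pl_ext (pl_comp P1 (pl_affine 1 x)) _ _ => z.
      rewrite /= -scalerBr; split=> [[[[]]]//|Sz]; split=> //; split=> //.
      exact: Tz.
    by move=> _; rewrite /= scale1r -scalerBr /g addrC.
Qed.

Section Manifold.
Variables (d : Order.disp_t) (P : finPOrderType d).
Implicit Types A B : {set P}.

Lemma pl_polyhedron A : pl_on (@polyhedron R d P A) idfun.
Proof. exact: pl_on_slice (slice_order_cone R A) (cpl_order_cone R A). Qed.

(** The derivative of the chart at x. A chart tells which points are on the
    boundary at its own centre only, so to see that the chart at x identifies the
    boundaries nearby one compares it with the charts centred at the points near
    x, by means of the invariance of the boundary. *)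
Lemma manifold_tangent n A B x : is_manifold R n A B -> @polyhedron R d P A x ->
  exists (k : nat) (p : 'rV[R]_k.+1) F G, [/\ n = k%:Z, simplex p,
    chomeo (fun=> 0) (fun=> 0) (tangent (polyhedron A) x) (tangent (@simplex R k) p) F G,
    polyhedron B x <-> bd_simplex p &
    forall v, tangent (polyhedron A) x v ->
      (tangent (polyhedron B) x v <-> tangent (@bd_simplex R k) p (F v))].
Proof.
move=> [_ HA] Ax; have [k [U [h [nk UA /nbhs_within[r r0 rU] hU Bx]]]] := HA x Ax.
have Ux : U x.
  by rewrite -[x]addr0; apply: rU; rewrite ?addr0 // => i; rewrite mxE normr0 ltW.
have [_ US _] := hU.
have tU y s v : 0 < s -> (forall v, box s v -> box r (y - x + v)) ->
    tangent U y v <-> tangent (polyhedron A) y v.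
  move=> s0 Hs; apply: (@tangent_local R _ _ _ _ s) => // w bw; split=> [/UA//|].
  have -> : y + w = x + (y - x + w) by rewrite !addrA [x + y]addrC addrK.
  by move=> Aw; apply: rU => //; apply: Hs.
have [dd [F [G [dd0 hFG hF]]]] := germ_homeo hU Ux.
have tUx v : tangent U x v <-> tangent (polyhedron A) x v.
  by apply: (tU x r) => // w; rewrite subrr add0r.
exists k, (h x), F, G; split=> //.
- exact: US.
- by apply: chomeo_ext hFG _ _ _ _.
- move=> v /tUx Tv; have [cF _ _ _] := hFG.
  have r2 : 0 < r / 2 by rewrite divr_gt0.
  apply: (@germ_homeo_sub R _ _ U _ _ h F x dd (r / 2)) => // w bw Uw.
  have Aw := UA _ Uw.
  have [k' [U' [h' [nk' U'A /nbhs_within[r' r'0 rU'] hU' ->]]]] := HA _ Aw.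
  have E : k' = k by apply/eqP; rewrite -eqz_nat -nk' nk.
  subst k'.
  have U'w : U' (x + w).
    by rewrite -[x + w]addr0; apply: rU'; rewrite ?addr0 // => i; rewrite mxE normr0 ltW.
  have [_ US' _] := hU'.
  have [_ [F1 [G1 [_ hFG1 _]]]] := germ_homeo hU Uw.
  have [_ [F2 [G2 [_ hFG2 _]]]] := germ_homeo hU' U'w.
  have tUw v' : tangent U (x + w) v' <-> tangent (polyhedron A) (x + w) v'.
    apply: (tU _ (r / 2)) => // w' bw' i.
    have -> : x + w - x = w by rewrite addrAC subrr add0r.
    by rewrite mxE; apply: le_trans (ler_normD _ _) _; have := bw i; have := bw' i; lra.
  have tU'w v' : tangent U' (x + w) v' <-> tangent (polyhedron A) (x + w) v'.
    apply: (@tangent_local R _ _ _ _ r') => // w' bw'; split=> [/U'A//|]; exact: rU'.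
  have hFG1' : chomeo (fun=> 0) (fun=> 0) (tangent U' (x + w))
      (tangent (@simplex R k) (h (x + w))) F1 G1.
    by apply: chomeo_ext hFG1 _ _ _ _ => // v'; rewrite tUw tU'w.
  have H := chomeo_trans (chomeo_sym hFG1') hFG2.
  split; last exact: bd_simplex_invariant (US _ Uw) (US' _ U'w) H.
  exact: bd_simplex_invariant (US' _ U'w) (US _ Uw) (chomeo_sym H).
Qed.

End Manifold.

End Charts.

(** * Comanifolds *)

Section Models.
Variable R : realType.

Definition barycenter k : 'rV[R]_k.+1 := const_mx (k.+1%:R^-1).

Lemma simplex_barycenter k : simplex (barycenter k).
Proof.
split=> [i|]; first by rewrite mxE invr_ge0 ler0n.
rewrite (eq_bigr (fun=> k.+1%:R^-1)) => [|i _]; last by rewrite mxE.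
by rewrite sumr_const card_ord -[LHS]mulr_natl divff // pnatr_eq0.
Qed.

Lemma barycenter_interior k : ~ bd_simplex (barycenter k).
Proof. by move=> [_ [i /eqP]]; rewrite mxE invr_eq0 pnatr_eq0. Qed.

Definition vertex k : 'rV[R]_k.+1 := delta_mx 0 0.

Lemma bd_simplex_vertex k : bd_simplex (vertex k.+1).
Proof.
split; first split.
- by move=> i; rewrite mxE ler0n.
- rewrite (bigD1 ord0) //= mxE !eqxx big1 ?addr0 // => i i0.
  by rewrite mxE (negPf i0) andbF.
- by exists ord_max; rewrite mxE andbF.
Qed.

Lemma interior_model k : exists F G,
  chomeo (fun=> 0) (fun=> 0) (@bd_orthant R k.+1) (tangent (@simplex R k) (barycenter k)) F G.
Proof.
have [F [G H]] := bd_orthant_linear R k; exists F, G.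
apply: chomeo_ext H _ _ _ _ => // v.
by rewrite tangent_simplex_flat //; [exact: simplex_barycenter|exact: barycenter_interior].
Qed.

(** At the vertex 0 the tangent cone of the simplex is given by the other
    coordinates, which are nonnegative and otherwise free. *)
Lemma boundary_model k : exists F G,
  chomeo (fun=> 0) (fun=> 0) (@orthant R k.+1) (tangent (@simplex R k.+1) (vertex k.+1)) F G.
Proof.
pose F (x : 'rV[R]_k.+1) : 'rV[R]_(1 + k.+1) := row_mx (- total x)%:M x.
pose G (y : 'rV[R]_(1 + k.+1)) := rsubmx y.
have Fl : linear F.
  move=> a u v; rewrite /F scale_row_mx add_row_mx; congr row_mx.
  by apply/rowP => j; rewrite !ord1 !mxE scalar_total !mulr1n; ring.
have Gl : linear G := @linear_rsub R 1 k.+1.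
exists F, G.
have Sv : simplex (vertex k.+1) := (bd_simplex_vertex k).1.
pose C := corner (zeros (vertex k.+1)) (@flat R k.+2).
have T v : tangent (@simplex R k.+1) (vertex k.+1) v <-> C v by exact: tangent_simplex.
have Z (i : 'I_k.+1) : zeros (vertex k.+1) (rshift 1 i : 'I_(1 + k.+1)).
  by rewrite /zeros mxE.
apply: (@chomeo_ext R _ _ (fun=> 0) _ (fun=> 0) _ (@orthant R k.+1) _ C) => //; last first.
  by move=> v; apply iff_sym; apply: T.
apply: chomeo_lin.
- by apply: cpl_polycone; apply: polycone_orthant.
- by apply: cpl_polycone; apply: polycone_corner; apply: polycone_flat.
- exact: Fl.
- exact: Gl.
- move=> x Ox; split=> //; last by rewrite /G /F row_mxKr.
  split.
    rewrite /flat -[X in X = 0]/(total (F x : 'rV[R]_(1 + k.+1))) totalD.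
    by rewrite /sum_gauge row_mxKl row_mxKr total1 mxE mulr1n addNr.
  move=> i; rewrite -(splitK (i : 'I_(1 + k.+1))).
  case: (split _) => j /=; last first.
    have E : F x 0 (rshift 1 j) = x 0 j := row_mxEr _ _ _ _.
    by move=> _; have := Ox j; rewrite -E.
  by rewrite /zeros mxE (ord1 j) oner_eq0.
- move=> y [Vy y0]; split=> [i|]; first by rewrite /G mxE; apply: y0.
  apply: (etrans _ (hsubmxK (y : 'rV[R]_(1 + k.+1)))); rewrite /F; congr row_mx.
  have := totalD (y : 'rV[R]_(1 + k.+1)); rewrite [LHS]Vy /sum_gauge total1 => /esym/eqP.
  rewrite addr_eq0 => /eqP E; apply/rowP => i; rewrite !ord1 mxE mulr1n.
  by rewrite E.
Qed.

End Models.

Section Comanifold.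
Variables (R : realType) (d d' : Order.disp_t).
Variables (M : finPOrderType d) (N : finPOrderType d') (f : M -> N) (m : int) (Z : {set N}).
Hypothesis NZ : cell_complex_cobd R (opset [set: N]) (opset Z).
Hypothesis fM : comanifold_of_dim R f m.

Let fmono x y : (x <= y)%O -> (f x <= f y)%O.
Proof. by case: fM => H _ _; apply: H. Qed.

Section Point.
Variable x : 'rV[R]_#|M|.
Hypothesis Mx : @polyhedron R _ M [set: M] x.
Variable e : M.
Hypotheses (ex : e \in carrier x) (emax : forall p, p \in carrier x -> (p <= e)%O).

Let L : {set N^d^d} := opset (bd_cone (opset [set: N]) (f e : N^d)).
Let A (E : {set N^d^d}) : {set M} := [set y | (f y <= f e)%O || ((f y : N^d^d) \in E)].
Let T E := tangent (@polyhedron R _ M (A E)) x.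

Let inL (n : N) : ((n : N^d^d) \in L) = (f e < n)%O.
Proof. by rewrite !inE. Qed.

Let x0 : orthant x.
Proof. by have [_ _ _ H] := slice_order_cone R [set: M]; have [[]] := (H x).1 Mx. Qed.

Let r := x 0 (enum_rank e) / 2.

Let r0 : 0 < r.
Proof. by rewrite divr_gt0 // lt_neqAle eq_sym -carrierP ex x0. Qed.

Let near v : box r v -> e \in carrier (x + v).
Proof.
move=> bv; rewrite carrierP mxE; apply/eqP => H.
by have := bv (enum_rank e); have := r0; rewrite /r ler_norml => h1 /andP[h2 _]; lra.
Qed.

Let polyP (B : {set M}) y : @polyhedron R _ M B y <->
  [/\ orthant y, total y = 1, chain (carrier y) & carrier y \subset B].
Proof.
have [_ _ _ H] := slice_order_cone R B; rewrite H; split=> [[[? ? ?] ?]|[? ? ? ?]] //.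
Qed.

Let local_eq (B C : {set M}) v :
  (forall c : {set M}, chain c -> e \in c -> (c \subset B <-> c \subset C)) ->
  tangent (@polyhedron R _ M B) x v <-> tangent (@polyhedron R _ M C) x v.
Proof.
move=> BC; apply: (@tangent_local R _ _ _ _ r) => // w /near ew.
by rewrite !polyP; split=> -[? ? cy ?]; split=> //; apply/BC.
Qed.

Let f_dichotomy (c : {set M}) y : chain c -> e \in c -> y \in c -> (f y <= f e)%O || (f e < f y)%O.
Proof.
move=> /chainP cc ec yc; have /orP[/fmono ->//|/fmono] := cc y e yc ec.
by rewrite le_eqVlt => /orP[/eqP ->|->]; rewrite ?lexx ?orbT.
Qed.

Let in_base (B : {set M}) : (forall y, (f y <= f e)%O -> y \in B) -> @polyhedron R _ M B x.
Proof.
move=> HB; have [Ox tx cx _] := (polyP _ _).1 Mx; apply/polyP; split=> //.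
by apply/subsetP => p /emax/fmono; apply: HB.
Qed.

(** The fibration lemma for tangent cones at x. Close to x all chains contain e,
    so an element of such a chain maps below f e or into L. *)
Lemma tangent_fibration : exists (k : nat) F G,
  m - dim_poset (cone [set: N^d] (f e : N^d)) = k%:Z /\
  chomeo (fun=> 0) (fun=> 0) (tangent (@polyhedron R _ M [set: M]) x)
    (prodc (@bd_orthant R k.+1) (@order_cone R _ _ L)) F G.
Proof.
have TI E F v : closed_in L E -> closed_in L F -> (T (E :&: F) v <-> T E v /\ T F v).
  move=> Ecl Fcl; rewrite -tangentI; apply: (@tangent_local R _ _ _ _ 1) => // w _.
  have AEF : A (E :&: F) = A E :&: A F.
    by apply/setP => y; rewrite !inE; case: (_ <= _)%O.
  rewrite AEF !polyP subsetI; split=> [[? ? ? /andP[? ?]]|[[? ? ? a] [_ _ _ b]]] //.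
  by split=> //; rewrite a.
have TU E F v : closed_in L E -> closed_in L F -> (T (E :|: F) v <-> T E v \/ T F v).
  move=> Ecl Fcl.
  have H : tangent (@polyhedron R _ M (A (E :|: F))) x v <->
      tangent (fun y => @polyhedron R _ M (A E) y \/ @polyhedron R _ M (A F) y) x v.
    apply: (@tangent_local R _ _ _ _ r) => // w /near ew; rewrite !polyP; split; last first.
      case=> -[? ? ? s]; split=> //; apply: subset_trans s _; apply/subsetP => y; rewrite !inE.
        by case/orP=> ->; rewrite ?orbT.
      by case/orP=> ->; rewrite ?orbT.
    move=> [Oy ty cy yA]; have [|p pc pmax] := chain_max cy; first by apply/set0Pn; exists e.
    have key (E' : {set N^d^d}) : closed_in L E' -> (f p : N^d^d) \in E' ->
        carrier (x + w) \subset A E'.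
      move=> E'cl pE; apply/subsetP => y yc; rewrite inE.
      have /orP[->//|ye] := f_dichotomy cy ew yc.
      apply/orP; right; apply: (E'cl.2 (f y : N^d^d) (f p)) => //; first by rewrite inL.
      exact: (fmono (pmax y yc)).
    have := subsetP yA p pc; rewrite !inE => /or3P[pe|pE|pF].
    - left; split=> //; apply/subsetP => y yc; rewrite inE.
      by rewrite (le_trans (fmono (pmax y yc)) pe).
    - by left; split=> //; apply: key.
    - by right; split=> //; apply: key.
  rewrite [X in X <-> _]H; split; first by apply: tangentU; apply: pl_polyhedron.
  by case=> S; apply: tangentS S => y Hy; [left|right].
have Tcol t : t \in L -> collared 0 (fun=> 0) (T (cone L t)) (T (bd_cone L t)).
  rewrite inL => et; have [_ _ /(_ t) Ht] := fM.
  have Bx : @polyhedron R _ M (f @^-1: cone [set: N] t) x.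
    by apply: in_base => y ye; rewrite !inE (le_trans ye (ltW et)).
  have Bbx : @polyhedron R _ M (f @^-1: bd_cone [set: N] t) x.
    by apply: in_base => y ye; rewrite !inE (le_lt_trans ye et).
  have [k [p [F [G [_ Sp hFG Bp hB]]]]] := manifold_tangent Ht Bx.
  have Bdp := Bp.1 Bbx.
  have sub v : tangent (@polyhedron R _ M (f @^-1: bd_cone [set: N] t)) x v ->
      tangent (@polyhedron R _ M (f @^-1: cone [set: N] t)) x v.
    apply: tangentS => y; rewrite !polyP => -[? ? ? s]; split=> //.
    by apply: subset_trans s _; apply/subsetP => z; rewrite !inE /= => /ltW.
  apply: collared_sub (collared_transport hFG sub hB (tangent_simplex_collared Bdp)) _ _ => v.
    apply: local_eq => c cc ec; split=> /subsetP s; apply/subsetP => y yc; have := s y yc.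
      rewrite !inE /= => yt; have /orP[->//|ye] := f_dichotomy cc ec yc.
      by apply/orP; right; apply/andP; split.
    rewrite !inE /= => /orP[ye|/andP[_ yt]]; last exact: yt.
    exact: le_trans ye (ltW et).
  apply: local_eq => c cc ec; split=> /subsetP s; apply/subsetP => y yc; have := s y yc.
    rewrite !inE /= => yt; have /orP[->//|ye] := f_dichotomy cc ec yc.
    by apply/orP; right; apply/andP; split.
  rewrite !inE /= => /orP[ye|/andP[_ yt]]; last exact: yt.
  exact: le_lt_trans ye et.
have [_ _ /(_ (f e)) He] := fM.
have Bx : @polyhedron R _ M (f @^-1: cone [set: N] (f e)) x.
  by apply: in_base => y ye; rewrite !inE.
have [k [p [F [G [dk Sp hFG Bp _]]]]] := manifold_tangent He Bx.
have Np : ~ bd_simplex p.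
  move=> /Bp/polyP[_ _ _ /subsetP/(_ e ex)].
  by rewrite !inE ltxx.
have A0 : A finset.set0 = f @^-1: cone [set: N] (f e).
  by apply/setP => y; rewrite !inE orbF.
have cT0 : cpl_on (T finset.set0) idfun.
  by rewrite /T A0; have [cF _ _ _] := hFG; apply: cpl_id cF.
have [h [g [hg _]]] := fibration TI TU Tcol cT0.
have [F1 [G1 H1]] := bd_orthant_linear R k.
have hbase : chomeo (fun=> 0) (fun=> 0) (T finset.set0) (@bd_orthant R k.+1) (G1 \o F) (G \o F1).
  apply: chomeo_trans (chomeo_sym H1); rewrite /T A0.
  by apply: chomeo_ext hFG _ _ _ _ => // v; rewrite tangent_simplex_flat.
have H2 := chomeo_prod hbase (chomeo_id (fun=> 0) (cpl_order_cone R L)).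
exists k; do 2!eexists; split; first exact: dk.
apply: chomeo_ext (chomeo_trans (chomeo_ungauge hg) (chomeo_ungauge H2)) _ _ _ _ => // v.
apply: local_eq => c cc ec; split=> _; apply/subsetP => y yc; first by rewrite inE.
by rewrite inE inL; apply: f_dichotomy cc ec yc.
Qed.

(** The tangent cone is R^k x K(L), where K(L) is the cone over a sphere or a
    ball according to whether f e, and so x, is off or on the boundary. The
    dimension of K(L) is the height of L, which is also m - k. *)
Lemma comanifold_chart : exists (k : nat) (U : set 'rV[R]_#|M|) (h : 'rV[R]_#|M| -> 'rV[R]_k.+1),
  [/\ m = k%:Z, (U `<=` @polyhedron R _ M [set: M])%classic,
      within (@polyhedron R _ M [set: M]) (nbhs x) U, pl_homeo U (@simplex R k) h
    & @polyhedron R _ M (f @^-1: Z) x <-> bd_simplex (h x)].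
Proof.
have [k [F [G [dk hFG]]]] := tangent_fibration.
have hL : height (cone [set: N^d] (f e : N^d)) = (height L).+1.
  rewrite height_cone /L height_opset; congr (height _).+1.
  by apply/setP => y; rewrite !inE.
have mE : m = k%:Z + (height L)%:Z.
  move: dk; rewrite /dim_poset -/(height _) hL -addn1 PoszD addrK => /eqP.
  by rewrite subr_eq => /eqP.
have [Zop Ns Nb] := NZ.
have Zx : @polyhedron R _ M (f @^-1: Z) x <-> f e \in Z.
  split=> [/polyP[_ _ _ /subsetP/(_ e ex)]|eZ]; first by rewrite inE.
  apply: in_base => y ye; rewrite inE.
  by have := Zop.2 (f y) (f e : N^d); rewrite !inE; apply.
have Xpl := @pl_polyhedron R _ M [set: M].
have cid := @chomeo_id R k.+1 (@total R k.+1) _ (@cpl_bd_orthant R k.+1).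
have [eZ|eZ] := boolP (f e \in Z).
  have [|_ [n [H1 [G1 [hg1 _]]]]] := (is_ballP R _ _).1 (Nb (f e : N^d) _); first by rewrite inE.
  have [h [g [hg _]]] := join_ball cid hg1.
  have nE : (n.+1 = height L)%N.
    apply/eqP; rewrite eqn_leq; apply/andP; split.
      exact: rank_order_cone_le (has_rank_chomeo (chomeo_sym hg1) (rank_orthant R n.+1)).
    exact: rank_orthant_le (has_rank_chomeo hg1 (rank_order_cone R L)).
  have [F2 [G2 hg2]] := boundary_model R (k + n).
  have H := chomeo_trans (chomeo_trans hFG (chomeo_ungauge hg)) hg2.
  have [U [c [UX Un Uc cx]]] := chart_of_tangent Xpl Mx (bd_simplex_vertex R (k + n)).1 H.
  exists (k + n).+1, U, c; split=> //.
    by rewrite mE -nE -PoszD addnS.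
  by rewrite Zx cx; split=> // _; apply: bd_simplex_vertex.
have eT : (f e : N^d) \in opset [set: N] by rewrite !inE.
have eZ' : (f e : N^d) \notin opset Z by rewrite inE.
have [n [H1 [G1 hg1]]] := (is_sphereP R _).1 (Ns (f e : N^d) eT eZ').
have [h [g hg]] := join_sphere cid hg1.
have nE : (n = height L)%N.
  apply/eqP; rewrite eqn_leq; apply/andP; split.
    exact: rank_order_cone_le (has_rank_chomeo (chomeo_sym hg1) (rank_bd_orthant R n)).
  exact: rank_bd_orthant_le (has_rank_chomeo hg1 (rank_order_cone R L)).
have [F2 [G2 hg2]] := interior_model R (k + n).
have H := chomeo_trans (chomeo_trans hFG (chomeo_ungauge hg)) hg2.
have [U [c [UX Un Uc cx]]] := chart_of_tangent Xpl Mx (simplex_barycenter R (k + n)) H.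
exists (k + n)%N, U, c; split=> //.
  by rewrite mE -nE -PoszD.
by rewrite Zx cx; split=> [fZ|/barycenter_interior//]; rewrite fZ in eZ.
Qed.

End Point.

Lemma comanifold_total : is_manifold R m [set: M] (f @^-1: Z).
Proof.
split.
  have [Zop _ _] := NZ; split=> [|x y _]; first exact: subsetT.
  rewrite !inE => fyZ /fmono xy.
  by have := Zop.2 (f x : N^d) (f y : N^d); rewrite !inE; apply.
move=> x Mx.
have : carrier x != finset.set0.
  rewrite carrier_eq0; apply/eqP => x0; have [_ _ _ H] := slice_order_cone R [set: M].
  have [_] := (H x).1 Mx; rewrite x0 (scalar_0 (@scalar_total R _)).
  by move=> /eqP; rewrite eq_sym oner_eq0.
have [_ _ _ H] := slice_order_cone R [set: M]; have [[_ cx _] _] := (H x).1 Mx.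
move=> /(chain_max cx)[e ex emax].
exact: comanifold_chart Mx e ex emax.
Qed.

End Comanifold.

Theorem theorem16p7 (R : realType) :
  (forall (d d' : Order.disp_t) (P : finPOrderType d) (Q : finPOrderType d')
      (f : P -> Q) (Z : {set Q}),
    cellular R f -> open_in [set: Q]%SET Z ->
    (cell_complex_cobd R [set: Q]%SET Z ->
       cell_complex_cobd R [set: P]%SET (f @^-1: Z)) /\
    ((forall q : Q, exists p : P, f p = q) ->
       cell_complex_cobd R [set: P]%SET (f @^-1: Z) ->
       cell_complex_cobd R [set: Q]%SET Z))
  /\
  (forall (d d' : Order.disp_t) (M : finPOrderType d) (N : finPOrderType d')
      (f : M -> N) (m : int) (Z : {set N}),
    cell_complex_cobd R (opset [set: N]%SET) (opset Z) ->
    (comanifold_of_dim R f m ->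
       is_manifold R m [set: M]%SET (f @^-1: Z)) /\
    (pseudo_comanifold_of_dim R f m ->
       pseudostar_manifold R m [set: M]%SET (f @^-1: Z))).
Proof.
split=> [d d' P Q f Z fcell Zop|d d' M N f m Z NZ]; split.
- exact: cellular_pullback.
- exact: cellular_pushforward.
- exact: comanifold_total.
- exact: pseudo_comanifold_total.
Qed.
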